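(* Fix $r\ge2$, $q\in(0,1)$, and let $\tau_n\sim\mathrm{Mallows}(n,q)$ for each $n\ge1$. Then, in distribution as $n\to\infty$, $$\frac{\mathrm{Occ}(\mathrm{id}_r,\tau_n)-\binom nr+\binom{n}{r-1}(r-1)\frac{\mathbb{E}[\mathrm{inv}(B)]}{\mathbb{E}[|B|]}}{n^{r-3/2}}\longrightarrow\mathcal{N}(0,\gamma_r^2),$$ where $B\sim\mathrm{MBlock}(q)$ and $\gamma_r^2>0$ is given by $$\gamma_r^2=\frac{\mathbb{E}[|B|]^{-3}}{(r-2)!^2}\,\mathrm{Var}\Big[\mathbb{E}[\mathrm{inv}(B)]\,|B|-\mathbb{E}[|B|]\,\mathrm{inv}(B)\Big].$$ This also holds with convergence of all moments.
   Context: $\mathbb{N}^*=\{1,2,\dots\}$, $[n]=\{1,\dots,n\}$, $\mathfrak{S}_n$ is the symmetric group on $[n]$, $\mathfrak{S}_\infty$ is the set of bijections of $\mathbb{N}^*$, $|\sigma|=n$ for $\sigma\in\mathfrak{S}_n$, and $\mathrm{id}_r$ is the identity of $\mathfrak{S}_r$. For $\sigma\in\mathfrak{S}_n$, $\mathrm{inv}(\sigma)$ is the number of pairs $i<j$ with $\sigma(i)>\sigma(j)$. $\mathrm{Mallows}(n,q)$ is the law on $\mathfrak{S}_n$ giving mass $q^{\mathrm{inv}(\sigma)}/Z_{n,q}$ to $\sigma$, $Z_{n,q}=\prod_{k=1}^n\frac{1-q^k}{1-q}$. $\mathrm{Occ}(\mathrm{id}_r,\tau)$ is the number of increasing subsequences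 of length $r$ of $\tau$, i.e. of subsets $\{i_1<\dots<i_r\}$ with $\tau(i_1)<\dots<\tau(i_r)$. The direct sum $\sigma\oplus\rho\in\mathfrak{S}_{\ell+m}$ of $\sigma\in\mathfrak{S}_\ell,\rho\in\mathfrak{S}_m$ is given by $(\sigma\oplus\rho)(i)=\sigma(i)$ for $i\le\ell$, $(\sigma\oplus\rho)(\ell+i)=\ell+\rho(i)$ for $1\le i\le m$; infinite direct sums are defined likewise. A finite permutation that is not a direct sum of two non-empty permutations is called a block. For $\Sigma\in\mathfrak{S}_\infty$ let $r_i(\Sigma)=|\{j>i:\Sigma(j)<\Sigma(i)\}|$; the sequence $(r_i(\Sigma))_{i\ge1}$ determines $\Sigma$ and can be any sequence of nonnegative integers with infinitely many zeros. $\Sigma\sim\mathrm{Mallows}(\mathbb{N}^*,q)$ means that $(r_i(\Sigma)+1)_{i\ge1}$ are i.i.d. with $\mathbf{P}(R=j)=(1-q)q^{j-1}$, $j\ge1$. Then $\Sigma=B_1\oplus B_2\oplus\cdots$ with $(B_k)$ i.i.d. random finite blocks, and $\mathrm{MBlock}(q)$ is the law of $B_1$; its size has finite moments of all orders. *)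

(* Defs.v *)
From HB Require Import structures.
From mathcomp Require Import all_boot all_order all_algebra all_fingroup finmap.
From mathcomp Require Import all_classical all_reals all_analysis.
Set Implicit Arguments.
Unset Strict Implicit.
Unset Printing Implicit Defensive.
Import Order.TTheory GRing.Theory Num.Theory.
Import numFieldTopology.Exports numFieldNormedType.Exports.

Local Open Scope ring_scope.

(* Everything is 0-indexed: [n] is 'I_n = {0, ..., n-1}, the positive integers
   are shifted to nat, and a bijection of them is a bijective nat -> nat. *)

Definition inversions (n : nat) (s : 'S_n) : nat :=
  #|[set p : 'I_n * 'I_n | (p.1 < p.2)%N && (s p.2 < s p.1)%N]|.

Definition occ_id (r n : nat) (s : 'S_n) : nat :=
  #|[set A : {set 'I_n} | (#|A| == r) &&
      [forall i in A, forall j in A, (i < j)%N ==> (s i < s j)%N]]|.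

Local Open Scope classical_set_scope.

(* Finite permutations of arbitrary size: the size is tag b and the
   permutation itself is tagged b. *)
Definition finperm := {n : nat & 'S_n}.

Definition FinPerm (n : nat) (s : 'S_n) : finperm := existT (fun n => 'S_n) n s.

Definition dsum_fun (l m : nat) (s : 'S_l) (t : 'S_m) (i : 'I_(l + m)) :
    'I_(l + m) :=
  match fintype.split i with
  | inl j => lshift m (s j)
  | inr j => rshift l (t j)
  end.

Lemma dsum_fun_inj (l m : nat) (s : 'S_l) (t : 'S_m) :
  injective (dsum_fun s t).
Proof.
apply: (can_inj (g := dsum_fun s^-1%g t^-1%g)) => i.
rewrite /dsum_fun; case: (split_ordP i) => j ->.
- by rewrite -[lshift m (s j)]/(unsplit (inl (s j))) unsplitK permK.
- by rewrite -[rshift l (t j)]/(unsplit (inr (t j))) unsplitK permK.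
Qed.

Definition dsum (l m : nat) (s : 'S_l) (t : 'S_m) : 'S_(l + m) :=
  perm (@dsum_fun_inj l m s t).

Definition is_block (b : finperm) : Prop :=
  (0 < tag b)%N /\
  forall (l m : nat) (s : 'S_l) (t : 'S_m),
    (0 < l)%N -> (0 < m)%N -> b <> FinPerm (dsum s t).

(* S = b 0 (+) b 1 (+) ... *)
Definition is_infinite_dsum (S : nat -> nat) (b : nat -> finperm) : Prop :=
  forall (k : nat) (i : 'I_(tag (b k))),
    let offset := (\sum_(j < k) tag (b j))%N in
    S (offset + i)%N = (offset + tagged (b k) i)%N.

(* The first term of the decomposition of S into finite blocks (which is unique
   when it exists), and the empty permutation if there is no decomposition. *)
Definition first_block (S : nat -> nat) : finperm :=
  xget (FinPerm (1%g : 'S_0))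
    [set b0 | exists b : nat -> finperm,
       [/\ forall k, is_block (b k), is_infinite_dsum S b & b0 = b 0%N]].

(* The sets below are finite when S is a bijection, so that the cardinal is
   the actual one. *)
Definition rinv (S : nat -> nat) (i : nat) : nat :=
  #|` fset_set [set j | (i < j)%N /\ (S j < S i)%N] |.

Section Laws.
Context (d : measure_display) (T : measurableType d) (R : realType).
Variable P : probability T R.

(* Random variables with values in a countable type, equipped with the
   discrete sigma-algebra. *)
Definition discrete_rv (U : countType) (X : T -> U) : Prop :=
  forall u : U, measurable (X @^-1` [set u]).

Definition mutually_independent (U : countType) (X : nat -> T -> U) : Prop :=
  forall (J : {fset nat}) (A : nat -> set U),
    P (\bigcap_(i in [set` J]) (X i @^-1` A i)) =
    (\prod_(i <- J) P (X i @^-1` A i))%E.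

Definition geometric_law (q : R) (X : T -> nat) : Prop :=
  forall j : nat, (1 <= j)%N ->
    P (X @^-1` [set j]) = ((1 - q) * q ^+ (j - 1))%:E.

Definition mallows_Z (n : nat) (q : R) : R :=
  \prod_(1 <= k < n.+1) ((1 - q ^+ k) / (1 - q)).

Definition is_Mallows (n : nat) (q : R) (tau : T -> 'S_n) : Prop :=
  discrete_rv tau /\
  forall s : 'S_n, P (tau @^-1` [set s]) = (q ^+ inversions s / mallows_Z n q)%:E.

Definition is_Mallows_infinite (q : R) (Sigma : T -> nat -> nat) : Prop :=
  [/\ forall i, discrete_rv (fun w => Sigma w i),
      forall w, bijective (Sigma w),
      mutually_independent (fun i w => (rinv (Sigma w) i).+1) &
      forall i, geometric_law q (fun w => (rinv (Sigma w) i).+1)].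

End Laws.

(* B ~ MBlock(q): B has the law of the first block of some
   Sigma ~ Mallows(N*, q), possibly defined on another probability space. *)
Definition is_MBlock (d : measure_display) (T : measurableType d)
    (R : realType) (P : probability T R) (q : R) (B : T -> finperm) : Prop :=
  discrete_rv B /\
  exists (d' : measure_display) (T' : measurableType d')
    (P' : probability T' R) (Sigma : T' -> nat -> nat),
    is_Mallows_infinite P' q Sigma /\
    forall b : finperm,
      P (B @^-1` [set b]) = P' [set w | first_block (Sigma w) = b].

Section BlockMoments.
Context (d : measure_display) (T : measurableType d) (R : realType).
Variables (P : probability T R) (B : T -> finperm).

Definition bsize (w : T) : R := (tag (B w))%:R.
Definition binv (w : T) : R := (inversions (tagged (B w)))%:R.

(* fine : \bar R -> R; the expectations and the variance are finite under
   MBlock(q). *)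
Definition mean_size : R := fine ('E_P[bsize])%E.
Definition mean_inv : R := fine ('E_P[binv])%E.

Definition gamma_sq (r : nat) : R :=
  mean_size ^- 3 / ((r - 2)`!%:R ^+ 2) *
  fine ('V_P[fun w => (mean_inv * bsize w - mean_size * binv w)%R])%E.

Definition normalized_occ (r n : nat) (s : 'S_n) : R :=
  ((occ_id r s)%:R - 'C(n, r)%:R
    + 'C(n, r - 1)%:R * (r - 1)%:R * (mean_inv / mean_size))
  / (n%:R `^ (r%:R - 3 / 2)).

End BlockMoments.

Section Convergence.
Context (R : realType) (d : nat -> measure_display).
Context (T : forall n, measurableType (d n)).
Variables (P : forall n, probability (T n) R) (X : forall n, T n -> R).
Variable nu : probability (measurableTypeR R) R.

Definition cvg_in_distribution : Prop :=
  forall f : R -> R, continuous f -> (exists M : R, forall x, `|f x| <= M) ->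
    ('E_(P n)[fun w => f (X w)])%E @[n --> \oo] --> ('E_nu[f])%E.

Definition cvg_moments : Prop :=
  forall p : nat,
    ('E_(P n)[fun w => (X w ^+ p)%R])%E @[n --> \oo] -->
    ('E_nu[fun x : R => (x ^+ p)%R])%E.

End Convergence.

(* Main.v *)
(* Writing an inversion code c_i = #{j < i : s j > s i}, the Mallows(n, q) law
   makes the c_i independent truncated geometric variables, so that inv(s) is a
   sum of independent variables; with m = q / (1 - q) and v = q / (1 - q)^2, a
   recursion on n gives E[(inv - n m)^(2s)] ~ (2s-1)!! (v n)^s and a bound of
   order n^s for the moment of order 2s + 1.  A set of r indices fails to be an
   increasing subsequence as soon as it contains an inverted pair, and the
   second-order Bonferroni inequality yields
     Occ(id_r, s) = C(n, r) - C(n - 2, r - 2) inv(s) + error,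
   where the error is O(n^(r - 3)) times a quadratic function of the codes whose
   moments of order p are O(n^p); hence the error is negligible and the moments
   of the normalized count converge to those of N(0, v / (r - 2)!^2).
   The blocks enter only through the centering and the variance.  Splitting s at
   its first block gives renewal equations for the moments of order 0, 1 and 2 of
   inv(s) - n m, and letting n tend to infinity in them yields Wald's identities
     E[inv B] = m E|B|  and  E[(m |B| - inv B)^2] = v E|B|,
   so that gamma_r^2 = v / (r - 2)!^2.
   Finally, the moments of the normal law grow slowly enough for the Taylor
   series of sin (a x + b) to be exchanged with the limit, and bounded continuous
   functions are reached from these by Bernstein's approximation in sin. *)

Require Import Defs.
From HB Require Import structures.
From mathcomp Require Import all_boot all_order all_algebra all_fingroup finmap.
From mathcomp Require Import all_classical all_reals all_analysis measurable_realfun.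
From mathcomp Require Import ring lra zify.
Set Implicit Arguments.
Unset Strict Implicit.
Unset Printing Implicit Defensive.
Import Order.TTheory GRing.Theory Num.Theory.
Import numFieldTopology.Exports numFieldNormedType.Exports.
Local Open Scope classical_set_scope.
Local Open Scope ring_scope.

(** * Limits of real sequences *)

(** Moments written as finite sums settle both modes of convergence at once, so of the blocks only
    the ratio E[inv B] / E|B| and one variance have to be identified. The obstacle is that B comes
    from an infinite permutation and that its second moments are not known to be finite beforehand.
    The weight (1 - q)^n q^inv is multiplicative over direct sums and is the probability that the
    infinite permutation starts with a given permutation of size n; summed over the size n it gives
    the probability u_n = (1 - q)...(1 - q^n) of a split at n. Since u_n decreases to a positive
    limit, renewal equations in u_n first bound the block sums and then identify their limits. In
    the error term, two inverted pairs sharing an index span only three points, which allows a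
    factor n more than four; their number is at most a sum of squared degrees in the inversion
    graph, and a degree adds a code entry of s to one of its inverse, which has the same law. Real
    sines with a phase replace complex exponentials: their products stay in their span. *)

Section RealSequences.
Variable R : realType.
Implicit Types (a b d u v : nat -> R) (l lb C : R).

Lemma cvgn_dist u l : u n @[n --> \oo] --> l <->
  forall e, 0 < e -> exists N : nat, forall n, (N <= n)%N -> `|u n - l| <= e.
Proof.
split=> [/cvgrPdist_le ul e e0|H].
  have [N _ HN] := ul e e0; exists N => n Nn; rewrite distrC; exact: HN.
apply/cvgrPdist_le => e e0; have [N HN] := H e e0.
by exists N => // n Nn; rewrite /= distrC; exact: HN.
Qed.

Lemma eq_cvgn u v l : u n @[n --> \oo] --> l -> (forall n, u n = v n) ->
  v n @[n --> \oo] --> l.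
Proof. by move=> h e; rewrite (_ : v = u) //; apply/funext => n. Qed.

Lemma cvgnD u v l lb : u n @[n --> \oo] --> l -> v n @[n --> \oo] --> lb ->
  u n + v n @[n --> \oo] --> l + lb.
Proof. exact: cvgD. Qed.

Lemma cvgnB u v l lb : u n @[n --> \oo] --> l -> v n @[n --> \oo] --> lb ->
  u n - v n @[n --> \oo] --> l - lb.
Proof. exact: cvgB. Qed.

Lemma cvgnM u v l lb : u n @[n --> \oo] --> l -> v n @[n --> \oo] --> lb ->
  u n * v n @[n --> \oo] --> l * lb.
Proof. exact: cvgM. Qed.

Lemma cvgn_cst l : l @[n --> \oo] --> l.
Proof. exact: cvg_cst. Qed.

Lemma cvgn_bounded u l : u n @[n --> \oo] --> l ->
  exists2 M, 0 < M & forall n, `|u n| <= M.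
Proof.
move=> /cvgn_dist /(_ 1 ltr01)[N HN].
exists (\sum_(k < N) `|u k| + `|l| + 1).
  by rewrite ltr_wpDl// addr_ge0// sumr_ge0.
move=> n; case: (ltnP n N) => [nN|Nn].
  rewrite (bigD1 (Ordinal nN))//= -!addrA lerDl !addr_ge0// sumr_ge0//.
have s0 : 0 <= \sum_(k < N) `|u k| by apply: sumr_ge0.
have H := HN n Nn; have := ler_normD (u n - l) l; rewrite subrK => H2; lra.
Qed.

Lemma sum_ord_nat (F : nat -> R) n : \sum_(k < n) F k = \sum_(0 <= k < n) F k.
Proof. by rewrite big_mkord. Qed.

Lemma nneg_bounded_sum_cvg a C : (forall k, 0 <= a k) ->
  (forall n, \sum_(k < n) a k <= C) ->
  exists l, [/\ \sum_(k < n) a k @[n --> \oo] --> l, 0 <= l, l <= C &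
    forall n, \sum_(k < n) a k <= l].
Proof.
move=> a0 aC.
have hom : {homo (fun n => \sum_(k < n) a k) : n m / (n <= m)%N >-> n <= m}.
  move=> n m nm; rewrite !sum_ord_nat (big_cat_nat (leq0n n) nm)//= lerDl.
  by apply: sumr_ge0.
have cv : cvgn (fun n => \sum_(k < n) a k).
  by apply: nondecreasing_is_cvgn hom _; exists C => _ [n _ <-].
have le := nondecreasing_cvgn_le hom cv.
exists (limn (fun n => \sum_(k < n) a k)); split => //.
- by have := le 0%N; rewrite big_ord0.
- apply: limr_le => //; apply: nearW => n; exact: aC.
Qed.

(** Writing a as |a| - (|a| - a) gives two nonnegative series with bounded partial sums. *)
Lemma abs_bounded_sum_cvg a C :
  (forall n, \sum_(k < n) `|a k| <= C) ->
  exists l, \sum_(k < n) a k @[n --> \oo] --> l.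
Proof.
move=> aC.
have [l1 [h1 _ _ _]] := nneg_bounded_sum_cvg (fun k => normr_ge0 (a k)) aC.
have p2 k : 0 <= `|a k| - a k by rewrite subr_ge0 ler_norm.
have b2 n : \sum_(k < n) (`|a k| - a k) <= C + C.
  rewrite sumrB; have := aC n.
  have : `|\sum_(k < n) a k| <= \sum_(k < n) `|a k| by exact: ler_norm_sum.
  by rewrite ler_norml => /andP[+ _]; lra.
have [l2 [h2 _ _ _]] := nneg_bounded_sum_cvg p2 b2.
exists (l1 - l2).
apply: (eq_cvgn (cvgnB h1 h2)) => n.
by rewrite sumrB opprB addrC subrK.
Qed.

(** Dominated convergence for a convolution with an absolutely summable kernel; it lets n tend to
    infinity in the renewal equations. *)
Lemma cvg_conv a b C l lb :
  (forall n, \sum_(k < n) `|a k| <= C) ->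
  \sum_(k < n) a k @[n --> \oo] --> l -> b n @[n --> \oo] --> lb ->
  \sum_(k < n.+1) a k * b (n - k)%N @[n --> \oo] --> l * lb.
Proof.
move=> aC al blb.
have C0 : 0 <= C by have := aC 0%N; rewrite big_ord0.
have [M M0 bM] := cvgn_bounded (cvgnB blb (@cvgn_cst lb)).
have [S [Scv S0 _ Sle]] := nneg_bounded_sum_cvg (fun k => normr_ge0 (a k)) aC.
suff H : \sum_(k < n.+1) a k * (b (n - k)%N - lb) @[n --> \oo] --> (0 : R).
  have al1 : \sum_(k < n.+1) a k @[n --> \oo] --> l.
    by rewrite -cvg_shiftS in al.
  have := cvgnD H (cvgnM al1 (@cvgn_cst lb)); rewrite add0r => H'.
  apply: (eq_cvgn H') => n; rewrite mulr_suml -big_split/=.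
  by apply: eq_bigr => k _; rewrite mulrBr subrK.
apply/cvgn_dist => e e0.
have d1 : 0 < e / (2 * (C + 1)) by rewrite divr_gt0// mulr_gt0// ltr_wpDl.
have d2 : 0 < e / (2 * M) by rewrite divr_gt0// mulr_gt0.
have [N1 HN1] := (cvgn_dist _ _).1 blb _ d1.
have [N2 HN2] := (cvgn_dist _ _).1 Scv _ d2.
(* Cut at [N2]: before it the index n - k is large, so b is close to its limit; after it b - lb is
   bounded by M and the tail of the sum of |a| is small. The 1 in C + 1 keeps a denominator
   positive. *)
exists (N1 + N2)%N => n Nn; rewrite subr0.
apply: le_trans (ler_norm_sum _ _ _) _.
rewrite (sum_ord_nat (fun k => `|a k * (b (n - k)%N - lb)|)).
have N2n : (N2 <= n.+1)%N by lia.
rewrite (big_cat_nat (leq0n N2) N2n)//=.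
have -> : e = e / 2 + e / 2 by lra.
apply: lerD.
  apply: (@le_trans _ _ (\sum_(0 <= k < N2) `|a k| * (e / (2 * (C + 1))))).
    rewrite !big_nat; apply: ler_sum => k /andP[_ kN].
    by rewrite normrM ler_wpM2l// HN1//; lia.
  rewrite -mulr_suml -sum_ord_nat.
  apply: (@le_trans _ _ ((C + 1) * (e / (2 * (C + 1))))).
    apply: ler_wpM2r; first exact: ltW.
    by apply: le_trans (aC _) _; rewrite lerDl.
  by rewrite le_eqVlt; apply/orP; left; apply/eqP; field; lra.
apply: (@le_trans _ _ (\sum_(N2 <= k < n.+1) `|a k| * M)).
  rewrite !big_nat; apply: ler_sum => k /andP[_ kN].
  by rewrite normrM ler_wpM2l//; exact: bM.
rewrite -mulr_suml.
have -> : \sum_(N2 <= k < n.+1) `|a k| =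
    \sum_(k < n.+1) `|a k| - \sum_(k < N2) `|a k|.
  by rewrite !(sum_ord_nat (fun k => `|a k|)) (big_cat_nat (leq0n N2) N2n)//=; ring.
have := HN2 N2 (leqnn _); rewrite distrC ger0_norm ?subr_ge0// => h.
apply: (@le_trans _ _ ((e / (2 * M)) * M)).
  apply: ler_wpM2r; first exact: ltW.
  by apply: le_trans h; rewrite lerB.
by rewrite le_eqVlt; apply/orP; left; apply/eqP; field; lra.
Qed.

(** With t the square root of s, one factor t^n pays for one power of n, and the induction continues
    with the other factor t^n. *)
Lemma pow_geom_bounded (p : nat) (s : R) : 0 <= s < 1 ->
  exists2 C, 0 < C & forall n : nat, n%:R ^+ p * s ^+ n <= C.
Proof.
elim: p s => [|p IH] s /andP[s0 s1].
  by exists 1 => // n; rewrite expr0 mul1r exprn_ile1// ltW.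
set t := Num.sqrt s.
have tt : t * t = s by rewrite -expr2 sqr_sqrtr.
have t0 : 0 <= t by exact: sqrtr_ge0.
have t1 : t < 1 by rewrite -sqrtr1 ltr_sqrt.
have [C C0 HC] := IH t (introT andP (conj t0 t1)).
have Hn (n : nat) : n%:R * t ^+ n <= (1 - t)^-1.
  rewrite -[leRHS]mul1r ler_pdivlMr ?subr_gt0//.
  (* The geometric sum of the t^i for i < n has n terms, each at least t^n. *)
  have : n%:R * t ^+ n * (1 - t) <= 1 - t ^+ n.
    elim: n => [|n IHn]; first by rewrite mul0r mul0r expr0 subrr.
    have tn : 0 <= t ^+ n by exact: exprn_ge0.
    have tn1 : n.+1%:R * t ^+ n.+1 * (1 - t) =
      t * (n%:R * t ^+ n * (1 - t)) + t ^+ n.+1 * (1 - t).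
      by rewrite -[n.+1]addn1 natrD !exprD expr1; ring.
    rewrite tn1.
    have := ler_wpM2l t0 IHn; rewrite exprS => h1.
    have h2 : (1 - t) * (t * t^+ n) <= (1 - t) * 1.
      rewrite ler_wpM2l//; first by lra.
      by rewrite -exprS exprn_ile1// ltW.
    nra.
  by have := exprn_ge0 n t0; lra.
exists (C * (1 - t)^-1) => [|n]; first by rewrite mulr_gt0// invr_gt0 subr_gt0.
have -> : n%:R ^+ p.+1 * s ^+ n = (n%:R ^+ p * t ^+ n) * (n%:R * t ^+ n).
  by rewrite -tt exprMn exprS; ring.
by apply: ler_pM => //; rewrite mulr_ge0// exprn_ge0.
Qed.

End RealSequences.

(** * Stolz-Cesaro limits at polynomial scales *)

Section Stolz.
Variable R : realType.
Implicit Types (a b d u v : nat -> R) (l lb C c : R).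

Lemma near_eq_cvgn (N : nat) u v l : u n @[n --> \oo] --> l ->
  (forall n, (N <= n)%N -> u n = v n) -> v n @[n --> \oo] --> l.
Proof.
move=> h e; apply: cvg_trans h; apply: near_eq_cvg.
by exists N => // n /= Nn; rewrite e.
Qed.

Lemma dom_cvgn0 (N : nat) u v : u n @[n --> \oo] --> (0 : R) ->
  (forall n, (N <= n)%N -> `|v n| <= u n) -> v n @[n --> \oo] --> (0 : R).
Proof.
move=> /cvgn_dist h le; apply/cvgn_dist => e e0; have [N1 HN] := h e e0.
exists (N + N1)%N => n Nn; rewrite subr0; have := HN n; rewrite subr0 => h1.
have Nn1 : (N <= n)%N by lia.
apply: le_trans (le n Nn1) _; apply: le_trans (ler_norm _) _; apply: h1; lia.
Qed.

Lemma cvgn_invn : (n%:R : R)^-1 @[n --> \oo] --> (0 : R).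
Proof.
have /cvgn_dist h := @cvg_harmonic R; apply/cvgn_dist => e e0.
have [N HN] := h e e0; exists N.+1 => -[|n] // nN.
by have := HN n; rewrite /= /harmonic; apply; lia.
Qed.

Lemma cvgn_sum (I : finType) (F : I -> nat -> R) (L : I -> R) :
  (forall i, F i n @[n --> \oo] --> L i) ->
  \sum_i F i n @[n --> \oo] --> \sum_i L i.
Proof.
move=> h; elim: (index_enum I) => [|i s IH].
  by under eq_fun do rewrite big_nil; rewrite big_nil; exact: cvgn_cst.
rewrite big_cons; apply: (eq_cvgn (u := fun n => F i n + \sum_(j <- s) F j n)).
  exact: cvgnD.
by move=> n; rewrite big_cons.
Qed.

Lemma cvgnV u l : l != 0 -> u n @[n --> \oo] --> l ->
  (u n)^-1 @[n --> \oo] --> l^-1.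
Proof. exact: cvgV. Qed.

Lemma cvgn_exp u l k : u n @[n --> \oo] --> l -> u n ^+ k @[n --> \oo] --> l ^+ k.
Proof.
move=> h; elim: k => [|k IH].
  by under eq_fun do rewrite expr0; exact: cvgn_cst.
apply: (eq_cvgn (u := fun n => u n * u n ^+ k)) => [|n]; last by rewrite exprS.
by rewrite exprS; exact: cvgnM.
Qed.

Lemma sum_bin_ord k n : (\sum_(i < n) 'C(i, k) = 'C(n, k.+1))%N.
Proof.
elim: n => [|n IH]; first by rewrite big_ord0 bin0n.
by rewrite big_ord_recr /= IH binS.
Qed.

Lemma bin_ge_sub k n : (n - k <= 'C(n, k.+1))%N.
Proof.
elim: n => [|n IH]; first by rewrite sub0n.
rewrite binS; case: (leqP k n) => kn.
  by have := bin_gt0 n k; rewrite kn; lia.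
by rewrite (_ : n.+1 - k = 0)%N //; lia.
Qed.

Lemma ler_norm_divB (x y c e : R) : 0 < y ->
  (`|x / y - c| <= e) = (`|x - c * y| <= e * y).
Proof.
move=> y0; have -> : x / y - c = (x - c * y) / y by field; rewrite gt_eqF.
by rewrite normrM normfV (gtr0_norm y0) ler_pdivrMr.
Qed.

(** With binomial denominators the Stolz-Cesaro argument needs no estimate of increments, because
    ['C(n, k.+1)] is exactly the sum of the ['C(i, k)] for i < n. *)
Lemma stolz_binom k d c : d n / 'C(n, k)%:R @[n --> \oo] --> c ->
  (\sum_(i < n) d i) / 'C(n, k.+1)%:R @[n --> \oo] --> c.
Proof.
move=> /cvgn_dist h; apply/cvgn_dist => e e0.
have e2 : 0 < e / 2 by rewrite divr_gt0.
have [N0 HN0] := h _ e2.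
pose N := (N0 + k.+1)%N.
have HN n : (N <= n)%N -> `|d n - c * 'C(n, k)%:R| <= e / 2 * 'C(n, k)%:R.
  move=> Nn; have C0 : (0 : R) < 'C(n, k)%:R by rewrite ltr0n bin_gt0; lia.
  by rewrite -ler_norm_divB//; apply: HN0; lia.
(* Total error of the indices below N. It is absorbed by the binomial, which is at least n - k and
   hence at least [N2], an integer above K / (e / 2). *)
pose K := \sum_(i < N) `|d i - c * 'C(i, k)%:R|.
have K0 : 0 <= K by apply: sumr_ge0.
pose N2 := (Num.truncn (K / (e / 2))).+1.
exists (N + N2 + k)%N => n Nn.
have C0 : (0 : R) < 'C(n, k.+1)%:R by rewrite ltr0n bin_gt0; lia.
rewrite ler_norm_divB//.
have E1 : \sum_(i < n) d i - c * 'C(n, k.+1)%:R =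
    \sum_(i < n) (d i - c * 'C(i, k)%:R).
  by rewrite sumrB -mulr_sumr -natr_sum sum_bin_ord.
rewrite E1; apply: le_trans (ler_norm_sum _ _ _) _.
have Nn' : (N <= n)%N by lia.
rewrite (sum_ord_nat (fun i => `|d i - c * 'C(i, k)%:R|)).
rewrite (big_cat_nat (leq0n N) Nn')//= -sum_ord_nat -/K.
have -> : e = e / 2 + e / 2 by lra.
rewrite mulrDl lerD//.
  have h1 : K / (e / 2) <= N2%:R by apply: ltW; exact: truncnS_gt.
  rewrite -ler_pdivrMl// mulrC; apply: le_trans h1 _.
  by rewrite ler_nat; have := bin_ge_sub k n; lia.
apply: (@le_trans _ _ (\sum_(N <= i < n) e / 2 * 'C(i, k)%:R)).
  by rewrite !big_nat; apply: ler_sum => i /andP[Ni _]; exact: HN.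
rewrite -mulr_sumr; apply: ler_wpM2l; first exact: ltW.
rewrite -natr_sum ler_nat -(sum_bin_ord k n).
by rewrite -(big_mkord xpredT (fun i => 'C(i, k))) (big_cat_nat (leq0n N) Nn')//= leq_addl.
Qed.

Lemma cvgn_binom_pow k : 'C(n, k)%:R / (n%:R : R) ^+ k @[n --> \oo] --> (k`!%:R^-1 : R).
Proof.
elim: k => [|k IH].
  apply: (eq_cvgn (u := fun=> 1 : R)) => [|n]; last by rewrite bin0 expr0 divr1.
  by rewrite fact0 invr1; exact: cvgn_cst.
have h : (n%:R - k%:R) / (n%:R : R) @[n --> \oo] --> (1 : R).
  apply: (near_eq_cvgn (N := 1) (u := fun n => 1 - k%:R * n%:R^-1)).
    have := cvgnB (cvgn_cst (l := 1 : R)) (cvgnM (cvgn_cst (l := k%:R)) cvgn_invn).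
    by rewrite mulr0 subr0.
  by move=> n n0; rewrite mulrBl divff// pnatr_eq0; lia.
have := cvgnM (cvgn_cst (l := k.+1%:R^-1)) (cvgnM IH h).
rewrite mulr1 -invfM -natrM -factS => h2.
apply: (near_eq_cvgn (N := k.+1) h2) => n kn.
have n0 : (n%:R : R) != 0 by rewrite pnatr_eq0; lia.
have := mul_bin_left n k => /(congr1 (fun x => x%:R : R)).
rewrite !natrM natrB; last lia.
move=> H; have k0 : (k.+1%:R : R) != 0 by rewrite pnatr_eq0.
have -> : 'C(n, k.+1)%:R = (n%:R - k%:R) * 'C(n, k)%:R / k.+1%:R :> R.
  by rewrite -H; field.
rewrite exprS; move: (k.+1%:R : R) k0 => K K0; field.
by rewrite n0 K0 expf_neq0.
Qed.

Lemma stolz_pow k d c : d n / (n%:R) ^+ k @[n --> \oo] --> c ->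
  (\sum_(i < n) d i) / (n%:R) ^+ k.+1 @[n --> \oo] --> c / k.+1%:R.
Proof.
move=> h.
have kf0 j : (j`!%:R^-1 : R) != 0 by rewrite invr_eq0 pnatr_eq0 -lt0n fact_gt0.
have h1 : d n / 'C(n, k)%:R @[n --> \oo] --> c * k`!%:R.
  have := cvgnM h (cvgnV (kf0 k) (@cvgn_binom_pow k)); rewrite invrK => h2.
  apply: (near_eq_cvgn (N := k.+1) h2) => n kn.
  have n0 : (n%:R : R) != 0 by rewrite pnatr_eq0; lia.
  have C0 : ('C(n, k)%:R : R) != 0 by rewrite pnatr_eq0 -lt0n bin_gt0; lia.
  by field; rewrite C0 expf_neq0.
have := cvgnM (stolz_binom h1) (@cvgn_binom_pow k.+1).
have -> : c * k`!%:R / (k.+1)`!%:R = c / k.+1%:R.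
  rewrite factS natrM; have : (k.+1%:R : R) != 0 by rewrite pnatr_eq0.
  move: (k.+1%:R : R) => K K0; field.
  by move: (kf0 k); rewrite invr_eq0 => ->; rewrite K0.
move=> h2; apply: (near_eq_cvgn (N := k.+1) h2) => n kn.
have n0 : (n%:R : R) != 0 by rewrite pnatr_eq0; lia.
have C0 : ('C(n, k.+1)%:R : R) != 0 by rewrite pnatr_eq0 -lt0n bin_gt0; lia.
by field; rewrite C0 ?n0 ?expf_neq0.
Qed.


Lemma abs_sum_cvg0 a C : (forall n, \sum_(i < n) `|a i| <= C) ->
  a n @[n --> \oo] --> (0 : R).
Proof.
move=> h; have [l [hl _ _ _]] := nneg_bounded_sum_cvg (fun k => normr_ge0 (a k)) h.
have hl1 : \sum_(k < n.+1) `|a k| @[n --> \oo] --> l by rewrite -cvg_shiftS in hl.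
have := cvgnB hl1 hl; rewrite subrr => h0.
apply: (dom_cvgn0 (N := 0) h0) => n _.
by rewrite big_ord_recr/= addrAC subrr add0r.
Qed.

End Stolz.

(** * Moments of a sum of independent terms, from a recursion *)

Section MomentRecursion.
Variables (R : realType) (M kappa : nat -> nat -> R) (C1 v : R) (K : nat -> R).
Hypothesis M0 : forall p, M 0 p = (p == 0)%:R.
Hypothesis MS : forall n p,
  M n.+1 p = \sum_(j < p.+1) 'C(p, j)%:R * (kappa n j * M n (p - j)%N).
Hypothesis kappa0 : forall n, kappa n 0 = 1.
Hypothesis kappa1 : forall n, \sum_(i < n) `|kappa i 1| <= C1.
Hypothesis kappa2 : kappa n 2 @[n --> \oo] --> v.
Hypothesis kappaK : forall n j, `|kappa n j| <= K j.

Let incr n p := \sum_(j < p) 'C(p, j.+1)%:R * (kappa n j.+1 * M n (p - j.+1)%N).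

Let M_sum n p : M n p = M 0 p + \sum_(i < n) incr i p.
Proof.
elim: n => [|n IH]; first by rewrite big_ord0 addr0.
rewrite big_ord_recr/= addrA -IH MS big_ord_recl/= bin0 mul1r kappa0 mul1r subn0.
by congr (_ + _); apply: eq_bigr => j _.
Qed.

Let K0 j : 0 <= K j. Proof. exact: le_trans (normr_ge0 _) (kappaK 0 j). Qed.

(** [M n p] stands for the p-th moment of a sum of n independent terms and [kappa i j] for the j-th
    moment of term i. In the increments, first moments are summable over i, and moments of order at
    least two leave a factor of order at most n^(p/2 - 1), to which the sum over i restores one
    power of n. *)
Lemma moment_rec_bound p :
  exists2 B, 0 <= B & forall n, `|M n p| <= B * n.+1%:R ^+ p./2.
Proof.
elim/ltn_ind: p => p IH.
have H (j : nat) : exists B, (j < p)%N -> 0 <= B /\ forall n,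
    \sum_(i < n) `|kappa i j.+1 * M i (p - j.+1)%N| <= B * n.+1%:R ^+ p./2.
  case: (ltnP j p) => jp; last by exists 0.
  have [|B B0 HB] := IH (p - j.+1)%N; first lia.
  (* The index is shifted by one: j = 0 is the first moment, handled by summability. *)
  case: j jp B0 HB => [|j] jp B0 HB.
    exists (C1 * B) => _; split.
      by rewrite mulr_ge0//; have := kappa1 0; rewrite big_ord0.
    move=> n; apply: (@le_trans _ _ (\sum_(i < n) `|kappa i 1| * (B * n.+1%:R ^+ p./2))).
      apply: ler_sum => i _; rewrite normrM ler_wpM2l//.
      apply: le_trans (HB i) _; rewrite ler_wpM2l//.
      apply: (@le_trans _ _ (i.+1%:R ^+ p./2)).
        by apply: ler_weXn2l; [rewrite ler1n|lia].
      by apply: lerXn2r; rewrite ?nnegrE ?ler0n// ler_nat; have := ltn_ord i; lia.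
    rewrite -mulr_suml -mulrA ler_wpM2r//.
    by rewrite mulr_ge0// exprn_ge0// ler0n.
  exists (K j.+2 * B) => _; split; first by rewrite mulr_ge0.
  move=> n; apply: (@le_trans _ _ (\sum_(i < n) K j.+2 * B * n.+1%:R ^+ (p./2).-1)).
    apply: ler_sum => i _; rewrite normrM -mulrA ler_pM//.
    apply: le_trans (HB i) _; rewrite ler_wpM2l//.
    apply: (@le_trans _ _ (i.+1%:R ^+ (p./2).-1)).
      by apply: ler_weXn2l; [rewrite ler1n|lia].
    by apply: lerXn2r; rewrite ?nnegrE ?ler0n// ler_nat; have := ltn_ord i; lia.
  rewrite sumr_const card_ord -[_ *+ n]mulr_natr -[leLHS]mulrA.
  rewrite ler_wpM2l ?mulr_ge0//.
  have -> : p./2 = (p./2).-1.+1 by lia.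
  by rewrite /= exprSr ler_wpM2l ?exprn_ge0 ?ler0n// ler_nat.
have [B HB] := choice H.
have B0 : 0 <= \sum_(j < p) 'C(p, j.+1)%:R * B j.
  by apply: sumr_ge0 => j _; rewrite mulr_ge0 ?ler0n//; have [] := HB j (ltn_ord j).
exists (1 + \sum_(j < p) 'C(p, j.+1)%:R * B j); first by rewrite addr_ge0.
move=> n; rewrite M_sum; apply: le_trans (ler_normD _ _) _; rewrite mulrDl mul1r.
apply: lerD.
  rewrite M0; apply: (@le_trans _ _ 1); last by rewrite exprn_ege1// ler1n.
  by case: (p == 0); rewrite ?normr1 ?normr0.
rewrite /incr exchange_big/= mulr_suml.
apply: le_trans (ler_norm_sum _ _ _) _; apply: ler_sum => j _.
rewrite -mulr_sumr normrM ger0_norm ?ler0n// -mulrA ler_wpM2l ?ler0n//.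
apply: le_trans (ler_norm_sum _ _ _) _.
by have [_] := HB j (ltn_ord j); apply.
Qed.

Lemma succ_pow_bound (s n : nat) : (0 < n)%N ->
  (n.+1%:R : R) ^+ s <= 2 ^+ s * n%:R ^+ s.
Proof.
move=> n0; rewrite -exprMn lerXn2r// ?nnegrE ?ler0n// ?mulr_ge0//.
by rewrite -natrM ler_nat; lia.
Qed.

(* The leading term of the increment of the 2s-th moment is its second-order
   one, [C(2s, 2) v M n (2s - 2)]. *)
Lemma moment_rec_even s : M n s.*2 / n%:R ^+ s @[n --> \oo] -->
  (\prod_(i < s) (i.*2.+1)%:R) * v ^+ s.
Proof.
elim: s => [|s IH].
  rewrite big_ord0 mul1r expr0.
  apply: (eq_cvgn (u := fun=> 1 : R)) => [|n]; first exact: cvgn_cst.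
  by rewrite expr0 divr1 M_sum /incr M0 big1 ?addr0// => i _; rewrite big_ord0.
set L := (X in _ --> X); pose h := (\prod_(i < s) (i.*2.+1)%:R) * v ^+ s.
(* Because of the same shift, index 1 carries the second moment. *)
pose lim (j : 'I_(s.+1.*2)) : R :=
  if (j : nat) == 1 then 'C(s.+1.*2, 2)%:R * (v * h) else 0.
have incr_lim : incr n s.+1.*2 / n%:R ^+ s @[n --> \oo] --> \sum_j lim j.
  rewrite /incr.
  apply: (eq_cvgn (u := fun n => \sum_(j < s.+1.*2)
     ('C(s.+1.*2, j.+1)%:R * (kappa n j.+1 * M n (s.+1.*2 - j.+1)%N)) / n%:R ^+ s)).
    apply: cvgn_sum => -[j jlt]; rewrite /lim /=.
    case: j jlt => [|[|j]] jlt /=.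
    - have [B B0 HB] := moment_rec_bound (s.+1.*2 - 1)%N.
      have := cvgnM (cvgn_cst (l := 'C(s.+1.*2, 1)%:R * B * 2 ^+ s))
         (abs_sum_cvg0 (a := fun n => `|kappa n 1|) (C := C1) _).
      rewrite mulr0 => /(_ _) H; apply: (dom_cvgn0 (N := 1) (H _)).
        by move=> n; under eq_bigr do rewrite normr_id.
      move=> n n0; have np : 0 < n%:R ^+ s :> R by rewrite exprn_gt0// ltr0n.
      rewrite normrM normfV (gtr0_norm np) ler_pdivrMr//.
      rewrite !normrM normr_nat.
      rewrite -!mulrA ler_wpM2l ?ler0n// [leRHS](_ : _ = `|kappa n 1| * (B * (2 ^+ s * n%:R ^+ s))); last by ring.
      rewrite ler_wpM2l//; apply: le_trans (HB n) _; rewrite ler_wpM2l//.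
      by rewrite (_ : (_ - 1)./2 = s) ?succ_pow_bound//; lia.
    - apply: (eq_cvgn (u := fun n => 'C(s.+1.*2, 2)%:R * (kappa n 2 * (M n s.*2 / n%:R ^+ s)))).
        by apply: cvgnM (cvgn_cst (l := _)) _; apply: cvgnM kappa2 IH.
      by move=> n; rewrite (_ : s.+1.*2 - 2 = s.*2)%N ?mulrA//; lia.
    - have [B B0 HB] := moment_rec_bound (s.+1.*2 - j.+3)%N.
      have := cvgnM (cvgn_cst (l := 'C(s.+1.*2, j.+3)%:R * K j.+3 * B * 2 ^+ s)) (@cvgn_invn R).
      rewrite mulr0 => H; apply: (dom_cvgn0 (N := 1) H).
      move=> n n0; have np : 0 < n%:R ^+ s :> R by rewrite exprn_gt0// ltr0n.
      rewrite normrM normfV (gtr0_norm np) ler_pdivrMr//.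
      rewrite !normrM normr_nat.
      rewrite -!mulrA ler_wpM2l ?ler0n// ler_pM//.
      apply: le_trans (HB n) _; rewrite ler_wpM2l//.
      apply: (@le_trans _ _ (n.+1%:R ^+ s.-1)).
        by apply: ler_weXn2l; [rewrite ler1n|lia].
      have -> : (n%:R^-1 * n%:R ^+ s : R) = n%:R ^+ s.-1.
        have -> : s = s.-1.+1 by lia.
        by rewrite exprS mulKf// pnatr_eq0; lia.
      apply: le_trans (succ_pow_bound _ n0) _; rewrite ler_wpM2r ?exprn_ge0 ?ler0n//.
      by apply: ler_weXn2l; [rewrite ler1n|lia].
  by move=> n; rewrite mulr_suml.
have s1 : (1 < s.+1.*2)%N by lia.
have limE : \sum_j lim j = 'C(s.+1.*2, 2)%:R * (v * h).
  rewrite (bigD1 (Ordinal s1))//= /lim/= big1 ?addr0// => j.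
  by rewrite -val_eqE/= => /negbTE ->.
rewrite limE in incr_lim.
have := stolz_pow incr_lim.
(* The binomial is (s + 1)(2s + 1), and s + 1 cancels against the denominator produced by
   [stolz_pow]. *)
have -> : 'C(s.+1.*2, 2)%:R * (v * h) / s.+1%:R = L.
  rewrite /L /h big_ord_recr/= exprS.
  have -> : ('C(s.+1.*2, 2) = s.+1 * s.*2.+1)%N.
    by rewrite bin2 -doubleMl doubleK.
  rewrite natrM; have : (s.+1%:R : R) != 0 by rewrite pnatr_eq0.
  by move: (s.+1%:R : R) => x x0; field.
move=> H; apply: (eq_cvgn H) => n; rewrite M_sum M0.
by rewrite (_ : (s.+1.*2 == 0)%N = false)// add0r.
Qed.

End MomentRecursion.

(** * Inversion codes and the expansion of Occ *)

Section PermutationCodes.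
Local Open Scope nat_scope.

Section Codes.
Variable n : nat.
Implicit Types (s : 'S_n) (i j : 'I_n).

(** The Lehmer code. It is compatible with the removal of the first point; [lcode] is brought back
    to it through the inverse permutation. *)
Definition rcode s i : nat := \sum_(j < n) ((i < j) && (s j < s i)).
Definition lcode s i : nat := \sum_(j < n) ((j < i) && (s i < s j)).

Lemma inversions_rcode s : inversions s = \sum_i rcode s i.
Proof.
rewrite /inversions cardsE -sum1_card big_mkcond/= /rcode pair_big/=.
by apply: eq_bigr => -[i j] _ /=; rewrite unfold_in/=; case: ifP.
Qed.

Lemma inversions_lcode s : inversions s = \sum_i lcode s i.
Proof. by rewrite inversions_rcode /rcode exchange_big. Qed.

(** Inverting a permutation exchanges positions and values, hence the left and right ends of its
    inversions. *)
Lemma lcode_inv s i : lcode s i = rcode s^-1%g (s i).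
Proof.
rewrite /lcode /rcode [RHS](reindex_inj (@perm_inj _ s))/=.
by apply: eq_bigr => j _; rewrite !permK andbC.
Qed.

Lemma sum_lcode_inv (g : nat -> nat) s :
  \sum_i g (lcode s i) = \sum_i g (rcode s^-1%g i).
Proof.
rewrite [RHS](reindex_inj (@perm_inj _ s))/=.
by apply: eq_bigr => i _; rewrite lcode_inv.
Qed.

Lemma inversionsV s : inversions s^-1%g = inversions s.
Proof.
by rewrite inversions_rcode inversions_lcode (sum_lcode_inv id).
Qed.

End Codes.

Lemma sum_ltn_ord n (j : 'I_n) : \sum_(i < n) (i < j) = j.
Proof.
rewrite -(big_mkord xpredT (fun i => (i < j) : nat)).
rewrite (big_cat_nat (leq0n j) (ltnW (ltn_ord j)))/=.
rewrite [X in _ + X]big_nat [X in _ + X]big1 ?addn0; last by move=> i; lia.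
rewrite big_nat; under eq_bigr => i /andP[_ ->] do [].
by rewrite -big_nat sum_nat_const_nat subn0 muln1.
Qed.

Section LiftPerm.
Variable n : nat.
Implicit Types (j : 'I_n.+1) (t : 'S_n).

(** All the values below the first one are taken later, and each makes an inversion with it. *)
Lemma rcode_lift0 j t : rcode (lift_perm ord0 j t) ord0 = j.
Proof.
rewrite /rcode lift_perm_id.
rewrite -[RHS]sum_ltn_ord [RHS](reindex_inj (@perm_inj _ (lift_perm ord0 j t)))/=.
apply: eq_bigr => k _; case: (unliftP ord0 k) => [k'|] ->.
  by rewrite lift0.
by rewrite lift_perm_id !ltnn.
Qed.

Lemma ltn_lift (h : 'I_n.+1) (a b : 'I_n) : (lift h a < lift h b) = (a < b).
Proof. by rewrite !ltnNge /= leq_bump2. Qed.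

Lemma rcode_lift j t i : rcode (lift_perm ord0 j t) (lift ord0 i) = rcode t i.
Proof.
rewrite /rcode big_ord_recl/= add0n.
apply: eq_bigr => k _; rewrite !lift_perm_lift ltn_lift.
by rewrite -[_ < _]/(lift ord0 i < lift ord0 k) ltn_lift.
Qed.

Lemma sum_rcode_lift (g : nat -> nat) j t :
  \sum_i g (rcode (lift_perm ord0 j t) i) = g j + \sum_i g (rcode t i).
Proof.
rewrite big_ord_recl rcode_lift0; congr (_ + _).
by apply: eq_bigr => i _; rewrite rcode_lift.
Qed.

Lemma inversions_lift j t :
  inversions (lift_perm ord0 j t) = j + inversions t.
Proof. by rewrite !inversions_rcode (sum_rcode_lift id). Qed.

Lemma lift_perm0_bij :
  bijective (fun jt : 'I_n.+1 * 'S_n => lift_perm ord0 jt.1 jt.2).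
Proof.
apply: inj_card_bij; last first.
  by rewrite card_prod card_ord !card_Sn factS.
move=> [j t] [j' t'] /= e.
have jj : j = j' by have := congr1 (fun s : 'S_n.+1 => s ord0) e; rewrite !lift_perm_id.
subst j'; congr (_, _); apply/permP => k.
have := congr1 (fun s : 'S_n.+1 => s (lift ord0 k)) e.
by rewrite !lift_perm_lift => /lift_inj.
Qed.

Lemma sum_perm_lift (V : nmodType) (G : 'S_n.+1 -> V) :
  (\sum_s G s = \sum_(j < n.+1) \sum_t G (lift_perm ord0 j t))%R.
Proof.
rewrite pair_big/= (reindex _ (onW_bij _ lift_perm0_bij)).
by [].
Qed.

End LiftPerm.

End PermutationCodes.

(** * Inverted pairs inside r-subsets *)

Section OccurrenceExpansion.
Local Close Scope classical_set_scope.
Local Open Scope nat_scope.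

Lemma ffact_le_expn n m : n ^_ m <= n ^ m.
Proof.
elim: m => [|m IH]; first by rewrite ffactn0.
by rewrite ffactnSr expnSr leq_mul// leq_subr.
Qed.

Section Bonferroni.
Variables (n r : nat).
Implicit Types (A U : {set 'I_n}).

Definition rsupersets U : {set {set 'I_n}} := [set A : {set 'I_n} | (#|A| == r) && (U \subset A)].

Lemma card_rsupersets U : #|U| <= r ->
  #|rsupersets U| = 'C(n - #|U|, r - #|U|).
Proof.
move=> Ur.
have -> : n - #|U| = #|~: U| by rewrite [RHS]cardsCs finset.setCK card_ord.
rewrite -cards_draws -(card_in_imset (f := fun B => U :|: B)).
  apply: eq_card => A; apply/idP/imsetP.
    rewrite inE => /andP[/eqP Ar UA]; exists (A :\: U); last first.
      by rewrite finset.setDE finset.setUIr finset.setUCr finset.setIT; apply/esym/finset.setUidPr.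
    rewrite inE finset.setDE subsetIr/= -finset.setDE cardsD (finset.setIidPr UA).
    by rewrite Ar eqxx.
  move=> [B]; rewrite inE => /andP[BU /eqP Br] ->.
  rewrite inE finset.subsetUl andbT cardsU.
  have -> : U :&: B = finset.set0.
    by apply/eqP; rewrite setI_eq0 disjoint_sym finset.disjoints_subset.
  by rewrite cards0 subn0 Br subnKC.
move=> B B'; rewrite !inE => /andP[BU _] /andP[BU' _] e.
have dj (C : {set 'I_n}) : C \subset ~: U -> (U :|: C) :\: U = C.
  move=> CU; rewrite finset.setDUl finset.setDv finset.set0U; apply/finset.setDidPl.
  by rewrite finset.disjoints_subset.
by rewrite -(dj B BU) -(dj B' BU') e.
Qed.

(** Each prescribed point costs a factor n. Only a lower bound on the size of U is known later, and
    the product form avoids negative exponents. *)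
Lemma rsupersets_bound U m : m <= #|U| -> #|rsupersets U| * n ^ m <= n ^ r.
Proof.
move=> mU; case: (leqP #|U| r) => Ur; last first.
  suff -> : rsupersets U = finset.set0 by rewrite cards0.
  apply/setP => A; rewrite !inE; apply/negbTE/negP => /andP[/eqP Ar /subset_leq_card].
  by lia.
have Un : #|U| <= n by rewrite -[leqRHS]card_ord max_card.
case: (posnP n) => [n0|n0].
  case: m mU => [|m] mU; last by lia.
  rewrite card_rsupersets// expn0 muln1.
  have U0 : #|U| = 0 by lia.
  by rewrite U0 !subn0 n0; case: (r).
rewrite card_rsupersets//.
apply: (@leq_trans (n ^ (r - #|U|) * n ^ #|U|)).
  apply: leq_mul; last by rewrite leq_pexp2l.
  apply: (@leq_trans ((n - #|U|) ^ (r - #|U|))); last first.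
    by case: (posnP (r - #|U|)) => [->//|h]; rewrite leq_exp2r// leq_subr.
  by apply: leq_trans (ffact_le_expn _ _); rewrite -bin_ffact leq_pmulr// fact_gt0.
by rewrite -expnD subnK.
Qed.

Variable s : 'S_n.

Definition invpairs : {set 'I_n * 'I_n} :=
  [set p : 'I_n * 'I_n | (p.1 < p.2) && (s p.2 < s p.1)].
Definition pset (p : 'I_n * 'I_n) : {set 'I_n} := [set p.1; p.2].
Definition inv_in A : nat := \sum_(p in invpairs) (pset p \subset A).

Lemma pset_sub p A : (pset p \subset A) = (p.1 \in A) && (p.2 \in A).
Proof. by rewrite /pset finset.subUset !finset.sub1set. Qed.

Lemma inv_in0 A : (inv_in A == 0) =
  [forall i in A, forall j in A, (i < j) ==> (s i < s j)].
Proof.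
rewrite /inv_in sum_nat_eq0; apply/forall_inP/forall_inP => H.
  move=> i iA; apply/forall_inP => j jA; apply/implyP => ij.
  rewrite ltnNge; apply/negP => sji.
  have sne : s j != s i by rewrite (inj_eq perm_inj) -val_eqE/= neq_ltn ij orbT.
  have pI : (i, j) \in invpairs.
    by rewrite inE/= ij/= ltn_neqAle sji andbT val_eqE.
  by have := H _ pI; rewrite pset_sub/= iA jA.
move=> [i j]; rewrite inE/= pset_sub/= => /andP[ij sji].
rewrite eqb0; apply/negP => /andP[iA jA].
have /forall_inP /(_ j jA) := H i iA; rewrite ij/=; lia.
Qed.

Lemma card_pset p : p \in invpairs -> #|pset p| = 2.
Proof.
rewrite inE => /andP[p12 _]; rewrite /pset cards2 -val_eqE/=.
by rewrite neq_ltn p12.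
Qed.

(** Degree of [i] in the inversion graph of [s], as [degE] confirms. *)
Definition deg (i : 'I_n) : nat := rcode s i + lcode s i.

Lemma degE i : deg i = \sum_(p in invpairs) (i \in pset p).
Proof.
rewrite /deg /rcode /lcode.
have -> : \sum_(p in invpairs) (i \in pset p) = \sum_a \sum_b
    (if (a, b) \in invpairs then ((i \in pset (a, b)) : nat) else 0).
  by rewrite big_mkcond pair_big/=; apply: eq_bigr => -[a b].
(* A pair a < b cannot have [i] at both ends, so its indicator is the sum of those of the two
   ends. *)
transitivity (\sum_(a < n) \sum_(b < n) (((a == i) && ((a < b) && (s b < s a))) +
    ((b == i) && ((a < b) && (s b < s a))))); last first.
  apply: eq_bigr => a _; apply: eq_bigr => b _.
  rewrite !inE/= (eq_sym i a) (eq_sym i b).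
  case: ifP => [/andP[ab _]|_]; last by rewrite !andbF.
  rewrite !andbT; case: (eqVneq a i) => [ai|]; case: (eqVneq b i) => [bi|] //=.
  by move: ab; rewrite ai bi ltnn.
under [RHS]eq_bigr do rewrite big_split/=.
rewrite [RHS]big_split/=; congr (_ + _).
  rewrite [RHS](bigD1 i)//= [X in _ = _ + X]big1 ?addn0.
    by apply: eq_bigr => b _; rewrite eqxx.
  by move=> a /negbTE ->; rewrite big1.
apply: eq_bigr => a _; rewrite [RHS](bigD1 i)//= eqxx /= big1 ?addn0//.
by move=> b /negbTE ->.
Qed.

Lemma sum_inv_in : \sum_(A : {set 'I_n} | #|A| == r) inv_in A =
  \sum_(p in invpairs) #|rsupersets (pset p)|.
Proof.
rewrite /inv_in exchange_big/=; apply: eq_bigr => p _.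
rewrite -sum1_card big_mkcond/= [RHS]big_mkcond/=.
by apply: eq_bigr => A _; rewrite inE; case: (_ == _) => //=; case: ifP.
Qed.

Lemma sum_inv_in2 :
  \sum_(A : {set 'I_n} | #|A| == r) inv_in A * (inv_in A).-1 =
  \sum_(p in invpairs) \sum_(p' in invpairs | p' != p)
     #|rsupersets (pset p :|: pset p')|.
Proof.
transitivity (\sum_(A : {set 'I_n} | #|A| == r)
  \sum_(p in invpairs) \sum_(p' in invpairs | p' != p)
     ((pset p \subset A) && (pset p' \subset A))).
  apply: eq_bigr => A _; rewrite {1}/inv_in big_distrl/=; apply: eq_bigr => p pI.
  case: (boolP (pset p \subset A)) => pA; last by rewrite big1.
  by rewrite mul1n /inv_in (bigD1 p)//= pA add1n.
rewrite exchange_big/=; apply: eq_bigr => p _.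
rewrite exchange_big/=; apply: eq_bigr => p' _.
rewrite -sum1_card big_mkcond/= [RHS]big_mkcond/=.
apply: eq_bigr => A _; rewrite inE.
have -> : (pset p :|: pset p' \subset A) = (pset p \subset A) && (pset p' \subset A).
  exact: finset.subUset.
by case: (#|A| == r) => //=; case: (pset p \subset A); case: (pset p' \subset A).
Qed.

Definition adjacent (p p' : 'I_n * 'I_n) : bool :=
  [exists i, (i \in pset p) && (i \in pset p')].

(** An inverted pair is listed with its smaller index first, so it is determined by its two-element
    set. *)
Lemma card_psetU3 p p' : p \in invpairs -> p' \in invpairs -> p' != p ->
  3 <= #|pset p :|: pset p'|.
Proof.
move=> pI pI' pp'; rewrite leqNgt ltnS; apply/negP => le2.
have e1 : pset p = pset p :|: pset p'.
  by apply/eqP; rewrite eqEcard finset.subsetUl card_pset.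
have e2 : pset p' = pset p :|: pset p'.
  by apply/eqP; rewrite eqEcard finset.subsetUr card_pset.
have e : pset p' = pset p by rewrite e1.
move: pI pI'; rewrite !inE => /andP[p12 _] /andP[p12' _].
have h1 : p'.1 \in pset p by rewrite -e /pset !inE eqxx.
have h2 : p'.2 \in pset p by rewrite -e /pset !inE eqxx orbT.
clear le2 e1 e2 e; move: pp' h1 h2 p12 p12'; case: p => a b; case: p' => a' b'.
rewrite /pset !inE/= xpair_eqE => /negP ne.
move=> /orP[] /eqP ? /orP[] /eqP ?; subst a' b' => ab; rewrite ?ltnn//.
  by case: ne; rewrite !eqxx.
by move=> /ltnW; rewrite leqNgt ab.
Qed.

Lemma card_psetU4 p p' : p \in invpairs -> p' \in invpairs -> ~~ adjacent p p' ->
  4 <= #|pset p :|: pset p'|.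
Proof.
move=> pI pI' na; rewrite cardsU !card_pset//.
suff -> : pset p :&: pset p' = finset.set0 by rewrite cards0.
apply/setP => i; rewrite finset.in_setI finset.in_set0; apply/negbTE/negP => h.
by move/negP: na; apply; apply/existsP; exists i.
Qed.

(** Adjacent pairs share some vertex i, and the squared degree of i counts the ordered couples of
    edges at i. *)
Lemma sum_adjacent :
  \sum_(p in invpairs) \sum_(p' in invpairs) adjacent p p' <= \sum_i deg i ^ 2.
Proof.
apply: (@leq_trans (\sum_(p in invpairs) \sum_(p' in invpairs)
   \sum_i ((i \in pset p) && (i \in pset p')))).
  apply: leq_sum => p _; apply: leq_sum => p' _.
  rewrite /adjacent; case: existsP => // -[i hi].
  by rewrite (bigD1 i)//= hi.
under eq_bigr do rewrite exchange_big/=.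
rewrite exchange_big/=; apply: leq_sum => i _.
rewrite -mulnn {1}degE big_distrl/=; apply: leq_sum => p _.
rewrite degE big_distrr/=; apply: leq_sum => p' _.
by rewrite mulnb.
Qed.

(** Cauchy-Schwarz, from 2ab <= a^2 + b^2 summed over all couples of indices. *)
Lemma sqr_inversions : inversions s ^ 2 <= n * \sum_i rcode s i ^ 2.
Proof.
rewrite inversions_rcode -mulnn big_distrl/=.
suff : 2 * \sum_i rcode s i * (\sum_j rcode s j) <=
    2 * (n * \sum_i rcode s i ^ 2) by rewrite leq_pmul2l.
apply: (@leq_trans (\sum_(i < n) \sum_(j < n) (rcode s i ^ 2 + rcode s j ^ 2))).
  rewrite big_distrr/=; apply: leq_sum => i _.
  rewrite big_distrr/= big_distrr/=; apply: leq_sum => j _; exact: nat_Cauchy.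
rewrite (eq_bigr (fun i => n * rcode s i ^ 2 + \sum_j rcode s j ^ 2)).
  by rewrite big_split/= -big_distrr/= sum_nat_const card_ord; lia.
by move=> i _; rewrite big_split/= sum_nat_const card_ord.
Qed.

(** Both codes enter because an index shared by two inversions can be a left end as well as a right
    end. *)
Definition code_energy : nat := \sum_i rcode s i ^ 2 + \sum_i lcode s i ^ 2.

Lemma sum_deg : \sum_i deg i ^ 2 <= 2 * code_energy.
Proof.
rewrite /code_energy -big_split/= big_distrr/=; apply: leq_sum => i _.
rewrite /deg sqrnD [leqRHS]mul2n -addnn leq_add2l; exact: nat_Cauchy.
Qed.

(* Second-order Bonferroni inequality for the number of r-subsets containing
   no inversion. *)
Lemma occ_id_expansion : 1 < r -> 0 < n -> exists err : nat,
  occ_id r s + inversions s * 'C(n - 2, r - 2) = 'C(n, r) + err /\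
  err * n ^ 3 <= 3 * code_energy * n ^ r.
Proof.
move=> r1 n0.
(* If A contains x inverted pairs then [x = 0] + x = 1 + [x.-1], with the truncated predecessor;
   summing this over A gives the identity. *)
exists (\sum_(A : {set 'I_n} | #|A| == r) (inv_in A).-1); split.
  have -> : 'C(n, r) = \sum_(A : {set 'I_n} | #|A| == r) 1.
    by rewrite -[in LHS](card_ord n) -card_draws -sum1_card; apply: eq_bigl => A; rewrite inE.
  have -> : occ_id r s = \sum_(A : {set 'I_n} | #|A| == r) (inv_in A == 0).
    rewrite /occ_id -sum1_card big_mkcond/= [RHS]big_mkcond/=.
    apply: eq_bigr => A _; rewrite inE -inv_in0; by case: (_ == r) => //=; case: ifP.
  have -> : inversions s * 'C(n - 2, r - 2) =
      \sum_(A : {set 'I_n} | #|A| == r) inv_in A.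
    rewrite sum_inv_in /inversions -/invpairs -sum_nat_const; apply: eq_bigr => p pI.
    by rewrite card_rsupersets card_pset.
  rewrite -!big_split/=; apply: eq_bigr => A _; by case: (inv_in A).
apply: (@leq_trans ((\sum_(A : {set 'I_n} | #|A| == r) inv_in A * (inv_in A).-1) * n ^ 3)).
  rewrite leq_mul2r; apply/orP; right; apply: leq_sum => A _; case: (inv_in A) => //= k.
  exact: leq_pmull.
(* The extra factor n balances the two kinds of couples: adjacent pairs span at least three points
   and get weight n, the others span at least four and get weight 1. *)
rewrite -(leq_pmul2r n0) sum_inv_in2 big_distrl/= big_distrl/=.
apply: (@leq_trans (\sum_(p in invpairs) \sum_(p' in invpairs)
    (adjacent p p' * n + 1) * n ^ r)).
  apply: leq_sum => p pI; rewrite big_distrl/= big_distrl/=.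
  apply: (@leq_trans (\sum_(p' in invpairs | p' != p) (adjacent p p' * n + 1) * n ^ r)).
    apply: leq_sum => p' /andP[pI' pp'].
    case: (boolP (adjacent p p')) => adj /=.
      rewrite mul1n mulnC.
      have := rsupersets_bound (card_psetU3 pI pI' pp') => h.
      apply: (@leq_trans (n * n ^ r)); first by rewrite leq_mul2l h orbT.
      by rewrite leq_mul2r leq_addr orbT.
    have := rsupersets_bound (card_psetU4 pI pI' adj).
    by rewrite mul0n add0n mul1n expnSr mulnA.
  by rewrite [leqRHS](bigID (fun p' => p' != p))/= leq_addr.
under eq_bigr do rewrite -big_distrl/= big_split/= -big_distrl/= sum1_card.
rewrite -big_distrl/= big_split/= -big_distrl/= sum_nat_const.
(* Adjacent couples number at most twice the energy, and all couples at most n times the energy: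
   hence the constant 3. *)
have h1 := leq_trans sum_adjacent sum_deg.
have h2 := sqr_inversions.
rewrite /inversions -/invpairs -mulnn in h2.
have h3 : \sum_i rcode s i ^ 2 <= code_energy by exact: leq_addr.
have h4 : n * (\sum_i rcode s i ^ 2) <= n * code_energy by rewrite leq_mul2l h3 orbT.
rewrite -mulnA [_ ^ r * n]mulnC mulnA leq_mul2r; apply/orP; right.
have h5 : (\sum_(p in invpairs) \sum_(p' in invpairs) adjacent p p') * n <= 2 * code_energy * n.
  by rewrite leq_mul2r h1 orbT.
have h6 := leq_trans h2 h4.
by rewrite [3 * _]mulSn mulnDl addnC leq_add// [leqRHS]mulnC.
Qed.

End Bonferroni.

End OccurrenceExpansion.

(** * Moments of inv under the finite Mallows law *)

Section GeometricSums.
Variable R : realType.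

(** With t the square root of q, one factor t^i absorbs the power of i and the other forms a
    geometric series. *)
Lemma pow_geom_sum_bounded (p : nat) (q : R) : 0 <= q < 1 ->
  exists2 C : R, 0 <= C & forall n, \sum_(i < n) i%:R ^+ p * q ^+ i <= C.
Proof.
move=> /andP[q0 q1]; set t := Num.sqrt q.
have tt : t * t = q by rewrite -expr2 sqr_sqrtr.
have t0 : 0 <= t by exact: sqrtr_ge0.
have t1 : t < 1 by rewrite -sqrtr1 ltr_sqrt.
have [C C0 HC] := pow_geom_bounded p (introT andP (conj t0 t1)).
have t1' : 0 < 1 - t by rewrite subr_gt0.
exists (C / (1 - t)) => [|n]; first by rewrite divr_ge0// ltW.
apply: (@le_trans _ _ (\sum_(i < n) C * t ^+ i)).
  apply: ler_sum => i _; rewrite -tt exprMn mulrA ler_wpM2r ?exprn_ge0//.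
rewrite -mulr_sumr; apply: ler_wpM2l; first exact: ltW.
rewrite -[leRHS]mul1r ler_pdivlMr//.
have e : (1 - t) * \sum_(i < n) t ^+ i = 1 - t ^+ n.
  by rewrite -opprB mulNr -subrX1 opprB.
by rewrite mulrC e lerBlDr lerDl exprn_ge0.
Qed.

End GeometricSums.

Section FiniteMallows.
Variables (R : realType) (q : R).
Hypothesis hq : 0 < q < 1.

Let q0 : 0 < q. Proof. by case/andP: hq. Qed.
Let q1 : q < 1. Proof. by case/andP: hq. Qed.
Let q01 : 0 <= q < 1. Proof. by rewrite ltW. Qed.
Let omq : 0 < 1 - q. Proof. by rewrite subr_gt0. Qed.
Let omqN0 : 1 - q != 0. Proof. by rewrite gt_eqF. Qed.

Lemma one_sub_pow_gt0 n : 0 < 1 - q ^+ n.+1.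
Proof. by rewrite subr_gt0 exprn_ilt1// ltW. Qed.

Lemma one_sub_pow_ge n : 1 - q <= 1 - q ^+ n.+1.
Proof. by rewrite lerB// exprS ger_pMr// exprn_ile1// ltW. Qed.

Lemma mallows_Z0 : mallows_Z 0 q = 1.
Proof. by rewrite /mallows_Z big_geq. Qed.

Lemma mallows_ZS n : mallows_Z n.+1 q = mallows_Z n q * ((1 - q ^+ n.+1) / (1 - q)).
Proof. by rewrite /mallows_Z big_nat_recr. Qed.

Lemma mallows_Z_gt0 n : 0 < mallows_Z n q.
Proof.
elim: n => [|n IH]; first by rewrite mallows_Z0.
by rewrite mallows_ZS mulr_gt0// divr_gt0// one_sub_pow_gt0.
Qed.

(** Expectation under Mallows(n, q) as a finite sum: the asymptotics are done here without a
    probability space, and [integral_Mallows] carries them to [tau]. *)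
Definition mexp n (g : 'S_n -> R) : R :=
  (\sum_(s : 'S_n) q ^+ inversions s * g s) / mallows_Z n q.

(** Law of the first code entry in size n + 1: a geometric variable conditioned to be at most n. *)
Definition truncgeom n j : R := (1 - q) * q ^+ j / (1 - q ^+ n.+1).

Lemma truncgeom_ge0 n j : 0 <= truncgeom n j.
Proof.
by rewrite divr_ge0 ?mulr_ge0 ?exprn_ge0 ?ltW// one_sub_pow_gt0.
Qed.

Lemma sum_geom n : \sum_(j < n) (1 - q) * q ^+ j = 1 - q ^+ n.
Proof. by rewrite -mulr_sumr -opprB mulNr -subrX1 opprB. Qed.

Lemma sum_truncgeom n : \sum_(j < n.+1) truncgeom n j = 1.
Proof. by rewrite -mulr_suml sum_geom divff// gt_eqF// one_sub_pow_gt0. Qed.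

(** The weight q^inv and the normalising constant both factor over the insertion of a first point;
    this is the independence of the code entries. *)
Lemma mexpS n (g : 'S_n.+1 -> R) :
  mexp g = \sum_(j < n.+1) truncgeom n j * mexp (fun t => g (lift_perm ord0 j t)).
Proof.
rewrite /mexp sum_perm_lift mulr_suml; apply: eq_bigr => j _.
rewrite mallows_ZS [LHS]mulr_suml [RHS]mulrA [X in _ = X / _]mulr_sumr [RHS]mulr_suml.
apply: eq_bigr => t _.
rewrite inversions_lift exprD /truncgeom.
have := mallows_Z_gt0 n => /lt0r_neq0 Z0; have := one_sub_pow_gt0 n => /lt0r_neq0 Q0.
by field; rewrite Z0 omqN0 Q0.
Qed.

Lemma eq_mexp n (g h : 'S_n -> R) : g =1 h -> mexp g = mexp h.
Proof. by move=> /funext ->. Qed.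

Lemma inversions_S0 (s : 'S_0) : inversions s = 0%N.
Proof. by rewrite inversions_rcode big_ord0. Qed.

Lemma mexp0 (g : 'S_0 -> R) : mexp g = g 1%g.
Proof.
rewrite /mexp mallows_Z0 divr1 (bigD1 1%g)//= big1 ?addr0.
  by rewrite inversions_S0 expr0 mul1r.
by move=> s; case/eqP; apply/permP => -[].
Qed.

Lemma mexpD n (g h : 'S_n -> R) : mexp (fun s => g s + h s) = mexp g + mexp h.
Proof.
rewrite /mexp -mulrDl -big_split/=; congr (_ / _).
by apply: eq_bigr => s _; rewrite mulrDr.
Qed.

Lemma mexpZ n c (g : 'S_n -> R) : mexp (fun s => c * g s) = c * mexp g.
Proof.
rewrite /mexp mulrA mulr_sumr; congr (_ / _).
by apply: eq_bigr => s _; rewrite mulrCA.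
Qed.

Lemma mexp_sum n (I : finType) (g : I -> 'S_n -> R) :
  mexp (fun s => \sum_i g i s) = \sum_i mexp (g i).
Proof.
rewrite /mexp -mulr_suml exchange_big/=; congr (_ / _).
by apply: eq_bigr => s _; rewrite mulr_sumr.
Qed.

Lemma ler_mexp n (g h : 'S_n -> R) : (forall s, g s <= h s) -> mexp g <= mexp h.
Proof.
move=> gh; apply: ler_wpM2r; first by rewrite invr_ge0 ltW// mallows_Z_gt0.
by apply: ler_sum => s _; rewrite ler_wpM2l// exprn_ge0// ltW.
Qed.

Lemma mexp_cst n c : mexp (fun _ : 'S_n => c) = c.
Proof.
elim: n => [|n IH]; first by rewrite mexp0.
by rewrite mexpS IH -mulr_suml sum_truncgeom mul1r.
Qed.

Lemma mexp_ge0 n (g : 'S_n -> R) : (forall s, 0 <= g s) -> 0 <= mexp g.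
Proof. by move=> g0; rewrite -(mexp_cst n 0); exact: ler_mexp. Qed.

Lemma mexpV n (g : 'S_n -> R) : mexp (fun s => g s^-1%g) = mexp g.
Proof.
rewrite /mexp [in RHS](reindex_inj (@invg_inj _)); congr (_ / _).
by apply: eq_bigr => s _; rewrite inversionsV.
Qed.

(** Cauchy-Schwarz from a nonnegative quadratic form, evaluated at (c, a) or, when c = 0, at points
    that force a = 0. *)
Lemma sqr_mexpM n (g h : 'S_n -> R) :
  mexp (fun s => g s * h s) ^+ 2 <= mexp (fun s => g s ^+ 2) * mexp (fun s => h s ^+ 2).
Proof.
set a := mexp _; set b := mexp _; set c := mexp _.
have quad (x y : R) : 0 <= x ^+ 2 * b - 2 * x * y * a + y ^+ 2 * c.
  have : 0 <= mexp (fun s => (x * g s - y * h s) ^+ 2).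
    by apply: mexp_ge0 => s; exact: sqr_ge0.
  suff -> : mexp (fun s => (x * g s - y * h s) ^+ 2) =
     x ^+ 2 * b - 2 * x * y * a + y ^+ 2 * c by [].
  rewrite /a /b /c -!mexpZ -mulN1r -!mexpZ -!mexpD; apply: eq_mexp => s; ring.
have c0 : 0 <= c by apply: mexp_ge0 => s; exact: sqr_ge0.
have b0 : 0 <= b by apply: mexp_ge0 => s; exact: sqr_ge0.
have [c00|c0'] := eqVneq c 0.
  have [b00|b0'] := eqVneq b 0.
    have := quad 1 1; have := quad 1 (-1); rewrite b00 c00 => h1 h2; nra.
  have := quad a b; rewrite c00 => h1.
  have : b * a ^+ 2 <= 0 by lra.
  have : 0 < b by rewrite lt0r b0'.
  nra.
have : 0 < c by rewrite lt0r c0'.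
have := quad c a => h1 h2.
have h3 : 0 <= c * (b * c - a ^+ 2) by lra.
by rewrite pmulr_rge0// subr_ge0 in h3.
Qed.

Let m : R := q / (1 - q).
Let v : R := q / (1 - q) ^+ 2.

Definition inv_moment n p : R :=
  mexp (fun s : 'S_n => ((inversions s)%:R - n%:R * m) ^+ p).

(** Centred at the mean [m] of the full geometric law, the same for every n: the first moment is
    then nonzero but summable in n, as the recursion on moments requires. *)
Definition truncgeom_moment n j : R :=
  \sum_(i < n.+1) truncgeom n i * (i%:R - m) ^+ j.

Lemma inv_moment0 p : inv_moment 0 p = (p == 0)%:R.
Proof. by rewrite /inv_moment mexp0 inversions_S0 mul0r subrr expr0n. Qed.

Lemma inv_momentS n p : inv_moment n.+1 p =
  \sum_(j < p.+1) 'C(p, j)%:R * (truncgeom_moment n j * inv_moment n (p - j)%N).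
Proof.
rewrite /inv_moment mexpS.
have H (i : 'I_n.+1) : mexp (fun t : 'S_n =>
    ((inversions (lift_perm ord0 i t))%:R - n.+1%:R * m) ^+ p) =
    \sum_(j < p.+1) 'C(p, j)%:R * (i%:R - m) ^+ j * inv_moment n (p - j)%N.
  rewrite -(eq_bigr _ (fun j _ => mexpZ _ _)) -mexp_sum; apply: eq_mexp => t.
  rewrite inversions_lift natrD -natr1.
  have -> : (i%:R + (inversions t)%:R - (n%:R + 1) * m) =
    ((inversions t)%:R - n%:R * m) + (i%:R - m) by ring.
  by rewrite exprDn; apply: eq_bigr => j _; rewrite -[_ *+ 'C(_, _)]mulr_natl; ring.
under eq_bigr do rewrite H mulr_sumr.
rewrite exchange_big/=; apply: eq_bigr => j _.
rewrite /truncgeom_moment mulr_suml mulr_sumr; apply: eq_bigr => i _. rewrite /inv_moment; ring.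
Qed.

Lemma truncgeom_moment0 n : truncgeom_moment n 0 = 1.
Proof.
by rewrite -(sum_truncgeom n); apply: eq_bigr => i _; rewrite expr0 mulr1.
Qed.

(** Without its denominator, the sum over i < k has the closed form - k q^k, obtained by induction
    on k. *)
Lemma truncgeom_moment1 n : truncgeom_moment n 1 =
  - (n.+1%:R * q ^+ n.+1) / (1 - q ^+ n.+1).
Proof.
rewrite /truncgeom_moment /truncgeom.
transitivity ((\sum_(i < n.+1) (1 - q) * q ^+ i * (i%:R - m)) / (1 - q ^+ n.+1)).
  by rewrite mulr_suml; apply: eq_bigr => i _; rewrite expr1; ring.
congr (_ / _); elim: n.+1 => [|k IH]; first by rewrite big_ord0 mul0r oppr0.
rewrite big_ord_recr/= IH -natr1 exprS /m; field; exact: omqN0.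
Qed.

Lemma truncgeom_moment2 n : truncgeom_moment n 2 =
  v - n.+1%:R ^+ 2 * q ^+ n.+1 / (1 - q ^+ n.+1).
Proof.
rewrite /truncgeom_moment /truncgeom.
have E k : \sum_(i < k) (1 - q) * q ^+ i * (i%:R - m) ^+ 2 = v - q ^+ k * (k%:R ^+ 2 + v).
  elim: k => [|k IH]; first by rewrite big_ord0 expr0n/= add0r expr0 mul1r subrr.
  by rewrite big_ord_recr/= IH -natr1 (exprS q k) /m /v; field; exact: omqN0.
transitivity ((\sum_(i < n.+1) (1 - q) * q ^+ i * (i%:R - m) ^+ 2) / (1 - q ^+ n.+1)).
  by rewrite mulr_suml; apply: eq_bigr => i _; ring.
rewrite E; have := one_sub_pow_gt0 n => /lt0r_neq0.
by move: (q ^+ n.+1) (n.+1%:R : R) => x y Q0; field.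
Qed.

Lemma truncgeom_sum_le n (g : nat -> R) : (forall i, 0 <= g i) ->
  \sum_(i < n.+1) truncgeom n i * g i <= \sum_(i < n.+1) q ^+ i * g i.
Proof.
move=> g0; apply: ler_sum => i _; rewrite ler_wpM2r// /truncgeom mulrAC.
rewrite ger_pMl ?exprn_gt0//.
by rewrite ler_pdivrMr ?one_sub_pow_gt0// mul1r one_sub_pow_ge.
Qed.

Lemma m_ge0 : 0 <= m. Proof. by rewrite divr_ge0// ltW. Qed.

Lemma pow_succ_geom_sum_bounded j :
  exists2 C : R, 0 <= C & forall n, \sum_(i < n) q ^+ i * i.+1%:R ^+ j <= C.
Proof.
have [C C0 HC] := pow_geom_sum_bounded j q01.
exists (q^-1 * C) => [|n]; first by rewrite mulr_ge0// invr_ge0 ltW.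
rewrite ler_pdivlMl// mulr_sumr.
apply: le_trans (HC n.+1); rewrite big_ord_recl/=.
rewrite -[leLHS]add0r; apply: lerD; first by apply: mulr_ge0; apply: exprn_ge0 => //; exact: ltW.
by apply: ler_sum => i _; rewrite mulrA -exprS mulrC.
Qed.

Lemma truncgeom_moment_bounded j :
  exists C : R, forall n, `|truncgeom_moment n j| <= C.
Proof.
have [C C0 HC] := pow_succ_geom_sum_bounded j.
exists ((1 + m) ^+ j * C) => n.
apply: le_trans (ler_norm_sum _ _ _) _.
apply: (@le_trans _ _ (\sum_(i < n.+1) truncgeom n i * ((1 + m) ^+ j * i.+1%:R ^+ j))).
  apply: ler_sum => i _; rewrite normrM ger0_norm ?truncgeom_ge0//.
  rewrite ler_wpM2l ?truncgeom_ge0// normrX -exprMn lerXn2r// ?nnegrE//.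
    by rewrite mulr_ge0 ?addr_ge0 ?m_ge0.
  apply: le_trans (ler_normB _ _) _; rewrite !ger0_norm ?m_ge0//.
  have := m_ge0; have : 0 <= i%:R :> R by [].
  rewrite -natr1; nra.
have g0 (i : nat) : 0 <= (1 + m) ^+ j * i.+1%:R ^+ j.
  by rewrite mulr_ge0// exprn_ge0// addr_ge0// m_ge0.
apply: le_trans (truncgeom_sum_le _ g0) _.
apply: (@le_trans _ _ ((1 + m) ^+ j * \sum_(i < n.+1) q ^+ i * i.+1%:R ^+ j)).
  by rewrite mulr_sumr ler_sum// => i _; rewrite mulrCA.
by apply: ler_wpM2l (HC n.+1); rewrite exprn_ge0// addr_ge0// m_ge0.
Qed.

Lemma pow_geom_ratio_sum_bounded p :
  exists C : R, forall n, \sum_(i < n) `|i.+1%:R ^+ p * q ^+ i.+1 / (1 - q ^+ i.+1)| <= C.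
Proof.
have [C C0 HC] := pow_succ_geom_sum_bounded p.
exists (C / (1 - q)) => n.
apply: (@le_trans _ _ ((\sum_(i < n) q ^+ i * i.+1%:R ^+ p) / (1 - q))); last first.
  by rewrite ler_wpM2r// invr_ge0 ltW.
rewrite mulr_suml; apply: ler_sum => i _.
have := one_sub_pow_gt0 i => Q0.
rewrite ger0_norm; last first.
  by apply: divr_ge0; [apply: mulr_ge0; apply: exprn_ge0 => //; exact: ltW|exact: ltW].
apply: ler_pM.
- by apply: mulr_ge0; apply: exprn_ge0 => //; exact: ltW.
- by rewrite invr_ge0 ltW.
- rewrite mulrC ler_wpM2r ?exprn_ge0 ?ler0n// exprS ger_pMl ?exprn_gt0//; exact: ltW.
- by rewrite lef_pV2 ?posrE// one_sub_pow_ge.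
Qed.

Lemma truncgeom_moment1_sum :
  exists C : R, forall n, \sum_(i < n) `|truncgeom_moment i 1| <= C.
Proof.
have [C HC] := pow_geom_ratio_sum_bounded 1; exists C => n.
apply: le_trans (HC n); apply: ler_sum => i _.
by rewrite truncgeom_moment1 mulNr normrN expr1.
Qed.

Lemma truncgeom_moment2_sum :
  exists C : R, forall n, \sum_(i < n) `|truncgeom_moment i 2 - v| <= C.
Proof.
have [C HC] := pow_geom_ratio_sum_bounded 2; exists C => n.
apply: le_trans (HC n); apply: ler_sum => i _.
by rewrite truncgeom_moment2 addrC addKr normrN.
Qed.

Lemma truncgeom_moment2_cvg : truncgeom_moment n 2 @[n --> \oo] --> v.
Proof.
have [C HC] := truncgeom_moment2_sum.
have := cvgnD (abs_sum_cvg0 (a := fun i => truncgeom_moment i 2 - v) HC) (cvgn_cst (l := v)); rewrite add0r => H.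
by apply: (eq_cvgn H) => n; rewrite subrK.
Qed.

Lemma inv_moment_even s : inv_moment n s.*2 / n%:R ^+ s @[n --> \oo] -->
  (\prod_(i < s) (i.*2.+1)%:R) * v ^+ s.
Proof.
have [C1 HC1] := truncgeom_moment1_sum.
have [K HK] := choice truncgeom_moment_bounded.
exact: (moment_rec_even inv_moment0 inv_momentS truncgeom_moment0 HC1
  truncgeom_moment2_cvg (fun n j => HK j n)).
Qed.

Lemma inv_moment_bound p :
  exists2 B, 0 <= B & forall n, `|inv_moment n p| <= B * n.+1%:R ^+ p./2.
Proof.
have [C1 HC1] := truncgeom_moment1_sum.
have [K HK] := choice truncgeom_moment_bounded.
exact: (moment_rec_bound inv_moment0 inv_momentS truncgeom_moment0 HC1
  (fun n j => HK j n)).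
Qed.

Lemma inv_moment1_sum n : inv_moment n 1 = \sum_(i < n) truncgeom_moment i 1.
Proof.
elim: n => [|n IH]; first by rewrite inv_moment0 big_ord0.
rewrite big_ord_recr/= -IH inv_momentS !big_ord_recl !big_ord0/= /bump/= addn0.
rewrite truncgeom_moment0 bin0 binn.
have -> : inv_moment n (1 - 1)%N = 1.
  by rewrite /inv_moment -[RHS](mexp_cst n 1); apply: eq_mexp => s; rewrite expr0.
by rewrite subn0; ring.
Qed.

Lemma inv_moment1_cvg : exists l : R, inv_moment n 1 @[n --> \oo] --> l.
Proof.
have [C HC] := truncgeom_moment1_sum.
have [l hl] := abs_bounded_sum_cvg (a := fun i => truncgeom_moment i 1) HC; exists l.
by apply: (eq_cvgn (u := fun n => \sum_(i < n) truncgeom_moment i 1) hl) => n; rewrite inv_moment1_sum.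
Qed.

Lemma inv_moment2_sum n : inv_moment n 2 - n%:R * v =
  \sum_(i < n) (2 * (truncgeom_moment i 1 * inv_moment i 1) +
     (truncgeom_moment i 2 - v)).
Proof.
elim: n => [|n IH]; first by rewrite inv_moment0 big_ord0 mul0r subrr.
rewrite big_ord_recr/= -IH inv_momentS !big_ord_recl !big_ord0/= /bump/= !addn0.
rewrite truncgeom_moment0 bin0 bin1 binn -natr1.
have -> : inv_moment n (2 - (1 + 1))%N = 1.
  by rewrite /inv_moment -[RHS](mexp_cst n 1); apply: eq_mexp => s; rewrite expr0.
rewrite subn0 subn1 /=; ring.
Qed.

(** Sharper than the leading order n v: the renewal equation for second moments needs the correction
    to converge. It does because its increments are absolutely summable. *)
Lemma inv_moment2_cvg : exists l : R, inv_moment n 2 - n%:R * v @[n --> \oo] --> l.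
Proof.
have [C HC] := truncgeom_moment1_sum.
have [C2 HC2] := truncgeom_moment2_sum.
have [l hl] := inv_moment1_cvg; have [B B0 HB] := cvgn_bounded hl.
have [l2 hl2] : exists l : R, \sum_(i < n) (2 * (truncgeom_moment i 1 * inv_moment i 1) +
     (truncgeom_moment i 2 - v)) @[n --> \oo] --> l.
  apply: (abs_bounded_sum_cvg (a := fun i => 2 * (truncgeom_moment i 1 * inv_moment i 1) +
     (truncgeom_moment i 2 - v)) (C := 2 * (C * B) + C2)) => n.
  apply: le_trans (ler_sum _ (fun i _ => ler_normD _ _)) _.
  rewrite big_split/= lerD//.
  apply: (@le_trans _ _ (\sum_(i < n) 2 * (`|truncgeom_moment i 1| * B))).
    apply: ler_sum => i _; rewrite normrM normr_nat ler_wpM2l//.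
    by rewrite [leLHS]normrM ler_wpM2l//; exact: HB.
  by rewrite -mulr_sumr -mulr_suml; apply: ler_wpM2l => //; apply: ler_wpM2r (HC n); exact: ltW.
  exact: HC2.
by exists l2; apply: (eq_cvgn hl2) => n; rewrite inv_moment2_sum.
Qed.

Lemma mexp_rcode_sum j : exists2 C : R, 0 <= C &
  forall n, mexp (fun s : 'S_n => (\sum_i rcode s i ^ j)%:R) <= C * n%:R.
Proof.
have [C C0 HC] := pow_succ_geom_sum_bounded j; exists C => //.
elim=> [|n IH]; first by rewrite mexp0 big_ord0 mulr0.
rewrite mexpS.
under eq_bigr => i _.
  under eq_mexp => t do rewrite (sum_rcode_lift (fun x => x ^ j)%N) natrD.
  rewrite mexpD mexp_cst mulrDr.
  over.
rewrite big_split/= -mulr_suml sum_truncgeom mul1r -natr1 mulrDr mulr1 addrC lerD//.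
apply: (@le_trans _ _ (\sum_(i < n.+1) truncgeom n i * i.+1%:R ^+ j)).
  apply: ler_sum => i _; rewrite ler_wpM2l ?truncgeom_ge0// natrX.
  by rewrite lerXn2r ?nnegrE// ler_nat.
apply: le_trans (HC n.+1).
by apply: (truncgeom_sum_le n (g := fun i => i.+1%:R ^+ j)) => i; rewrite exprn_ge0.
Qed.

(** Power mean inequality up to a factor 2^p, which comes from bounding x y^(p+1) by x^(p+2) +
    y^(p+2). *)
Lemma power_mean_nat n p (a : 'I_n -> nat) :
  ((\sum_i a i) ^ p.+1 <= (2 * n) ^ p * \sum_i a i ^ p.+1)%N.
Proof.
elim: p => [|p IH]; first by rewrite expn1 expn0 mul1n; under [leqRHS]eq_bigr do rewrite expn1.
rewrite expnS; apply: (@leq_trans ((\sum_i a i) * ((2 * n) ^ p * \sum_i a i ^ p.+1))%N).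
  by rewrite leq_mul2l IH orbT.
rewrite mulnCA expnSr -mulnA leq_mul2l; apply/orP; right.
rewrite big_distrl/=.
apply: (@leq_trans (\sum_(i < n) \sum_(j < n) (a i ^ p.+2 + a j ^ p.+2))%N).
  apply: leq_sum => i _; rewrite big_distrr/=; apply: leq_sum => j _.
  case: (leqP (a i) (a j)) => aij.
    by apply: leq_trans (leq_addl _ _); rewrite [leqRHS]expnS leq_mul2r aij orbT.
  apply: leq_trans (leq_addr _ _); rewrite [leqRHS]expnS leq_mul2l leq_exp2r//.
  by rewrite (ltnW aij) orbT.
rewrite [leqLHS](eq_bigr (fun i => n * a i ^ p.+2 + \sum_j a j ^ p.+2)%N).
  by rewrite big_split/= -big_distrr/= sum_nat_const card_ord -[leqRHS]mulnA mul2n addnn.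
by move=> i _; rewrite big_split/= sum_nat_const card_ord.
Qed.

Lemma mexp_rcode_sum_pow j p : exists2 C : R, 0 <= C &
  forall n, mexp (fun s : 'S_n => (\sum_i rcode s i ^ j)%:R ^+ p) <= C * n%:R ^+ p.
Proof.
case: p => [|p].
  exists 1 => // n; rewrite expr0 mulr1 -[leRHS](mexp_cst n); apply: ler_mexp => s.
  by rewrite expr0.
have [C C0 HC] := mexp_rcode_sum (j * p.+1); exists (2 ^+ p * C) => [|n].
  by rewrite mulr_ge0// exprn_ge0.
apply: (@le_trans _ _ (mexp (fun s : 'S_n => (2 * n%:R) ^+ p *
    (\sum_i rcode s i ^ (j * p.+1))%:R))).
  apply: ler_mexp => s; rewrite -natrX -natrM -natrX -natrM ler_nat.
  apply: leq_trans (power_mean_nat _ _) _; rewrite leq_mul2l; apply/orP; right.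
  by apply: leq_sum => i _; rewrite expnM.
rewrite mexpZ exprMn -!mulrA; apply: ler_wpM2l; first exact: exprn_ge0.
rewrite [n%:R ^+ p.+1]exprSr [leRHS]mulrCA; apply: ler_wpM2l (HC n).
exact: exprn_ge0.
Qed.

(** The [lcode] part is the [rcode] part of the inverse permutation, which has the same law; (a +
    b)^p <= 2^p (a^p + b^p) separates the two. *)
Lemma mexp_energy_pow p : exists2 C : R, 0 <= C &
  forall n, mexp (fun s : 'S_n => (code_energy s)%:R ^+ p) <= C * n%:R ^+ p.
Proof.
have [C C0 HC] := mexp_rcode_sum_pow 2 p.
exists (2 ^+ p * (C + C)) => [|n]; first by rewrite mulr_ge0 ?addr_ge0 ?exprn_ge0.
pose W (s : 'S_n) : R := (\sum_i rcode s i ^ 2)%:R ^+ p.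
apply: (@le_trans _ _ (mexp (fun s : 'S_n => 2 ^+ p * (W s + W s^-1%g)))).
  apply: ler_mexp => s; rewrite /W /code_energy (sum_lcode_inv (fun x => x ^ 2)%N).
  rewrite -!natrX -natrD -natrM ler_nat.
  move: (\sum_i _)%N (\sum_i _)%N => a b.
  have mono x y : (x <= y -> x ^ p <= y ^ p)%N.
    by case: (posnP p) => [->//|p0] xy; rewrite leq_exp2r.
  have [ab|ab] := leqP a b.
    apply: (@leq_trans ((2 * b) ^ p)); first by apply: mono; lia.
    by rewrite expnMn leq_mul2l leq_addr orbT.
  apply: (@leq_trans ((2 * a) ^ p)); first by apply: mono; lia.
  by rewrite expnMn leq_mul2l leq_addl orbT.
rewrite mexpZ mexpD mexpV -mulrA mulrDl ler_wpM2l ?exprn_ge0//.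
by apply: lerD; exact: HC.
Qed.

End FiniteMallows.

(** * Direct sums and the renewal equation *)

Section DirectSums.
Local Open Scope nat_scope.

Section Splits.
Variable n : nat.
Implicit Types (s : 'S_n) (k : nat).

Definition splitat k s : bool := [forall i : 'I_n, (i < k) ==> (s i < k)].

(** An injection of a finite segment into itself is onto, so no later point can enter the
    segment. *)
Lemma splitatP k s : splitat k s -> forall i : 'I_n, (s i < k) = (i < k).
Proof.
move=> /forallP H.
pose A : {set 'I_n} := finset (fun i : 'I_n => i < k).
have e : s @: A = A.
  apply/eqP; rewrite eqEcard card_imset ?leqnn ?andbT; last exact: perm_inj.
  apply/fintype.subsetP => _ /imsetP[i + ->]; rewrite !inE => ik.
  by have := H i; rewrite ik.
move=> i; have := mem_imset A i (@perm_inj _ s).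
by rewrite e !inE.
Qed.

Lemma splitatn s : splitat n s.
Proof. by apply/forallP => i; rewrite !ltn_ord. Qed.

(** Boolean counterpart of [is_block], so that blocks can index finite sums. *)
Definition indec s : bool :=
  (0 < n) && [forall k : 'I_n, (0 < k) ==> ~~ splitat k s].

Lemma indecP s : reflect (0 < n /\ forall k, 0 < k < n -> ~~ splitat k s) (indec s).
Proof.
apply: (iffP andP) => -[n0 H]; split => //.
  move=> k /andP[k0 kn]; move/forallP: H => /(_ (Ordinal kn))/=.
  by rewrite k0.
by apply/forallP => k; apply/implyP => k0; apply: H; rewrite k0 ltn_ord.
Qed.

Definition first_split k s : bool :=
  [&& 0 < k, splitat k s & [forall j : 'I_k, (0 < j) ==> ~~ splitat j s]].

Lemma first_splitP k s : reflect
  [/\ 0 < k, splitat k s & forall j, 0 < j < k -> ~~ splitat j s] (first_split k s).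
Proof.
apply: (iffP and3P) => -[k0 ks H]; split => //.
  move=> j /andP[j0 jk]; move/forallP: H => /(_ (Ordinal jk))/=.
  by rewrite j0.
by apply/forallP => j; apply/implyP => j0; apply: H; rewrite j0 ltn_ord.
Qed.

Lemma first_split_ex s : 0 < n -> exists k : 'I_n.+1, first_split k s.
Proof.
move=> n0; have ex : exists k, (0 < k) && splitat k s by exists n; rewrite n0 splitatn.
case: (ex_minnP ex) => k /andP[k0 ks] kmin.
have kn : k < n.+1 by rewrite ltnS; apply: kmin; rewrite n0 splitatn.
exists (Ordinal kn); apply/first_splitP; split => //= j /andP[j0 jk].
by apply/negP => js; have := kmin j; rewrite j0 js => /(_ isT); rewrite leqNgt jk.
Qed.

Lemma first_split_inj s j k : first_split j s -> first_split k s -> j = k.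
Proof.
move=> /first_splitP[j0 js jmin] /first_splitP[k0 ks kmin].
case: (ltngtP j k) => // h.
  by have := kmin j; rewrite j0 h js => /(_ isT).
by have := jmin k; rewrite k0 h ks => /(_ isT).
Qed.

End Splits.

Section Dsum.
Variables (l m : nat).
Implicit Types (s : 'S_l) (t : 'S_m).

Lemma dsum_lshift s t i : dsum s t (lshift m i) = lshift m (s i).
Proof.
by rewrite permE /dsum_fun -[lshift m i]/(unsplit (inl i)) unsplitK.
Qed.

Lemma dsum_rshift s t j : dsum s t (rshift l j) = rshift l (t j).
Proof.
by rewrite permE /dsum_fun -[rshift l j]/(unsplit (inr j)) unsplitK.
Qed.

Lemma splitat_dsum j s t : j <= l -> splitat j (dsum s t) = splitat j s.
Proof.
move=> jl; apply/forallP/forallP => H i.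
  by have := H (lshift m i); rewrite dsum_lshift.
case: (split_ordP i) => k ->; first by rewrite dsum_lshift; exact: H.
by rewrite dsum_rshift/=; apply/implyP; lia.
Qed.

Lemma splitat_ex (u : 'S_(l + m)) : splitat l u -> exists s t, u = dsum s t.
Proof.
move=> hu; have H := splitatP hu.
have L (i : 'I_l) : u (lshift m i) < l by rewrite H/=.
have Rge (j : 'I_m) : l <= u (rshift l j) by rewrite leqNgt H/= -leqNgt leq_addr.
have R (j : 'I_m) : u (rshift l j) - l < m.
  by have := ltn_ord (u (rshift l j)); have := Rge j; lia.
have Linj : injective (fun i => Ordinal (L i)).
  move=> i i' /(congr1 val)/= /val_inj /perm_inj /(congr1 val)/= e.
  exact: val_inj.
have Rinj : injective (fun j => Ordinal (R j)).
  move=> j j' /(congr1 val)/= e.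
  have : u (rshift l j) = u (rshift l j').
    by apply: val_inj => /=; have := Rge j; have := Rge j'; lia.
  by move=> /perm_inj /(congr1 val)/= /addnI; exact: val_inj.
exists (perm Linj), (perm Rinj); apply/permP => i.
case: (split_ordP i) => k ->; apply: val_inj.
  by rewrite dsum_lshift permE.
by rewrite dsum_rshift permE/= subnKC.
Qed.

Lemma dsum_inj s t s' t' : dsum s t = dsum s' t' -> s = s' /\ t = t'.
Proof.
move=> e; split; apply/permP => i.
  by have := congr1 (fun u : 'S_(l + m) => u (lshift m i)) e; rewrite !dsum_lshift => /lshift_inj.
by have := congr1 (fun u : 'S_(l + m) => u (rshift l i)) e; rewrite !dsum_rshift => /rshift_inj.
Qed.

Lemma inversions_dsum s t : inversions (dsum s t) = inversions s + inversions t.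
Proof.
rewrite !inversions_rcode big_split_ord/=; congr (_ + _); apply: eq_bigr => i _.
  rewrite /rcode big_split_ord/= [X in _ + X]big1 ?addn0.
    by apply: eq_bigr => j _; rewrite !dsum_lshift.
  move=> j _; rewrite dsum_lshift dsum_rshift/=; have := ltn_ord (s i); lia.
rewrite /rcode big_split_ord/= [X in X + _]big1 ?add0n.
  by apply: eq_bigr => j _; rewrite !dsum_rshift/= !ltn_add2l.
by move=> j _; have := ltn_ord j => /= jl; rewrite [_ < j]ltnNge (leq_trans (ltnW jl))// leq_addr.
Qed.

Lemma first_split_dsum s t : first_split l (dsum s t) = indec s.
Proof.
apply/first_splitP/indecP => [[l0 _ H]|[l0 H]]; split => //.
- by move=> j jl; rewrite -(splitat_dsum s t)//; [exact: H|lia].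
- by rewrite splitat_dsum// splitatn.
- by move=> j jl; rewrite splitat_dsum//; [exact: H|lia].
Qed.

Lemma sum_first_split (V : nmodType) (G : 'S_(l + m) -> V) :
  (\sum_(u | first_split l u) G u = \sum_(s | indec s) \sum_t G (dsum s t))%R.
Proof.
rewrite pair_big_dep/=.
pose h (p : 'S_l * 'S_m) := dsum p.1 p.2.
have hinj : injective h by move=> [s t] [s' t'] /dsum_inj[/= -> ->].
rewrite (eq_bigl (fun p => p \in finset (fun p : 'S_l * 'S_m => indec p.1))); last first.
  by move=> p; rewrite inE andbT.
rewrite -(big_imset G (h := h)) /=; last by move=> p p' _ _; exact: hinj.
apply: eq_bigl => u; apply/idP/imsetP => [hu|[[s t]]].
  have /first_splitP[_ /splitat_ex[s [t e]] _] := hu.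
  exists (s, t) => //; rewrite inE/= -(first_split_dsum s t) -e//.
by rewrite inE/= => hs ->; rewrite first_split_dsum.
Qed.

End Dsum.

Lemma is_blockP n (s : 'S_n) : is_block (FinPerm s) <-> indec s.
Proof.
(* A predicate on [finperm], in which an equality of dependent pairs can be rewritten without
   casting permutations. *)
pose P l (b : finperm) := splitat l (tagged b).
split=> [[n0 H]|/indecP[n0 H]].
  apply/indecP; split => // k /andP[k0 kn]; apply/negP => sk.
  have nE : n = k + (n - k) by lia.
  have m0 : 0 < n - k by lia.
  move: (n - k) m0 nE H sk => m m0 nE; clear kn n0; subst n => H.
  move=> /splitat_ex[a [b e]]; apply: (H _ _ a b) => //.
  by rewrite e.
split=> // l m a b l0 m0 e.
have nE : n = l + m by have := congr1 (@tag _ _) e.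
have : P l (FinPerm s) by rewrite e /P/= splitat_dsum// splitatn.
by rewrite /P/=; apply/negP; apply: H; lia.
Qed.

Lemma sum_first_block (V : nmodType) (G : finperm -> V) n : 0 < n ->
  (\sum_(s : 'S_n) G (FinPerm s) =
   \sum_(k < n.+1) \sum_(b : 'S_k | indec b) \sum_(t : 'S_(n - k))
      G (FinPerm (dsum b t)))%R.
Proof.
move=> n0.
transitivity (\sum_(k < n.+1) \sum_(s : 'S_n | first_split k s) G (FinPerm s))%R.
  rewrite (exchange_big_dep xpredT)//=; apply: eq_bigr => s _.
  have [k hk] := first_split_ex s n0.
  rewrite (bigD1 k)//= big1 ?addr0// => j /andP[hj jk].
  by move: jk; rewrite -val_eqE/= (first_split_inj hj hk) eqxx.
apply: eq_bigr => -[k kn] _ /=.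
(* The complementary size becomes a variable, so that n can be substituted and no cast from ['S_n]
   is needed. *)
suff H m : n = k + m ->
    (\sum_(s : 'S_n | first_split k s) G (FinPerm s) =
     \sum_(b : 'S_k | indec b) \sum_(t : 'S_m) G (FinPerm (dsum b t)))%R.
  by apply: H; lia.
move=> nE; clear kn n0; subst n.
exact: (sum_first_split (fun u => G (FinPerm u))).
Qed.

End DirectSums.

(** * Renewal equations for the first block *)

Section Renewal.
Variables (R : realType) (q : R).
Hypothesis hq : 0 < q < 1.

Let q0 : 0 < q. Proof. by case/andP: hq. Qed.
Let q1 : q < 1. Proof. by case/andP: hq. Qed.
Let omq : 0 < 1 - q. Proof. by rewrite subr_gt0. Qed.
Let m : R := q / (1 - q).
Let v : R := q / (1 - q) ^+ 2.

(** By [prob_agree_event], the probability that the infinite Mallows permutation begins with [b]. *)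
Definition block_weight (b : finperm) : R :=
  (1 - q) ^+ tag b * q ^+ inversions (tagged b).

Definition centered_inv (b : finperm) : R :=
  (inversions (tagged b))%:R - (tag b)%:R * m.

Definition block_moment j k : R :=
  \sum_(b : 'S_k | indec b) block_weight (FinPerm b) * centered_inv (FinPerm b) ^+ j.

Definition full_moment j n : R :=
  \sum_(s : 'S_n) block_weight (FinPerm s) * centered_inv (FinPerm s) ^+ j.

(** The q-Pochhammer product of the 1 - q^k for 1 <= k <= n; by [prob_split_event], the probability
    of a split at n. *)
Definition qfact n : R := (1 - q) ^+ n * mallows_Z n q.

Lemma block_weight_ge0 b : 0 <= block_weight b.
Proof. by apply: mulr_ge0; apply: exprn_ge0; exact: ltW. Qed.

Lemma full_momentE j n : full_moment j n = qfact n * inv_moment q n j.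
Proof.
rewrite /full_moment /inv_moment /mexp /qfact.
have Z0 := lt0r_neq0 (mallows_Z_gt0 hq n).
rewrite -mulrA [_ * (_ / _)]mulrCA divff// mulr1 mulr_sumr.
by apply: eq_bigr => s _; rewrite /block_weight/= -mulrA.
Qed.

Lemma inv_moment_0 n : inv_moment q n 0 = 1.
Proof.
rewrite /inv_moment -[RHS](mexp_cst hq n); apply: eq_mexp => s.
by rewrite expr0.
Qed.

Lemma full_moment0 n : full_moment 0 n = qfact n.
Proof. by rewrite full_momentE inv_moment_0 mulr1. Qed.

Lemma block_weight_dsum l k (b : 'S_l) (t : 'S_k) :
  block_weight (FinPerm (dsum b t)) = block_weight (FinPerm b) * block_weight (FinPerm t).
Proof. by rewrite /block_weight/= inversions_dsum !exprD; ring. Qed.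

Lemma centered_inv_dsum l k (b : 'S_l) (t : 'S_k) :
  centered_inv (FinPerm (dsum b t)) = centered_inv (FinPerm t) + centered_inv (FinPerm b).
Proof. by rewrite /centered_inv/= inversions_dsum !natrD; ring. Qed.

(** When the first block is split off, weights multiply and centred counts add. The empty
    permutation has no first block, hence 0 < n. *)
Lemma renewal j n : (0 < n)%N -> full_moment j n =
  \sum_(k < n.+1) \sum_(i < j.+1)
     'C(j, i)%:R * (block_moment i k * full_moment (j - i) (n - k)).
Proof.
move=> n0; rewrite /full_moment.
rewrite (sum_first_block (fun s => block_weight s * centered_inv s ^+ j) n0).
apply: eq_bigr => k _.
transitivity (\sum_(b : 'S_k | indec b) \sum_(t : 'S_(n - k)) \sum_(i < j.+1)
   'C(j, i)%:R * ((block_weight (FinPerm b) * centered_inv (FinPerm b) ^+ i) *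
      (block_weight (FinPerm t) * centered_inv (FinPerm t) ^+ (j - i)))).
  apply: eq_bigr => b _; apply: eq_bigr => t _.
  rewrite block_weight_dsum centered_inv_dsum exprDn mulr_sumr.
  by apply: eq_bigr => i _; rewrite -[X in _ * X]mulr_natl; ring.
under eq_bigr do rewrite exchange_big/=.
rewrite exchange_big/=; apply: eq_bigr => i _.
rewrite mulr_suml mulr_sumr; apply: eq_bigr => b _.
by rewrite mulr_sumr mulr_sumr.
Qed.

Lemma qfact0 : qfact 0 = 1.
Proof. by rewrite /qfact expr0 mul1r mallows_Z0. Qed.

Lemma qfactS n : qfact n.+1 = qfact n * (1 - q ^+ n.+1).
Proof.
rewrite /qfact mallows_ZS// exprS.
by move: (q ^+ n.+1) => x; field; rewrite gt_eqF.
Qed.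

Lemma qfact_gt0 n : 0 < qfact n.
Proof. by rewrite mulr_gt0 ?exprn_gt0// mallows_Z_gt0. Qed.

Lemma qfact_le1 n : qfact n <= 1.
Proof.
elim: n => [|n IH]; first by rewrite qfact0.
rewrite qfactS; have := one_sub_pow_gt0 hq n; have := qfact_gt0 n.
have : 0 <= q ^+ n.+1 by apply: exprn_ge0; exact: ltW.
by move: (q ^+ n.+1) (qfact n) IH => x y y1 x0 y0 x1; apply: mulr_ile1; lra.
Qed.

(** Positivity of the infinite product: a product of factors 1 - x_i is at least 1 minus the sum of
    the x_i, applied from an index beyond which the powers of q sum to at most 1/2. *)
Lemma qfact_lb : exists2 c : R, 0 < c & forall n, c <= qfact n.
Proof.
have H N j : qfact N * (1 - \sum_(i < j) q ^+ (N + i).+1) <= qfact (N + j)%N.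
  elim: j => [|j IH]; first by rewrite big_ord0 subr0 mulr1 addn0.
  rewrite big_ord_recr/= addnS qfactS.
  have : 0 <= q ^+ (N + j).+1 by apply: exprn_ge0; exact: ltW.
  have : \sum_(i < j) q ^+ (N + i).+1 >= 0.
    by apply: sumr_ge0 => i _; apply: exprn_ge0; exact: ltW.
  have : qfact (N + j)%N <= qfact N.
    elim: (j) => [|k IHk]; first by rewrite addn0.
    rewrite addnS qfactS; apply: le_trans IHk; rewrite ger_pMr ?qfact_gt0//.
    by rewrite lerBlDr lerDl exprn_ge0 ?(ltW q0).
  have := qfact_gt0 N; have := qfact_gt0 (N + j)%N.
  move: (qfact (N + j)%N) (q ^+ (N + j).+1) (\sum_(i < j) _) (qfact N) IH => y x s z IH y0 z0 yz s0 x0.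
  by nra.
have [N HN] : exists N, q ^+ N.+1 / (1 - q) <= 1 / 2.
  have qq : `|q| < 1 by rewrite ger0_norm ?(ltW q0).
  have /cvgn_dist h := cvg_expr qq.
  have [|N HN] := h ((1 - q) / 2); first by rewrite divr_gt0.
  exists N; have := HN N.+1 (leqnSn _); rewrite subr0 ger0_norm; last first.
    by apply: exprn_ge0; exact: ltW.
  move=> h1; rewrite ler_pdivrMr//; apply: le_trans h1 _; by rewrite mul1r mulrC.
have HB j : qfact N / 2 <= qfact (N + j)%N.
  apply: le_trans (H N j); apply: ler_wpM2l; first exact/ltW/qfact_gt0.
  suff : \sum_(i < j) q ^+ (N + i).+1 <= 1 / 2 by lra.
  apply: le_trans HN.
  have -> : \sum_(i < j) q ^+ (N + i).+1 = (q ^+ N.+1 / (1 - q)) * (1 - q ^+ j).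
    rewrite -(sum_geom q) mulr_sumr; apply: eq_bigr => i _.
    by rewrite -addSn exprD; field; rewrite gt_eqF.
  rewrite ger_pMr; first by rewrite lerBlDr lerDl exprn_ge0 ?(ltW q0).
  by rewrite divr_gt0// exprn_gt0.
have qdec i j : (i <= j)%N -> qfact j <= qfact i.
  elim: j => [|j IH]; first by rewrite leqn0 => /eqP ->.
  rewrite leq_eqVlt => /predU1P[->//|ij]; apply: le_trans (IH ij).
  by rewrite qfactS ger_pMr ?qfact_gt0// lerBlDr lerDl exprn_ge0 ?(ltW q0).
exists (qfact N / 2) => [|n]; first by rewrite divr_gt0 ?qfact_gt0.
case: (leqP N n) => Nn; first by rewrite -(subnKC Nn).
have := qdec n N (ltnW Nn); have := qfact_gt0 N; lra.
Qed.

Lemma qfact_cvg : exists2 c : R, 0 < c & qfact n @[n --> \oo] --> c.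
Proof.
have [c c0 Hc] := qfact_lb.
pose a k := qfact k - qfact k.+1.
have sa n : \sum_(k < n) a k = 1 - qfact n.
  elim: n => [|n IH]; first by rewrite big_ord0 qfact0 subrr.
  by rewrite big_ord_recr/= IH /a; ring.
have a0 k : 0 <= a k.
  rewrite /a qfactS -[X in X - _]mulr1 -mulrBr; apply: mulr_ge0.
    exact/ltW/qfact_gt0.
  by rewrite opprB addrC subrK exprn_ge0 ?(ltW q0).
have [l [hl _ l1 _]] := nneg_bounded_sum_cvg (C := 1 - c) a0 (fun n => ltac:(rewrite sa; have := Hc n; lra)).
exists (1 - l); first by lra.
have := cvgnB (cvgn_cst (l := 1 : R)) hl => h.
by apply: (eq_cvgn h) => n; rewrite sa; ring.
Qed.

Lemma block_moment_0 j : block_moment j 0 = 0.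
Proof. by rewrite /block_moment big1// => b /andP[]. Qed.

Lemma block_moment0_ge0 k : 0 <= block_moment 0 k.
Proof.
by apply: sumr_ge0 => b _; rewrite expr0 mulr1 block_weight_ge0.
Qed.

Lemma block_moment2_ge0 k : 0 <= block_moment 2 k.
Proof.
by apply: sumr_ge0 => b _; rewrite mulr_ge0 ?block_weight_ge0// sqr_ge0.
Qed.

(** Young's inequality |y| <= e y^2 + 1 / (4 e), with e left free for the choice made in
    [block_moment2_bounded]. *)
Lemma block_moment1_le k (e : R) : 0 < e ->
  `|block_moment 1 k| <= e * block_moment 2 k + block_moment 0 k / (4 * e).
Proof.
move=> e0; rewrite /block_moment; apply: le_trans (ler_norm_sum _ _ _) _.
rewrite mulr_sumr mulr_suml -big_split/=; apply: ler_sum => b _.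
rewrite normrM ger0_norm ?block_weight_ge0// expr0 mulr1 expr1.
have := block_weight_ge0 (FinPerm b).
move: (block_weight _) (centered_inv _) => w y w0.
rewrite [leRHS](_ : _ = w * (e * y ^+ 2 + (4 * e)^-1)); last by ring.
apply: ler_wpM2l => //; have -> : y ^+ 2 = `|y| ^+ 2 by rewrite -normrX ger0_norm ?sqr_ge0.
move: `|y| => z.
rewrite -subr_ge0.
have -> : e * z ^+ 2 + (4 * e)^-1 - z = (2 * e * z - 1) ^+ 2 / (4 * e).
  by field; rewrite gt_eqF.
by rewrite divr_ge0 ?sqr_ge0// mulr_ge0// ltW.
Qed.

Lemma renewal0 n : (0 < n)%N ->
  qfact n = \sum_(k < n.+1) block_moment 0 k * qfact (n - k)%N.
Proof.
move=> n0; rewrite -full_moment0 renewal//; apply: eq_bigr => k _.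
by rewrite big_ord_recl big_ord0/= bin0 mul1r addr0 subn0 full_moment0.
Qed.

Lemma renewal1 n : (0 < n)%N -> full_moment 1 n =
  \sum_(k < n.+1) (block_moment 1 k * qfact (n - k)%N +
                   block_moment 0 k * full_moment 1 (n - k)%N).
Proof.
move=> n0; rewrite renewal//; apply: eq_bigr => k _.
rewrite !big_ord_recl big_ord0/= bin0 binn !mul1r addr0 subn0 /bump/= addn0 subnn.
by rewrite full_moment0 addrC.
Qed.

Lemma renewal2 n : (0 < n)%N -> full_moment 2 n =
  \sum_(k < n.+1) (block_moment 2 k * qfact (n - k)%N +
                   2 * (block_moment 1 k * full_moment 1 (n - k)%N) +
                   block_moment 0 k * full_moment 2 (n - k)%N).
Proof.
move=> n0; rewrite renewal//; apply: eq_bigr => k _.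
rewrite !big_ord_recl big_ord0/= bin0 bin1 binn !mul1r addr0 subn0 /bump/= !addn0.
by rewrite subn1 subnn/= full_moment0 addrC -addrA addrC -addrA [X in _ + X]addrC addrA.
Qed.

Let A0 := block_moment 0.
Let A1 := block_moment 1.
Let A2 := block_moment 2.

(** The lower bound on [qfact] bounds the sums; in the limit the renewal equation reads l c' = c',
    with c' > 0 the limit of [qfact]. *)
Lemma block_moment0_sum_cvg : \sum_(k < n) A0 k @[n --> \oo] --> (1 : R) /\
  forall n, \sum_(k < n) A0 k <= 1.
Proof.
have [c c0 Hc] := qfact_lb; have [c' c'0 cc'] := qfact_cvg.
have bd n : \sum_(k < n) A0 k <= c^-1.
  apply: (@le_trans _ _ (\sum_(k < n.+2) A0 k)).
    by rewrite !big_ord_recr/= -addrA lerDl addr_ge0// block_moment0_ge0.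
  rewrite -[leRHS]mul1r ler_pdivlMr//.
  apply: le_trans (qfact_le1 n.+1); rewrite renewal0// mulr_suml.
  by apply: ler_sum => k _; rewrite ler_wpM2l ?block_moment0_ge0.
have [l [hl _ _ le]] := nneg_bounded_sum_cvg block_moment0_ge0 bd.
have absbd n : \sum_(k < n) `|A0 k| <= c^-1.
  by apply: le_trans (bd n); apply: ler_sum => k _; rewrite ger0_norm ?block_moment0_ge0.
have h := cvg_conv absbd hl cc'.
have h2 : \sum_(k < n.+1) A0 k * qfact (n - k)%N @[n --> \oo] --> c'.
  by apply: (near_eq_cvgn (N := 1) cc') => n n0; rewrite -renewal0.
suff l1 : l = 1 by rewrite -l1.
have e : l * c' = c' by exact: (cvg_unique _ h h2).
by apply: (mulIf (lt0r_neq0 c'0)); rewrite mul1r.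
Qed.


(** The tails T of the block size satisfy the renewal identity [Tu]; as [qfact] is at least c, they
    sum to at most 1 / c, and summation by parts gives back the mean size. *)
Lemma block_moment0_size_bounded :
  exists C : R, forall n, \sum_(k < n) k%:R * A0 k <= C.
Proof.
have [c c0 Hc] := qfact_lb; have [h0 hle] := block_moment0_sum_cvg.
pose T k := 1 - \sum_(j < k.+1) A0 j.
have T0 k : 0 <= T k by rewrite subr_ge0.
have TS k : T k.+1 = T k - A0 k.+1 by rewrite /T big_ord_recr/=; ring.
have Tzero : T 0 = 1 by rewrite /T big_ord1 /A0 block_moment_0 subr0.
(* Exactly one split is the last one at or before n: it is at some n - k and is followed by a block
   longer than k. *)
have Tu n : \sum_(k < n.+1) T k * qfact (n - k)%N = 1.
  elim: n => [|n IH]; first by rewrite big_ord1 Tzero qfact0 mulr1.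
  rewrite big_ord_recl/= Tzero mul1r subn0.
  have -> : \sum_(i < n.+1) T (bump 0 i) * qfact (n.+1 - bump 0 i)%N =
      1 - \sum_(i < n.+1) A0 i.+1 * qfact (n - i)%N.
    rewrite -[in RHS]IH -sumrB; apply: eq_bigr => i _.
    by rewrite /bump/= add1n TS subSS mulrBl.
  have := renewal0 (ltn0Sn n); rewrite big_ord_recl/= block_moment_0 mul0r add0r => ->.
  by rewrite addrC -addrA -sumrN -big_split/= big1 ?addr0// => i _; rewrite /bump/= add1n subSS addNr.
have sumT n : \sum_(k < n) T k <= c^-1.
  apply: (@le_trans _ _ (\sum_(k < n.+1) T k)); first by rewrite big_ord_recr/= lerDl.
  rewrite -[leRHS]mul1r ler_pdivlMr// -[leRHS](Tu n) mulr_suml.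
  by apply: ler_sum => k _; rewrite ler_wpM2l.
have E n : \sum_(k < n.+1) k%:R * A0 k + n%:R * T n = \sum_(j < n) T j.
  elim: n => [|n IH]; first by rewrite big_ord1 big_ord0 !mul0r addr0.
  rewrite big_ord_recr/= [RHS]big_ord_recr/= -IH TS -natr1; ring.
exists c^-1 => n; apply: le_trans (sumT n); rewrite -E big_ord_recr/=.
by rewrite -addrA lerDl addr_ge0// mulr_ge0 ?block_moment0_ge0.
Qed.

Lemma full_moment1_cvg : exists2 l : R, full_moment 1 n @[n --> \oo] --> l &
  exists2 B : R, 0 < B & forall n, `|full_moment 1 n| <= B.
Proof.
have [c c0 hc] := qfact_cvg; have [l hl] := inv_moment1_cvg hq.
have h : full_moment 1 n @[n --> \oo] --> c * l.
  by apply: (eq_cvgn (cvgnM hc hl)) => n; rewrite full_momentE.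
by exists (c * l) => //; exact: cvgn_bounded h.
Qed.

Let D n := full_moment 2 n - n%:R * v * qfact n.

Let D_cvg : exists2 l : R, D n @[n --> \oo] --> l &
  exists2 B : R, 0 < B & forall n, `|D n| <= B.
Proof.
have [c c0 hc] := qfact_cvg; have [l hl] := inv_moment2_cvg hq.
have h : D n @[n --> \oo] --> c * l.
  by apply: (eq_cvgn (cvgnM hc hl)) => n; rewrite /D /v full_momentE; ring.
by exists (c * l) => //; exact: cvgn_bounded h.
Qed.

(** Writing n = k + (n - k) in the subtracted term n v [qfact n] removes the linear growth of the
    second moments and leaves D and [full_moment 1], which converge. *)
Let renewalD n : (0 < n)%N ->
  \sum_(k < n.+1) A2 k * qfact (n - k)%N =
  D n - \sum_(k < n.+1) A0 k * D (n - k)%N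
  + v * (\sum_(k < n.+1) (k%:R * A0 k) * qfact (n - k)%N)
  - 2 * \sum_(k < n.+1) A1 k * full_moment 1 (n - k)%N.
Proof.
move=> n0; rewrite /D renewal2// [qfact n]renewal0//.
rewrite !mulr_sumr -!sumrB -big_split/= -sumrB; apply: eq_bigr => k _.
rewrite natrB; last by rewrite -ltnS.
rewrite -/(A0 k) -/(A1 k) -/(A2 k); ring.
Qed.

Let v0 : 0 < v. Proof. by rewrite divr_gt0// exprn_gt0. Qed.

Lemma block_moment2_bounded : exists C : R, forall n, \sum_(k < n) A2 k <= C.
Proof.
have [c c0 Hc] := qfact_lb.
have [_ _ [B B0 HB]] := full_moment1_cvg.
have [_ _ [K K0 HK]] := D_cvg.
have [S HS] := block_moment0_size_bounded.
have [_ h01] := block_moment0_sum_cvg.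
(* With this e the cross term costs c / 2 times the sum of [A2], half of the available lower bound;
   the other half is divided out in [C]. *)
pose e := c / (4 * B).
have e0 : 0 < e by rewrite divr_gt0// mulr_gt0.
pose C := (K + K + v * S + 2 * B / (4 * e)) / (c / 2).
have main n : (0 < n)%N -> \sum_(k < n.+1) A2 k <= C.
  move=> n0; rewrite /C ler_pdivlMr ?divr_gt0//.
  have le1 : (\sum_(k < n.+1) A2 k) * c <= \sum_(k < n.+1) A2 k * qfact (n - k)%N.
    by rewrite mulr_suml; apply: ler_sum => k _; rewrite ler_wpM2l ?block_moment2_ge0.
  have le2 : `|\sum_(k < n.+1) A0 k * D (n - k)%N| <= K.
    apply: le_trans (ler_norm_sum _ _ _) _.
    apply: (@le_trans _ _ (\sum_(k < n.+1) A0 k * K)).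
      by apply: ler_sum => k _; rewrite normrM ger0_norm ?block_moment0_ge0// ler_wpM2l ?block_moment0_ge0.
    by rewrite -mulr_suml ger_pMl.
  have le3 : \sum_(k < n.+1) (k%:R * A0 k) * qfact (n - k)%N <= S.
    apply: le_trans (HS n.+1); apply: ler_sum => k _.
    have k0 : 0 <= k%:R * A0 k by rewrite mulr_ge0 ?block_moment0_ge0.
    by rewrite -[leRHS]mulr1 ler_wpM2l ?qfact_le1.
  have le4 : `|\sum_(k < n.+1) A1 k * full_moment 1 (n - k)%N| <=
      B * (e * (\sum_(k < n.+1) A2 k) + (4 * e)^-1).
    apply: le_trans (ler_norm_sum _ _ _) _.
    apply: (@le_trans _ _ (\sum_(k < n.+1) (e * A2 k + A0 k / (4 * e)) * B)).
      by apply: ler_sum => k _; rewrite normrM ler_pM//; exact: block_moment1_le.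
    rewrite -mulr_suml mulrC ler_wpM2l ?(ltW B0)// big_split/= -mulr_sumr lerD2l.
    rewrite -mulr_suml ler_piMl//; first by rewrite invr_ge0 mulr_ge0// ltW.
    exact: h01.
  have := HK n; rewrite ler_norml => /andP[_ le5].
  move: le1; rewrite renewalD//.
  move: le2; rewrite ler_norml => /andP[le2 _].
  move: le4; rewrite ler_norml => /andP[le4 _].
  have le3' : v * \sum_(k < n.+1) (k%:R * A0 k) * qfact (n - k)%N <= v * S.
    by rewrite ler_wpM2l ?(ltW v0).
  have Be : B * (e * (\sum_(k < n.+1) A2 k) + (4 * e)^-1) =
      c / 4 * (\sum_(k < n.+1) A2 k) + B / (4 * e).
    by rewrite /e; field; rewrite !gt_eqF.
  rewrite Be in le4.
  have -> : 2 * B / (4 * e) = 2 * (B / (4 * e)) by ring.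
  move: le2 le3' le4 le5; move: (\sum_(k < n.+1) A0 k * D _) (v * S)
    (v * \sum_(k < n.+1) _) (\sum_(k < n.+1) A1 k * _) (\sum_(k < n.+1) A2 k) (B / _) (D n).
  by move=> x1 x2 x3 x4 x5 x6 x7; nra.
exists C => n; apply: le_trans (main n.+1 isT).
by rewrite !big_ord_recr/= -addrA lerDl addr_ge0// block_moment2_ge0.
Qed.

(* Wald's identities for the first block, obtained by letting n tend to
   infinity in the renewal equations. *)
Lemma block_moments : exists2 K : R, 1 <= K &
  [/\ \sum_(k < n) k%:R * A0 k @[n --> \oo] --> K,
      \sum_(k < n) A1 k @[n --> \oo] --> (0 : R) &
      \sum_(k < n) A2 k @[n --> \oo] --> v * K].
Proof.
have [c c0 hc] := qfact_cvg.
have [l1 hl1 [B B0 HB]] := full_moment1_cvg.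
have [d hd _] := D_cvg.
have [S HS] := block_moment0_size_bounded.
have [h0 h01] := block_moment0_sum_cvg.
have [S2 HS2] := block_moment2_bounded.
have kA0 k : 0 <= k%:R * A0 k by rewrite mulr_ge0 ?block_moment0_ge0.
have [K [hK _ _ Kle]] := nneg_bounded_sum_cvg kA0 HS.
have [a2 [ha2 _ _ _]] := nneg_bounded_sum_cvg block_moment2_ge0 HS2.
have abs0 n : \sum_(k < n) `|A0 k| <= 1.
  by apply: le_trans (h01 n); apply: ler_sum => k _; rewrite ger0_norm ?block_moment0_ge0.
have abs1 n : \sum_(k < n) `|A1 k| <= S2 + 1 / 4.
  apply: (@le_trans _ _ (\sum_(k < n) (1 * A2 k + A0 k / (4 * 1)))).
    by apply: ler_sum => k _; exact: block_moment1_le.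
  rewrite big_split/= -mulr_sumr -mulr_suml; have := h01 n; have := HS2 n.
  by move: (\sum_(k < n) A2 k) (\sum_(k < n) A0 k) => x y; lra.
have abs2 n : \sum_(k < n) `|A2 k| <= S2.
  by apply: le_trans (HS2 n); apply: ler_sum => k _; rewrite ger0_norm ?block_moment2_ge0.
have absK n : \sum_(k < n) `|k%:R * A0 k| <= S.
  by apply: le_trans (HS n); apply: ler_sum => k _; rewrite ger0_norm.
have [a1 ha1] := abs_bounded_sum_cvg abs1.
have cN0 : c != 0 by rewrite gt_eqF.
(* In the limit [renewal1] reads l1 = a1 c + l1, with c nonzero. *)
have a10 : a1 = 0.
  have h1 := cvgnD (cvg_conv abs1 ha1 hc) (cvg_conv abs0 h0 hl1).
  have h2 : l1 = a1 * c + 1 * l1.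
    suff h3 : full_moment 1 n @[n --> \oo] --> a1 * c + 1 * l1.
      exact: (cvg_unique _ hl1 h3).
    apply: (near_eq_cvgn (N := 1) h1) => n n0.
    by rewrite renewal1// big_split.
  apply: (mulIf cN0); rewrite mul0r; move: h2; rewrite mul1r => h2.
  by apply: (addIr l1); rewrite add0r.
(* K is at least 1 because the masses [A0 k] sum to 1 and vanish at k = 0. *)
exists K.
  have le n : \sum_(k < n) A0 k <= K.
    apply: le_trans (Kle n); apply: ler_sum => -[[|k] kn] _ /=.
      by rewrite /A0 block_moment_0 mul0r.
    by rewrite ler_peMl ?block_moment0_ge0// ler1n.
  have /cvgP cv := h0.
  rewrite -(cvg_lim _ h0)//; apply: limr_le => //; exact: nearW.
split => //; first by rewrite a10 in ha1.
suff <- : a2 = v * K by [].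
have h1 := cvgnD (cvgnB hd (cvg_conv abs0 h0 hd))
  (cvgnM (cvgn_cst (l := v)) (cvg_conv (a := fun k => k%:R * A0 k) absK hK hc)).
have h2 := cvgnB h1 (cvgnM (cvgn_cst (l := 2 : R)) (cvg_conv abs1 ha1 hl1)).
(* Limit of [renewalD]: the two terms in d cancel, and a1 = 0 removes the cross term. *)
have h3 : a2 * c = d - 1 * d + v * (K * c) - 2 * (a1 * l1).
  suff h4 : \sum_(k < n.+1) A2 k * qfact (n - k)%N @[n --> \oo] -->
      d - 1 * d + v * (K * c) - 2 * (a1 * l1).
    exact: (cvg_unique _ (cvg_conv abs2 ha2 hc) h4).
  by apply: (near_eq_cvgn (N := 1) h2) => n n0; rewrite renewalD.
apply: (mulIf cN0); rewrite h3 a10; ring.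
Qed.

End Renewal.

(** * The first block of an infinite Mallows permutation *)

Lemma sum_nat_bool_count (T : Type) (a : pred T) (s : seq T) :
  (\sum_(j <- s) a j = count a s)%N.
Proof. by rewrite -sum1_count [RHS]big_mkcond; apply: eq_bigr => j _; case: (a j). Qed.

Section InfinitePermutations.
Local Open Scope nat_scope.
Variable S : nat -> nat.
Hypothesis bijS : bijective S.

Let injS : injective S. Proof. exact: bij_inj. Qed.

Definition agrees (k : nat) (b : 'S_k) : Prop := forall i : 'I_k, S i = b i.

Definition splits (k : nat) : Prop := forall i, i < k -> S i < k.

(** By bijectivity each value below S i is taken exactly once, either after i or before it. *)
Lemma rinvE i : rinv S i + \sum_(j < i) (S j < S i) = S i.
Proof.
have [g gS Sg] := bijS.
pose L := map g (iota 0 (S i)).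
have Lu : uniq L by rewrite map_inj_uniq ?iota_uniq//; exact: (can_inj Sg).
have memL j : (j \in L) = (S j < S i).
  apply/mapP/idP => [[v]|h]; first by rewrite mem_iota => /= h ->; rewrite Sg.
  by exists (S j); rewrite ?mem_iota ?gS.
have -> : rinv S i = size ([seq j <- L | i < j]).
  rewrite /rinv (_ : [set j | _] = [set` [fset j in [seq j <- L | i < j]]%fset]).
    by rewrite set_fsetK card_fseq undup_id// filter_uniq.
  apply/seteqP; split => j /=; rewrite !inE mem_filter memL => /andP//.
have -> : \sum_(j < i) (S j < S i) = size ([seq j <- L | j < i]).
  rewrite -(big_mkord xpredT (fun j => (S j < S i) : nat)) /index_iota subn0.
  rewrite sum_nat_bool_count -size_filter; apply: perm_size; apply: uniq_perm.
  - by rewrite filter_uniq// iota_uniq.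
  - by rewrite filter_uniq.
  by move=> j; rewrite !mem_filter memL mem_iota andbC.
rewrite !size_filter -[RHS](size_iota 0) -(size_map g) -/L -(count_predC (fun j => i < j)).
congr (_ + _); apply: eq_in_count => j; rewrite memL => h /=.
by case: (ltngtP j i) h => // ->; rewrite ltnn.
Qed.

Lemma rcodeE k (b : 'S_k) (i : 'I_k) :
  rcode b i + \sum_(j < k | j < i) (b j < b i) = b i.
Proof.
rewrite /rcode [X in _ + X]big_mkcond/= -big_split/=.
rewrite -[RHS]sum_ltn_ord [RHS](reindex_inj (@perm_inj _ b))/=.
apply: eq_bigr => j _; case: (ltngtP i j) => h /=; rewrite ?addn0//.
by rewrite (val_inj h) ltnn.
Qed.

Lemma agrees_rinv k (b : 'S_k) (i : 'I_k) : agrees b -> rinv S i = rcode b i.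
Proof.
move=> ag; have := rinvE i; have := rcodeE b i.
rewrite (big_ord_widen_cond k xpredT (fun j => (S j < S i) : nat))/=; last exact/ltnW.
have -> : \sum_(j < k | j < i) (b j < b i) = \sum_(j < k | j < i) (S j < S i).
  by apply: eq_bigr => j _; rewrite !ag.
rewrite ag => h1 h2; apply/eqP; rewrite -(eqn_add2r (\sum_(j < k | j < i) (S j < b i))) h1; exact/eqP.
Qed.

Lemma count_between (f : nat -> nat) i x y : injective f ->
  \sum_(j < i) (x < f j < y) <= y - x.+1.
Proof.
move=> injf; rewrite -(big_mkord xpredT (fun j => (x < f j < y) : nat)) /index_iota subn0.
rewrite sum_nat_bool_count -size_filter -(size_map f) -[leqRHS](size_iota x.+1).
apply: uniq_leq_size; first by rewrite map_inj_uniq// filter_uniq// iota_uniq.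
move=> v /mapP[j]; rewrite mem_filter mem_iota => /andP[/andP[h1 h2] _] ->.
by rewrite mem_iota; lia.
Qed.

(** Among the values not yet taken, z minus the number of smaller taken values is strictly
    increasing in z; a code entry and the earlier values thus determine the next value. *)
Lemma rank_lt (f : nat -> nat) i x y : injective f -> x < y ->
  (forall j, j < i -> f j != x) ->
  x + \sum_(j < i) (f j < y) < y + \sum_(j < i) (f j < x).
Proof.
move=> injf xy fx; have := count_between i x y injf.
have -> : \sum_(j < i) (f j < y) =
    \sum_(j < i) (f j < x) + \sum_(j < i) (x < f j < y).
  rewrite -big_split/=; apply: eq_bigr => j _; have := fx j (ltn_ord j).
  by case: (ltngtP (f j) x) => //= h _; rewrite (ltn_trans h xy).
lia.
Qed.

(** Strong induction on the position: once the earlier values agree, S i and b i solve the same rank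
    equation, and [rank_lt] leaves a single solution. *)
Lemma rinv_agrees k (b : 'S_k) :
  (forall i : 'I_k, rinv S i = rcode b i) -> agrees b.
Proof.
move=> H; suff K i (ik : i < k) : S i = b (Ordinal ik) by move=> [i ik]; exact: K.
elim/ltn_ind: i ik => i IH ik.
have h1 := rinvE i; have h2 := rcodeE b (Ordinal ik); rewrite -H/= in h2.
pose x := S i; pose y : nat := b (Ordinal ik).
have E z : \sum_(j < k | j < i) (b j < z) = \sum_(j < i) (S j < z).
  rewrite (big_ord_widen_cond k xpredT (fun j => (S j < z) : nat))/=; last exact/ltnW.
  by apply: eq_bigr => -[j jk] /= ji; rewrite (IH j ji jk).
rewrite E in h2; rewrite -/x -/y in h1 h2 *.
have nx j : j < i -> S j != x by move=> ji; rewrite (inj_eq injS) neq_ltn ji.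
have ny j : j < i -> S j != y.
  move=> ji; rewrite (IH j ji (ltn_trans ji ik)) /y val_eqE (inj_eq perm_inj).
  by rewrite -val_eqE/= neq_ltn ji.
case: (ltngtP x y) => // h.
  by have := rank_lt injS h nx; lia.
by have := rank_lt injS h ny; lia.
Qed.

(** Pigeonhole: a point outside the first k positions landing below k would make k + 1 distinct
    values below k. *)
Lemma splits_lt k i : splits k -> (S i < k) = (i < k).
Proof.
move=> sk; apply/idP/idP => [Sik|]; last exact: sk.
rewrite ltnNge; apply/negP => ki.
have : size (map S (i :: iota 0 k)) <= size (iota 0 k).
  apply: uniq_leq_size.
    by rewrite map_inj_uniq//= iota_uniq andbT mem_iota add0n/= -leqNgt.
  move=> v /mapP[j]; rewrite inE mem_iota add0n => /orP[/eqP -> ->|/andP[_ jk] ->].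
    by rewrite mem_iota.
  by rewrite mem_iota add0n/=; exact: sk.
by rewrite size_map/= ltnn.
Qed.

Lemma block_between p k : splits p -> splits (p + k) ->
  exists t : 'S_k, forall i : 'I_k, S (p + i) = p + t i.
Proof.
move=> sp spk.
have ge (i : 'I_k) : p <= S (p + i) by rewrite leqNgt splits_lt// -leqNgt leq_addr.
have lt (i : 'I_k) : S (p + i) - p < k.
  have := splits_lt (p + i) spk; rewrite ltn_add2l ltn_ord; have := ge i; lia.
have inj : injective (fun i => Ordinal (lt i)).
  move=> i j /(congr1 val)/= e; apply: val_inj; apply/eqP.
  have e' : S (p + i) = S (p + j) by have := ge i; have := ge j; lia.
  by rewrite -(eqn_add2l p) -(inj_eq injS); exact/eqP.
by exists (perm inj) => i; rewrite permE/= subnKC.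
Qed.

Lemma splits_agrees k (b : 'S_k) j : agrees b -> j <= k -> splits j <-> splitat j b.
Proof.
move=> ag jk; split=> [sj|sj i ij].
  by apply/forallP => i; apply/implyP => ij; rewrite -ag; exact: sj.
have ik := leq_trans ij jk.
by rewrite (ag (Ordinal ik)) (splitatP sj).
Qed.

Lemma agrees_splits k (b : 'S_k) : agrees b -> splits k.
Proof. by move=> ag i ik; rewrite (ag (Ordinal ik)). Qed.

Lemma splits_ex k : splits k -> exists b : 'S_k, agrees b.
Proof. by move=> sk; have [b] := @block_between 0 k (fun=> ltac:(by [])) sk; exists b. Qed.

(** Equivalent to the existence of a decomposition into blocks, by [infinite_dsum_ex] and
    [infinite_dsum_recurrent]. *)
Definition recurrent : Prop := forall n, exists2 k, n < k & splits k.

(** The implication sits under the existential so that [choice] gives a total function of p; where p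
    is not a split the value is arbitrary. *)
Lemma next_block : recurrent -> forall p, exists b : finperm, splits p ->
  [/\ indec (tagged b), splits (p + tag b) &
      forall i : 'I_(tag b), S (p + i) = p + tagged b i].
Proof.
move=> rec p; have [sp|nsp] := pselect (splits p); last by exists (FinPerm (1%g : 'S_0)).
have [k0 pk0 sk0] := rec p.
have ex : exists k, `[< p < k /\ splits k >] by exists k0; apply/asboolP.
case: (ex_minnP ex) => k /asboolP[pk sk] kmin.
have spk : splits (p + (k - p)) by rewrite subnKC// ltnW.
have [t ht] := block_between sp spk.
exists (FinPerm t) => _; split => //=.
apply/indecP; split; first by rewrite subn_gt0.
move=> j /andP[j0 jk]; apply/negP => st.
suff /asboolP/kmin : p < p + j /\ splits (p + j) by lia.
split; first by rewrite -addn1 leq_add2l.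
move=> i ij; case: (ltnP i p) => ip.
  by apply: leq_trans (sp i ip) _; exact: leq_addr.
have ik : i - p < k - p by lia.
have := ht (Ordinal ik); rewrite /= subnKC// => ->.
by rewrite ltn_add2l (splitatP st)/=; lia.
Qed.

Lemma infinite_dsum_ex : recurrent -> exists b : nat -> finperm,
  (forall k, is_block (b k)) /\ is_infinite_dsum S b.
Proof.
move=> rec; have [f hf] := choice (next_block rec).
pose p := fix p k := if k is k'.+1 then p k' + tag (f (p k')) else 0.
have sp k : splits (p k).
  by elim: k => [//|k IH] /=; have [] := hf _ IH.
have off k : \sum_(j < k) tag (f (p j)) = p k.
  by elim: k => [|k IH]; rewrite ?big_ord0// big_ord_recr/= IH.
exists (fun k => f (p k)); split=> [k|k i /=].
  have [] := hf _ (sp k); case: (f (p k)) => n s /= hs _ _.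
  exact/is_blockP.
by rewrite off; have [_ _] := hf _ (sp k); apply.
Qed.

Lemma infinite_dsum_splits (b : nat -> finperm) : is_infinite_dsum S b ->
  forall k, splits (\sum_(j < k) tag (b j)).
Proof.
move=> hb; elim=> [|k IH]; first by rewrite big_ord0.
rewrite big_ord_recr/= => i; set o := \sum_(_ < _) _ => ik.
case: (ltnP i o) => io; first by apply: leq_trans (IH i io) _; exact: leq_addr.
have ik' : i - o < tag (b k) by lia.
have := hb k (Ordinal ik'); rewrite /= -/o subnKC// => ->.
by rewrite ltn_add2l ltn_ord.
Qed.

Lemma infinite_dsum_recurrent (b : nat -> finperm) : (forall k, is_block (b k)) ->
  is_infinite_dsum S b -> recurrent.
Proof.
move=> blk hb n; exists (\sum_(j < n.+1) tag (b j)); last exact: infinite_dsum_splits.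
elim: n => [|n IH].
  by rewrite big_ord1; have [] := blk 0.
rewrite big_ord_recr/=; apply: (leq_ltn_trans IH).
by rewrite -[X in X < _]addn0 ltn_add2l; have [] := blk n.+1.
Qed.

(** The default value of [first_block] has size 0 and is no block, so equality with [b] forces a
    decomposition to exist. Conversely, two indecomposable prefixes have the same size, since the
    shorter one would split the longer. *)
Lemma first_block_agrees k (b : 'S_k) : indec b ->
  first_block S = FinPerm b <-> agrees b /\ recurrent.
Proof.
move=> ib; split.
  rewrite /first_block; case: xgetP => [b' -> [c [blk hc e]]|_ e].
    move=> be; split; last exact: (infinite_dsum_recurrent blk hc).
    move: (hc 0); rewrite -e be /= => H i; have := H i.
    by rewrite big_ord0 !add0n.
  have /andP[k0 _] := ib; have kE : 0 = k := congr1 (@tag _ _) e.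
  by exfalso; move: k0; rewrite -kE.
move=> [ag rec]; rewrite /first_block.
have uniq_b b' : (exists c : nat -> finperm,
    [/\ forall k, is_block (c k), is_infinite_dsum S c & b' = c 0]) -> b' = FinPerm b.
  move=> [c [blk hc e]]; have := blk 0; have := hc 0; rewrite -e.
  case: b' e => k' b' e H /is_blockP ib'.
  have ag' : agrees b' by move=> i; have := H i; rewrite /= big_ord0 !add0n.
  have kk' : k' = k.
    have [k0 hk] := indecP _ ib; have [k'0 hk'] := indecP _ ib'.
    case: (ltngtP k' k) => // h.
      have := hk k'; rewrite k'0 h => /(_ isT)/negP; case.
      by apply/(splits_agrees ag (ltnW h)); exact: (agrees_splits ag').
    have := hk' k; rewrite k0 h => /(_ isT)/negP; case.
    by apply/(splits_agrees ag' (ltnW h)); exact: (agrees_splits ag).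
  subst k'; congr (FinPerm _); apply/permP => i; apply: val_inj.
  exact: etrans (esym (ag' i)) (ag i).
have [c [blk hc]] := infinite_dsum_ex rec.
apply: xget_subset1.
  rewrite /=; have := uniq_b (c 0); exists c; split => //.
  by apply/esym; apply: uniq_b; exists c.
by move=> b1 b2 /uniq_b -> /uniq_b ->.
Qed.

End InfinitePermutations.

Lemma prob_bigcup_fin d (T : measurableType d) (R : realType)
    (mu : probability T R) (I : finType) (Q : pred I) (F : I -> set T) :
  (forall i, measurable (F i)) -> (forall i j x, F i x -> F j x -> i = j) ->
  mu (\bigcup_(i in [set i | Q i]) F i) = (\sum_(i | Q i) mu (F i))%E.
Proof.
move=> mF dF; rewrite measure_fin_bigcup//.
- rewrite (_ : [set i | Q i] = [set` enum Q]); last first.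
    by apply/seteqP; split => i /=; rewrite mem_enum.
  by rewrite -fsbig_seq ?enum_uniq// big_enum.
- exact: finite_finset.
- by apply/trivIsetP => i j _ _ /eqP ij; apply/seteqP; split => // x [/= fi fj]; case: ij; exact: dF fi fj.
Qed.

(** * Law of the first block *)

Section FirstBlockLaw.
Context (R : realType) (q : R) (d : measure_display) (T : measurableType d).
Variables (P : probability T R) (Sg : T -> nat -> nat).
Hypothesis hq : 0 < q < 1.
Hypothesis hS : is_Mallows_infinite P q Sg.

Let bijS w : bijective (Sg w). Proof. by case: hS. Qed.

Definition agree_event (k : nat) (b : 'S_k) : set T := [set w | agrees (Sg w) b].

Definition split_event (k : nat) : set T := [set w | splits (Sg w) k].

Lemma measurable_agree_event k (b : 'S_k) : measurable (agree_event b).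
Proof.
have -> : agree_event b = \bigcap_(i in [set: 'I_k]) [set w | Sg w i = b i].
  by apply/seteqP; split => w /= h i; [move=> _; exact: h|exact: h].
apply: fin_bigcap_measurable; first exact: finite_finset.
by move=> i _; case: hS => + _ _ _; apply.
Qed.

(** Beginning with [b] means having its code in the first k entries, which are independent and
    geometric. *)
Lemma prob_agree_event k (b : 'S_k) :
  P (agree_event b) = (block_weight q (FinPerm b))%:E.
Proof.
case: hS => _ _ ind geo.
pose J := [fset i in iota 0 k]%fset.
(* Extended by 0 beyond k, because independence is stated for families indexed by nat. *)
pose code (i : nat) : nat := oapp (rcode b) 0%N (insub i).
have codeE (i : 'I_k) : code i = rcode b i by rewrite /code valK.
have -> : agree_event b = \bigcap_(i in [set` J])
    ((fun w => (rinv (Sg w) i).+1) @^-1` [set (code i).+1]).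
  apply/seteqP; split => w /= h.
    move=> i; rewrite /= !inE mem_iota add0n /= => ik.
    by congr S; rewrite (codeE (Ordinal ik)) -(agrees_rinv (bijS w) _ h).
  apply: (rinv_agrees (bijS w)) => i; rewrite -codeE.
  have iJ : (i : nat) \in J by rewrite !inE mem_iota add0n/=.
  by have [] := h i iJ.
rewrite (ind J (fun i => [set (code i).+1])).
have pJ : perm_eq (enum_fset J) (iota 0 k).
  by apply: uniq_perm; rewrite ?fset_uniq ?iota_uniq// => i; rewrite /J !inE.
rewrite (perm_big _ pJ)/=.
have -> : iota 0 k = index_iota 0 k by rewrite /index_iota subn0.
rewrite big_mkord.
under eq_bigr do rewrite geo// subn1 codeE /=.
rewrite -(big_morph EFin EFinM erefl); congr EFin.
rewrite big_split/= prodr_const card_ord /block_weight/=; congr (_ * _).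
by rewrite inversions_rcode prodrXr.
Qed.

Lemma agree_event_inj k (b b' : 'S_k) w : agree_event b w -> agree_event b' w -> b = b'.
Proof.
by move=> h h'; apply/permP => i; apply: val_inj; exact: etrans (esym (h i)) (h' i).
Qed.

Lemma split_eventE k :
  split_event k = \bigcup_(b in [set b | xpredT b]) agree_event (b : 'S_k).
Proof.
apply/seteqP; split => w /=.
  by move=> /(splits_ex (bijS w))[b hb]; exists b.
by move=> [b _ hb]; exact: (agrees_splits hb).
Qed.

Lemma measurable_split_event k : measurable (split_event k).
Proof.
rewrite split_eventE; apply: fin_bigcup_measurable => [|b _].
  exact: finite_finset.
exact: measurable_agree_event.
Qed.

Lemma prob_split_event k : P (split_event k) = (qfact q k)%:E.
Proof.
rewrite split_eventE prob_bigcup_fin; last first.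
- exact: agree_event_inj.
- by move=> b; exact: measurable_agree_event.
under eq_bigr do rewrite prob_agree_event.
rewrite sumEFin -full_moment0//; congr EFin.
by apply: eq_bigr => b _; rewrite expr0 mulr1.
Qed.

Lemma splitat_dsum_shift l m (s : 'S_l) (t : 'S_m) j :
  splitat (l + j) (dsum s t) = splitat j t.
Proof.
apply/forallP/forallP => H i.
  by have := H (rshift l i); rewrite dsum_rshift/= !ltn_add2l.
case: (split_ordP i) => k ->; last by rewrite dsum_rshift/= !ltn_add2l; exact: H.
by rewrite dsum_lshift/=; apply/implyP => _; rewrite ltn_addr.
Qed.

(** The event that n is a split and that the next one is n + k. *)
Let next_split_event n k : set T :=
  \bigcup_(p in [set p : 'S_n * 'S_k | indec p.2]) agree_event (dsum p.1 p.2).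

Let measurable_next_split n k : measurable (next_split_event n k).
Proof.
apply: fin_bigcup_measurable => [|b _]; first exact: finite_finset.
exact: measurable_agree_event.
Qed.

Let prob_next_split n k :
  P (next_split_event n k) = (qfact q n * block_moment q 0 k)%:E.
Proof.
rewrite /next_split_event (prob_bigcup_fin P (fun p : 'S_n * 'S_k => indec p.2)); last first.
- move=> [s t] [s' t'] w /= h h'.
  by have [-> ->] := dsum_inj (agree_event_inj h h').
- by move=> b; exact: measurable_agree_event.
under eq_bigr do rewrite prob_agree_event.
rewrite sumEFin; congr EFin.
rewrite -full_moment0// /full_moment /block_moment mulr_suml.
under [RHS]eq_bigr do rewrite mulr_sumr.
rewrite pair_big/=; apply: eq_bigr => -[s t] _ /=.
by rewrite block_weight_dsum !expr0 !mulr1.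
Qed.

Let next_split_spec n k w : next_split_event n k w ->
  [/\ (0 < k)%N, splits (Sg w) n, splits (Sg w) (n + k) &
    forall j, (0 < j < k)%N -> ~ splits (Sg w) (n + j)].
Proof.
move=> [[s t] /= it ag]; have [k0 hk] := indecP _ it; split => //.
- by apply/(splits_agrees ag (leq_addr _ _)); rewrite splitat_dsum// splitatn.
- exact: (agrees_splits ag).
- move=> j /[dup] jk /andP[_ jk']; have := hk j jk; rewrite -(splitat_dsum_shift s).
  by move=> /negP h /(splits_agrees ag); apply: contra_not h; apply; rewrite leq_add2l ltnW.
Qed.

Definition last_split_event n : set T :=
  split_event n `&` \bigcap_(k in [set: nat]) ~` split_event (n + k.+1).

Lemma measurable_last_split n : measurable (last_split_event n).
Proof.
apply: measurableI; first exact: measurable_split_event.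
by apply: bigcapT_measurable => k; apply: measurableC; exact: measurable_split_event.
Qed.

(** A split at n followed by another at distance less than K has probability [qfact q n] times a sum
    that tends to 1, which leaves no mass for a last split. *)
Lemma prob_last_split n : P (last_split_event n) = 0%E.
Proof.
have [hA0 hA1] := block_moment0_sum_cvg hq.
have bound K : (P (last_split_event n) <=
    (qfact q n * (1 - \sum_(k < K) block_moment q 0 k))%:E)%E.
  pose V := \bigcup_(k in [set k : 'I_K | xpredT k]) next_split_event n k.
  have mV : measurable V.
    by apply: fin_bigcup_measurable => [|k _]; [exact: finite_finset|exact: measurable_next_split].
  have PV : P V = (qfact q n * \sum_(k < K) block_moment q 0 k)%:E.
    rewrite /V prob_bigcup_fin//; last first.
      move=> i j w /next_split_spec[i0 _ si hi] /next_split_spec[j0 _ sj hj].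
      apply: val_inj; case: (ltngtP i j) => // ij.
        by case: (hj i) => //; rewrite i0.
      by case: (hi j) => //; rewrite j0.
    under eq_bigr do rewrite prob_next_split.
    by rewrite sumEFin mulr_sumr.
  have disj : last_split_event n `&` V = set0.
    apply/seteqP; split => // w [[_ h] [k _ /next_split_spec[k0 _ hk _]]].
    by have := h k.-1 I; rewrite /= prednK.
  have le : (P (last_split_event n) + P V <= (qfact q n)%:E)%E.
    rewrite -prob_split_event -measureU//; last exact: measurable_last_split.
    apply: le_measure; rewrite ?inE.
    - by apply: measurableU => //; exact: measurable_last_split.
    - exact: measurable_split_event.
    by move=> w [[]//|[k _ /next_split_spec[]]].
  move: le; rewrite PV -leeBrDr// -EFinB => /le_trans; apply.
  by rewrite lee_fin mulrBr mulr1.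
apply/eqP; rewrite eq_le measure_ge0 andbT; apply/lee_addgt0Pr => e e0; rewrite add0e.
have := cvgnM (cvgn_cst (l := qfact q n)) (cvgnB (cvgn_cst (l := 1 : R)) hA0).
rewrite subrr mulr0 => /cvgn_dist/(_ e e0)[N HN].
apply: le_trans (bound N) _; rewrite lee_fin; have := HN N (leqnn _).
by rewrite subr0; apply: le_trans; exact: ler_norm.
Qed.

Definition recurrent_event : set T := [set w | recurrent (Sg w)].

Lemma measurable_recurrent : measurable recurrent_event.
Proof.
have -> : recurrent_event = \bigcap_(n in [set: nat]) \bigcup_(k in [set: nat])
    split_event (n + k.+1).
  apply/seteqP; split => w /= h n.
    by move=> _; have [k nk sk] := h n; exists (k - n.+1)%N => //; rewrite /split_event/= addnS -addSn subnKC.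
  by have [k _ hk] := h n I; exists (n + k.+1)%N => //; rewrite addnS ltnS leq_addr.
apply: bigcapT_measurable => n; apply: bigcupT_measurable => k.
exact: measurable_split_event.
Qed.

(** Since 0 is always a split, a permutation with finitely many splits has a last one; countably
    many null events cover these cases. *)
Lemma prob_recurrentC : P (~` recurrent_event) = 0%E.
Proof.
apply: (@subset_measure0 _ _ _ P _ (\bigcup_(n in [set: nat]) last_split_event n)).
- by apply: measurableC; exact: measurable_recurrent.
- by apply: bigcupT_measurable => n; exact: measurable_last_split.
- move=> w /= nrec; have [n hn] : exists n, forall k, (n < k)%N -> ~ splits (Sg w) k.
    apply: contrapT => h; apply: nrec => n; apply: contrapT => h2; apply: h.
    by exists n => k nk sk; apply: h2; exists k.
  have ex : exists k, `[< splits (Sg w) k >] by exists 0%N; apply/asboolP.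
  have ub k : `[< splits (Sg w) k >] -> (k <= n)%N.
    by move=> /asboolP sk; rewrite leqNgt; apply/negP => /hn.
  case: (ex_maxnP ex ub) => k /asboolP sk kmax; exists k => //; split => // j _ /= sj.
  by have := kmax (k + j.+1)%N; rewrite asboolT// => /(_ isT); lia.
- apply/negligibleP; first by apply: bigcupT_measurable => n; exact: measurable_last_split.
  apply: negligible_bigcup => n; apply/negligibleP; first exact: measurable_last_split.
  exact: prob_last_split.
Qed.

Lemma prob_first_block k (b : 'S_k) : indec b ->
  P [set w | first_block (Sg w) = FinPerm b] = (block_weight q (FinPerm b))%:E.
Proof.
move=> ib; rewrite -prob_agree_event.
have -> : [set w | first_block (Sg w) = FinPerm b] = agree_event b `&` recurrent_event.
  by apply/seteqP; split => w /=; move/(first_block_agrees (bijS w) ib).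
have mA := measurable_agree_event b.
have mR := measurable_recurrent.
have h0 : P (agree_event b `\` recurrent_event) = 0%E.
  apply: (subset_measure0 _ _ _ prob_recurrentC) => [||w []//].
    exact: measurableD.
  exact: measurableC.
have e : P (agree_event b) = (P (agree_event b `\` recurrent_event) +
  P (agree_event b `&` recurrent_event))%E := measureDI P mA mR.
by rewrite e h0 add0e.
Qed.

End FirstBlockLaw.

(** * Moments of the block B *)

Section BlockExpectations.
Context (R : realType) (q : R) (d : measure_display) (T : measurableType d).
Variables (P : probability T R) (B : T -> finperm).
Hypothesis hq : 0 < q < 1.
Hypothesis hB : is_MBlock P q B.

Let q0 : 0 < q. Proof. by case/andP: hq. Qed.
Let omq : 0 < 1 - q. Proof. by case/andP: hq => _; rewrite subr_gt0. Qed.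
Let m : R := q / (1 - q).
Let v : R := q / (1 - q) ^+ 2.

Lemma prob_MBlock k (b : 'S_k) : indec b ->
  P (B @^-1` [set FinPerm b]) = (block_weight q (FinPerm b))%:E.
Proof.
case: hB => _ [d' [T' [P' [Sg [hS eq]]]]] ib.
by rewrite eq; exact: prob_first_block.
Qed.

Lemma measurable_MBlock_preimage (A : set finperm) : measurable (B @^-1` A).
Proof.
have -> : B @^-1` A = \bigcup_(b in [set: finperm]) [set w | B w = b /\ A b].
  by apply/seteqP; split => w /=; [exists (B w)|case=> b _ [<-]].
apply: countable_bigcupT_measurable; first exact: countableP.
move=> b; case: hB => mB _; have [Ab|nAb] := pselect (A b).
  by rewrite (_ : [set w | _] = B @^-1` [set b])//; apply/seteqP; split => w /=; first by case.
by rewrite (_ : [set w | _] = set0)//; apply/seteqP; split => w // [].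
Qed.

Lemma measurable_fun_MBlock (g : finperm -> R) : measurable_fun setT (g \o B).
Proof.
move=> _ Y _; rewrite setTI.
by rewrite (_ : _ @^-1` Y = B @^-1` (g @^-1` Y)); first exact: measurable_MBlock_preimage.
Qed.

(** Restricted to indecomposable values, whose probabilities are given by [prob_MBlock]; since these
    already sum to 1, the other values form a null set ([null_sized]). *)
Let sized k : set T := [set w | indec (tagged (B w)) /\ tag (B w) = k].

Let measurable_sized k : measurable (sized k).
Proof.
exact: (measurable_MBlock_preimage [set b | indec (tagged b) /\ tag b = k]).
Qed.

Let sized_eq k w : sized k w -> exists2 b : 'S_k, indec b & B w = FinPerm b.
Proof.
rewrite /sized/=; case: (B w) => n s /= [hs nk]; subst n.
by exists s.
Qed.

Let FinPerm_inj k : injective (@FinPerm k).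
Proof. by move=> s t /eqP; rewrite -tag_eqE /tag_eq/= eqxx/= tagged_asE => /eqP. Qed.

Let trivIset_sized : trivIset [set: nat] sized.
Proof.
apply/trivIsetP => i j _ _ /eqP ij; apply/seteqP; split => // w [[_ e1] [_ e2]].
by case: ij; rewrite -e1 -e2.
Qed.

Let integral_sized (g : finperm -> R) k : (forall b, 0 <= g b) ->
  (\int[P]_(w in sized k) (g (B w))%:E =
   (\sum_(b : 'S_k | indec b) block_weight q (FinPerm b) * g (FinPerm b))%:E)%E.
Proof.
move=> g0; have mT b : measurable (B @^-1` [set b]) by exact: measurable_MBlock_preimage.
transitivity (\int[P]_(w in sized k) \sum_(b <- enum [pred b : 'S_k | indec b])
    ((g (FinPerm b))%:E * (\1_(B @^-1` [set FinPerm b]) w)%:E))%E.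
  apply: eq_integral => w; rewrite inE => /sized_eq[b ib Bw].
  rewrite big_enum/= (bigD1 b)//= big1 ?adde0; last first.
    move=> b' /andP[_ bb']; rewrite indicE memNset ?mule0//= Bw => /FinPerm_inj e.
    by rewrite e eqxx in bb'.
  by rewrite indicE mem_set//= mule1 Bw.
rewrite ge0_integral_sum//; last 2 first.
- move=> b; apply/measurable_EFinP; apply: measurable_funM => //.
- by move=> b w _; rewrite -EFinM lee_fin mulr_ge0.
rewrite big_enum/= -sumEFin; apply: eq_bigr => b ib.
rewrite ge0_integralZl//; last by rewrite lee_fin.
rewrite integral_indic// setIidl; last first.
  by move=> w /= e; rewrite /sized/= e.
by rewrite [X in (_ * X)%E](prob_MBlock ib) muleC EFinM.
by apply/measurable_EFinP; exact: measurable_indic.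
Qed.

Lemma eseries_cvg (a : nat -> R) (l : R) :
  \sum_(k < n) a k @[n --> \oo] --> l ->
  (\sum_(0 <= k <oo) (a k)%:E)%E = l%:E.
Proof.
move=> h; apply: cvg_lim => //.
have -> : (fun n => \sum_(0 <= k < n) (a k)%:E)%E =
    EFin \o (fun n => \sum_(k < n) a k).
  by apply/funext => n /=; rewrite -sumEFin big_mkord.
by apply/fine_cvgP; split; [exact: nearW|exact: h].
Qed.

Let prob_sized k : P (sized k) = (block_moment q 0 k)%:E.
Proof.
have := integral_sized k (fun=> ler01); rewrite integral_cst// mul1e => ->.
by congr EFin; apply: eq_bigr => b _; rewrite expr0.
Qed.

Let null_sized : P (~` \bigcup_k sized k) = 0%E.
Proof.
have mU : measurable (\bigcup_k sized k) by exact: bigcupT_measurable.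
have PU : P (\bigcup_k sized k) = 1%E.
  have -> : P (\bigcup_k sized k) = (\sum_(0 <= k <oo | k \in [set: nat]) P (sized k))%E.
    exact: measure_bigcup.
  under eq_eseriesr do rewrite prob_sized.
  rewrite (eq_eseriesl (Q := xpredT)); last by move=> k; exact: in_setT.
  by apply: eseries_cvg; have [] := block_moment0_sum_cvg hq.
by rewrite probability_setC// PU -EFinB subrr.
Qed.

Lemma ge0_integral_MBlock (g : finperm -> R) (l : R) : (forall b, 0 <= g b) ->
  \sum_(k < n) (\sum_(b : 'S_k | indec b)
      block_weight q (FinPerm b) * g (FinPerm b)) @[n --> \oo] --> l ->
  (\int[P]_w (g (B w))%:E = l%:E)%E.
Proof.
move=> g0 hl; have mU : measurable (\bigcup_k sized k) by exact: bigcupT_measurable.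
rewrite (ge0_negligible_integral (N := ~` \bigcup_k sized k))//; last 3 first.
- exact: measurableC.
- by apply/measurable_EFinP; exact: measurable_fun_MBlock.
- by move=> w _; rewrite lee_fin.
rewrite setTD setCK ge0_integral_bigcup//; last 2 first.
- by apply: measurable_funTS; apply/measurable_EFinP; exact: measurable_fun_MBlock.
- by move=> w _; rewrite lee_fin.
under eq_eseriesr do rewrite integral_sized//.
exact: eseries_cvg.
Qed.

Lemma MBlock_moments : exists2 K : R, 1 <= K &
  [/\ mean_size P B = K, mean_inv P B = m * K,
      (P.-integrable setT (EFin \o (bsize R B))),
      (P.-integrable setT (EFin \o (binv R B))) &
      (\int[P]_w ((centered_inv q (B w)) ^+ 2)%:E = (v * K)%:E)%E].
Proof.
have [K K1 [hK h1 h2]] := block_moments hq.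
have sizeE k : \sum_(b : 'S_k | indec b) block_weight q (FinPerm b) * (tag (FinPerm b))%:R =
    k%:R * block_moment q 0 k.
  by rewrite /block_moment mulr_sumr; apply: eq_bigr => b _; rewrite expr0 mulr1 mulrC.
have invE k : \sum_(b : 'S_k | indec b) block_weight q (FinPerm b) *
     (inversions (tagged (FinPerm b)))%:R =
    block_moment q 1 k + m * (k%:R * block_moment q 0 k).
  rewrite /block_moment !mulr_sumr -big_split/=; apply: eq_bigr => b _.
  by rewrite expr0 expr1 /centered_inv/= /m; ring.
have Isize : (\int[P]_w (bsize R B w)%:E = K%:E)%E.
  apply: (ge0_integral_MBlock (g := fun b => (tag b)%:R)) => //.
  by apply: (eq_cvgn hK) => n; apply: eq_bigr => k _; rewrite sizeE.
have Iinv : (\int[P]_w (binv R B w)%:E = (m * K)%:E)%E.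
  apply: (ge0_integral_MBlock (g := fun b => (inversions (tagged b))%:R)) => //.
  have := cvgnD h1 (cvgnM (cvgn_cst (l := m)) hK); rewrite add0r => h.
  apply: (eq_cvgn h) => n; rewrite mulr_sumr -big_split/=.
  by apply: eq_bigr => k _; rewrite invE.
exists K => //; split.
- by rewrite /mean_size unlock Isize.
- by rewrite /mean_inv unlock Iinv.
- apply/integrableP; split.
    by apply/measurable_EFinP; exact: (measurable_fun_MBlock (fun b => (tag b)%:R)).
  under eq_integral do rewrite /= ger0_norm ?ler0n//.
  by rewrite -/(bsize R B _) Isize ltry.
- apply/integrableP; split.
    by apply/measurable_EFinP; exact: (measurable_fun_MBlock (fun b => (inversions (tagged b))%:R)).
  under eq_integral do rewrite /= ger0_norm ?ler0n//.
  by rewrite Iinv ltry.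
- apply: (ge0_integral_MBlock (g := fun b => centered_inv q b ^+ 2)) => //.
  by move=> b; exact: sqr_ge0.
Qed.

Lemma mean_ratio_MBlock : mean_inv P B / mean_size P B = m.
Proof.
have [K K1 [-> -> _ _ _]] := MBlock_moments.
by rewrite mulfK// gt_eqF// (lt_le_trans _ K1).
Qed.

(** As E[inv B] = m K with K = E|B|, the variable in the variance is -K times the centred inversion
    number; its variance K^2 v K cancels the factor K^-3. *)
Lemma gamma_sq_MBlock r : gamma_sq P B r = v / ((r - 2)`!%:R ^+ 2).
Proof.
have [K K1 [sE iE isz iinv I2]] := MBlock_moments.
have K0 : 0 < K by exact: lt_le_trans K1.
rewrite /gamma_sq sE iE.
set X := fun w => _.
have EX : ('E_P[X] = 0)%E.
  rewrite unlock /X.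
  have i1 : P.-integrable setT (EFin \o (fun w => m * K * bsize R B w)).
    by have := integrableZl measurableT (m * K) isz.
  have i2 : P.-integrable setT (EFin \o (fun w => K * binv R B w)).
    by have := integrableZl measurableT K iinv.
  transitivity (\int[P]_w ((m * K * bsize R B w)%:E - (K * binv R B w)%:E))%E.
    by apply: eq_integral => w _; rewrite EFinB.
  rewrite integralB_EFin//.
  under eq_integral do rewrite EFinM.
  rewrite integralZl//; under [X in (_ - X)%E]eq_integral do rewrite EFinM.
  rewrite integralZl//.
  have -> : (\int[P]_w (bsize R B w)%:E = K%:E)%E.
    by rewrite -sE /mean_size unlock fineK//; exact: integrable_fin_num.
  have -> : (\int[P]_w (binv R B w)%:E = (m * K)%:E)%E.
    by rewrite -iE /mean_inv unlock fineK//; exact: integrable_fin_num.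
  by rewrite -!EFinM -EFinB; congr EFin; ring.
have -> : fine ('V_P[X])%E = K ^+ 2 * (v * K).
  rewrite /variance unlock EX/= unlock.
  transitivity (fine (\int[P]_w ((K ^+ 2)%:E * ((centered_inv q (B w)) ^+ 2)%:E))%E).
    congr fine; apply: eq_integral => w _; rewrite -EFinM; congr EFin.
    by rewrite !fctE /= !subr0 /X /bsize /binv /centered_inv -/m; ring.
  rewrite ge0_integralZl//; last 3 first.
  - apply/measurable_EFinP; exact: (measurable_fun_MBlock (fun b => centered_inv q b ^+ 2)).
  - by move=> w _; rewrite lee_fin sqr_ge0.
  - by rewrite lee_fin sqr_ge0.
  by rewrite I2 -EFinM.
have f0 : ((r - 2)`!%:R : R) != 0 by rewrite pnatr_eq0 -lt0n fact_gt0.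
rewrite /v; have := lt0r_neq0 K0; have := lt0r_neq0 omq.
by move: (1 - q) => x x0 KN; field; rewrite f0 x0 KN.
Qed.

End BlockExpectations.

(** * Moments of the normal law *)

Lemma is_derive_pow (R : realType) k (x : R) :
  is_derive x 1 (fun x : R => x ^+ k) (k%:R * x ^+ k.-1).
Proof.
have -> : (fun x : R => x ^+ k) = (@idfun R : R -> R) ^+ k.
  by apply/funext => y; rewrite exprfctE.
apply: is_derive_eq.
by rewrite /= /GRing.scale/= mulr1.
Qed.

Lemma is_derive_expR_comp (R : realType) (g : R -> R) dg (x : R) :
  is_derive x 1 g dg -> is_derive x 1 (fun x => expR (g x)) (dg * expR (g x)).
Proof.
move=> h; rewrite mulrC.
exact: (is_derive1_comp (f := expR) (g := g)).
Qed.

Lemma is_derive_mul (R : realType) (f g : R -> R) df dg (x : R) :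
  is_derive x 1 f df -> is_derive x 1 g dg -> is_derive x 1 (fun x => f x * g x) (df * g x + f x * dg).
Proof.
move=> hf hg. apply: is_derive_eq.
rewrite /GRing.scale/=; ring.
Qed.

Lemma continuous_derivable (R : realType) (f df : R -> R) :
  (forall x : R, is_derive x 1 f (df x)) -> continuous f.
Proof.
by move=> h x; apply: differentiable_continuous; apply/derivable1_diffP; have [] := h x.
Qed.

Lemma pow_le_fact_expR (R : realType) k (y : R) : 0 <= y ->
  y ^+ k <= k`!%:R * expR y.
Proof.
move=> y0; case: k => [|k].
  by rewrite expr0 mul1r; apply: le_trans (expR_ge1Dx y); rewrite lerDl.
have := expR_ge1Dxn k y0; have := fact_gt0 k.+1; rewrite -(ltr_nat R).
move: ((k.+1)`!%:R : R) => F F0 h.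
rewrite mulrC -ler_pdivrMr//; lra.
Qed.

Section NormalMoments.
Variables (R : realType) (g : R).
Hypothesis g0 : 0 < g.

Let s := Num.sqrt g.
Let s0 : s != 0. Proof. by rewrite gt_eqF// sqrtr_gt0. Qed.
Let ss : s ^+ 2 = g. Proof. by rewrite sqr_sqrtr// ltW. Qed.
Let mu := @lebesgue_measure R.
Let N : probability (measurableTypeR R) R := normal_prob 0 s.
Let pdf : R -> R := normal_pdf 0 s.
Let a := - (2 * g)^-1.
Let c := normal_peak s.

Let pdfE x : pdf x = c * expR (a * x ^+ 2).
Proof.
rewrite /pdf normal_pdfE// /normal_fun subr0 ss; congr (_ * expR _).
by rewrite /a -mulr_natl mulrC; ring.
Qed.

Let pdf_ge0 x : 0 <= pdf x. Proof. exact: normal_pdf_ge0. Qed.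

Let mpdf : measurable_fun setT pdf.
Proof. exact: measurable_normal_pdf. Qed.

(** The integral passes through the Radon-Nikodym derivative of the normal law, equal to the density
    almost everywhere because both have the same integral over every measurable set. *)
Lemma ge0_integral_normal (f : R -> R) : (forall x, 0 <= f x) ->
  measurable_fun setT f ->
  (\int[N]_x (f x)%:E = \int[mu]_x (f x * pdf x)%:E)%E.
Proof.
move=> f0 mf; have dom := normal_prob_dominates 0 s.
rewrite -(Radon_Nikodym_SigmaFinite.change_of_variables dom)//; last exact/measurable_EFinP.
have iRN := Radon_Nikodym_SigmaFinite.f_integrable dom.
apply: ae_eq_integral => //.
- apply: emeasurable_funM; first exact/measurable_EFinP.
  exact: measurable_int iRN.
- by apply/measurable_EFinP; apply: measurable_funM.
under [X in ae_eq _ _ _ X]eq_fun do rewrite EFinM.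
apply: ae_eqe_mul2l; apply: integral_ae_eq => //.
- by apply/measurable_EFinP.
- by move=> E _ mE; rewrite -Radon_Nikodym_SigmaFinite.f_integral.
Qed.

(** Half of the Gaussian exponent absorbs the power of x; the other half is that of the density of
    variance 2 g. *)
Lemma pow_normal_pdf_bounded k : exists2 C : R, 0 <= C &
  forall x, `|x| ^+ k * pdf x <= C * normal_pdf 0 (Num.sqrt (2 * g)) x.
Proof.
have g2 : 0 < 2 * g by rewrite mulr_gt0.
have s2 : Num.sqrt (2 * g) != 0 by rewrite gt_eqF// sqrtr_gt0.
have a0 : 0 < - (a / 2) by rewrite /a mulNr opprK divr_gt0// invr_gt0.
pose C := (1 + k`!%:R / (- (a / 2)) ^+ k).
have C0 : 0 <= C by rewrite addr_ge0// divr_ge0// exprn_ge0// ltW.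
have p0 := normal_peak_gt0 s2.
exists (c * C / normal_peak (Num.sqrt (2 * g))) => [|x].
  by rewrite divr_ge0 ?mulr_ge0 ?normal_peak_ge0.
rewrite pdfE normal_pdfE// [leRHS]mulrA divfK ?gt_eqF// /normal_fun subr0.
rewrite sqr_sqrtr ?(ltW g2)//.
have -> : - x ^+ 2 / (2 * g *+ 2) = a / 2 * x ^+ 2.
  by rewrite /a -mulr_natl; field; rewrite gt_eqF.
have -> : a * x ^+ 2 = a / 2 * x ^+ 2 + a / 2 * x ^+ 2 by field.
rewrite expRD mulrCA -[leRHS]mulrA ler_wpM2l ?normal_peak_ge0//.
rewrite mulrA ler_wpM2r ?expR_ge0//.
set y := - (a / 2) * x ^+ 2.
have y0 : 0 <= y by rewrite mulr_ge0 ?sqr_ge0 ?(ltW a0).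
have -> : a / 2 * x ^+ 2 = - y by rewrite /y mulNr opprK.
rewrite expRN ler_pdivrMr ?expR_gt0//.
have h1 : `|x| ^+ k <= 1 + `|x| ^+ (2 * k).
  have [x1|x1] := leP `|x| 1.
    by apply: (@le_trans _ _ 1); [exact: exprn_ile1|rewrite lerDl exprn_ge0].
  apply: (@le_trans _ _ (`|x| ^+ (2 * k))); last by rewrite lerDr.
  by apply: ler_weXn2l; [exact: ltW|lia].
apply: le_trans h1 _; rewrite /C mulrDl mul1r lerD//.
  by apply: le_trans (expR_ge1Dx y); rewrite lerDl.
have -> : `|x| ^+ (2 * k) = y ^+ k / (- (a / 2)) ^+ k.
  by rewrite /y exprMn exprM -normrX ger0_norm ?sqr_ge0// mulrAC divff ?mul1r// expf_neq0// gt_eqF.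
by rewrite mulrAC ler_wpM2r ?invr_ge0 ?exprn_ge0 ?(ltW a0)// pow_le_fact_expR.
Qed.

Lemma measurable_pow k : measurable_fun setT (fun x : R => x ^+ k).
Proof. exact: exprn_measurable. Qed.

Let integrable_pow_pdf k : mu.-integrable setT (EFin \o (fun x => x ^+ k * pdf x)).
Proof.
have [C C0 HC] := pow_normal_pdf_bounded k.
have := integrable_normal_pdf 0 (Num.sqrt (2 * g)).
move=> /(integrableZl measurableT C) ii.
apply: le_integrable ii => //.
  by apply/measurable_EFinP; apply: measurable_funM => //; exact: measurable_pow.
move=> x _ /=; rewrite lee_fin normrM normrX (ger0_norm (pdf_ge0 x)).
by apply: le_trans (HC x) _; exact: ler_norm.
Qed.

Lemma integrable_normal_pow k : N.-integrable setT (EFin \o (fun x : R => x ^+ k)).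
Proof.
apply/integrableP; split.
  by apply/measurable_EFinP; exact: measurable_pow.
rewrite (ge0_integral_normal (f := fun x => `|x ^+ k|))//; last first.
  by apply: measurableT_comp => //; exact: measurable_pow.
have := integrable_pow_pdf k => /integrableP[_].
congr (_ < _)%E.
by apply: eq_integral => x _ /=; rewrite normrM (ger0_norm (pdf_ge0 x)).
Qed.

(** Adding |x^k| makes the integrand nonnegative; the integral added is finite and is cancelled at
    the end. *)
Lemma integral_normal_pow k :
  (\int[N]_x (x ^+ k)%:E = \int[mu]_x (x ^+ k * pdf x)%:E)%E.
Proof.
have mp := measurable_pow k.
have ipdf := integrable_pow_pdf k; have iN := integrable_normal_pow k.
have iNa : N.-integrable setT (EFin \o (fun x : R => `|x ^+ k|)) by exact: integrable_abse iN.
have ipa : mu.-integrable setT (EFin \o (fun x : R => `|x ^+ k| * pdf x)).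
  apply: eq_integrable (integrable_abse ipdf) => // x _ /=.
  by rewrite normrM (ger0_norm (pdf_ge0 x)).
have ma : measurable_fun setT (fun x : R => `|x ^+ k|) by exact: measurableT_comp.
have e1 : (\int[N]_x ((x ^+ k)%:E + `|x ^+ k|%R%:E) =
    \int[mu]_x ((x ^+ k * pdf x)%:E + (`|x ^+ k| * pdf x)%R%:E))%E.
  transitivity (\int[N]_x (x ^+ k + `|x ^+ k|)%R%:E)%E.
    by apply: eq_integral => x _; rewrite EFinD.
  rewrite (ge0_integral_normal (f := fun x => x ^+ k + `|x ^+ k|)).
  - by apply: eq_integral => x _; rewrite mulrDl EFinD.
  - by move=> x; rewrite -lerBlDl sub0r -normrN ler_norm.
  - exact: measurable_funD.
move: e1; rewrite (integralD_EFin measurableT iN iNa) (integralD_EFin measurableT ipdf ipa).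
rewrite (ge0_integral_normal (f := fun x => `|x ^+ k|))//.
have fa : (\int[mu]_x (`|x ^+ k| * pdf x)%R%:E)%E \is a fin_num by exact: integrable_fin_num.
move=> e1; have := congr1 (fun z => z - (\int[mu]_x (`|x ^+ k| * pdf x)%R%:E))%E e1.
by rewrite !addeK.
Qed.

Let F k (x : R) := x ^+ k * pdf x.

Let is_derive_F k (x : R) :
  is_derive x 1 (F k) (k%:R * F k.-1 x - g^-1 * F k.+1 x).
Proof.
have -> : F k = (fun x => x ^+ k * (c * expR (a * x ^+ 2))).
  by apply/funext => y; rewrite /F pdfE.
have h3 := is_derive_mul (is_derive_cst a x 1) (is_derive_pow 2 x).
have h5 := is_derive_mul (is_derive_cst c x 1) (is_derive_expR_comp h3).
apply: is_derive_eq (is_derive_mul (is_derive_pow k x) h5) _.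
rewrite /F pdfE (exprS x k) /= expr1; move: (expR _) => E; rewrite /a; field.
by rewrite gt_eqF.
Qed.

Let continuous_F k : continuous (F k).
Proof. exact: continuous_derivable (is_derive_F k). Qed.

Let F_cvg0 k (e : R) : `|e| = 1 -> F k (e * n.+1%:R) @[n --> \oo] --> (0 : R).
Proof.
move=> e1; have [C C0 HC] := pow_normal_pdf_bounded k.+1.
have s2 : Num.sqrt (2 * g) != 0 by rewrite gt_eqF// sqrtr_gt0 mulr_gt0.
pose p := normal_peak (Num.sqrt (2 * g)).
have h : C * p * n.+1%:R^-1 @[n --> \oo] --> (0 : R).
  have := cvgnM (cvgn_cst (l := C * p)) (@cvg_harmonic R).
  by rewrite mulr0.
apply: (dom_cvgn0 (N := 0) h) => n _.
rewrite /F normrM (ger0_norm (pdf_ge0 _)) normrX ler_pdivlMr ?ltr0n//.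
have ne : `|e * n.+1%:R| = n.+1%:R by rewrite normrM e1 mul1r normr_nat.
rewrite mulrAC -[X in _ * X * _]ne -exprSr.
apply: le_trans (HC _) _; apply: ler_wpM2l => //.
exact: normal_pdf_ub.
Qed.

Let f k (x : R) := k%:R * F k.-1 x - g^-1 * F k.+1 x.

Let integrable_f k : mu.-integrable setT (EFin \o f k).
Proof.
have h1 := integrableZl measurableT k%:R (integrable_pow_pdf k.-1).
have h2 := integrableZl measurableT g^-1 (integrable_pow_pdf k.+1).
exact: integrableB h1 h2.
Qed.

Let continuous_f k : continuous (f k).
Proof.
move=> x; apply: cvgB.
  by apply: cvgM; [exact: cvg_cst|exact: continuous_F].
by apply: cvgM; [exact: cvg_cst|exact: continuous_F].
Qed.

Let D n : set R := [set` `[- (n.+1%:R : R), n.+1%:R]].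

Let integral_f_itv k n :
  (\int[mu]_(x in D n) (f k x)%:E =
   (F k (1 * n.+1%:R)%R)%:E - (F k (-1 * n.+1%:R)%R)%:E)%E.
Proof.
rewrite mul1r mulN1r; apply: continuous_FTC2.
- by rewrite gt0_cp.
- by apply: continuous_subspaceT; exact: continuous_f.
- split.
  + by move=> x _; have [] := is_derive_F k x.
  + by apply: cvg_at_right_filter; exact: continuous_F.
  + by apply: cvg_at_left_filter; exact: continuous_F.
- move=> x _; rewrite derive1E; exact: derive_val.
Qed.

(** [f k] is the derivative of [F k], which vanishes at both infinities: fundamental theorem on
    growing segments, then dominated convergence. *)
Let integral_f k : (\int[mu]_x (f k x)%:E = 0)%E.
Proof.
have cv0 : (\int[mu]_(x in D n) (f k x)%:E)%E @[n --> \oo] --> 0%E.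
  under eq_fun do rewrite integral_f_itv -EFinB.
  apply/fine_cvgP; split; first exact: nearW.
  have := cvgnB (F_cvg0 k (normr1 R)) (F_cvg0 k (e := -1) ltac:(by rewrite normrN1)).
  by rewrite subr0.
have cvI : (\int[mu]_x ((EFin \o f k) \_ (D n)) x)%E @[n --> \oo] -->
    (\int[mu]_x (f k x)%:E)%E.
  apply: (@dominated_cvg _ _ _ mu setT measurableT (fun n => (EFin \o f k) \_ (D n))
    (EFin \o f k) (fun x => `|(f k x)%:E|%E)).
  - move=> n; apply/(measurable_restrictT _ _).1 => //; first exact: measurable_itv.
    by apply: measurable_funTS; exact: measurable_int (integrable_f k).
  - move=> x _; apply: cvg_near_cst.
    have := @truncnS_gt R `|x|; set M := Num.truncn _ => hM.
    exists M => // n /= Mn; rewrite patchE mem_set// /D/= in_itv/= -ler_norml.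
    by apply: le_trans (ltW hM) _; rewrite ler_nat ltnS.
  - by [].
  - exact: integrable_abse (integrable_f k).
  - by move=> n x _; rewrite patchE; case: ifPn => _ //=; rewrite normr0 lee_fin.
have eD : (fun n => \int[mu]_x ((EFin \o f k) \_ (D n)) x)%E =
    (fun n => \int[mu]_(x in D n) (f k x)%:E)%E.
  by apply/funext => n; rewrite [RHS]integral_mkcond.
rewrite eD in cvI; exact: (cvg_unique _ cvI cv0).
Qed.

Definition normal_moment k : R := fine (\int[N]_x (x ^+ k)%:E)%E.

Lemma integral_normal_moment k : (\int[N]_x (x ^+ k)%:E = (normal_moment k)%:E)%E.
Proof.
by rewrite /normal_moment fineK//; exact: integrable_fin_num (integrable_normal_pow k).
Qed.

Lemma normal_moment0 : normal_moment 0 = 1.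
Proof.
rewrite /normal_moment; under eq_integral do rewrite expr0.
by rewrite integral_cst// mul1e [X in fine X](probability_setT N).
Qed.

(** Stein's identity for monomials. *)
Let by_parts k : k%:R * normal_moment k.-1 = g^-1 * normal_moment k.+1.
Proof.
have := integral_f k; rewrite /f.
under eq_integral do rewrite EFinB.
rewrite integralB_EFin//; last 2 first.
- by have := integrableZl measurableT k%:R (integrable_pow_pdf k.-1).
- by have := integrableZl measurableT g^-1 (integrable_pow_pdf k.+1).
under eq_integral do rewrite EFinM.
rewrite integralZl//; last exact: integrable_pow_pdf.
under [X in (_ - X)%E]eq_integral do rewrite EFinM.
rewrite integralZl//; last exact: integrable_pow_pdf.
rewrite -!integral_normal_pow !integral_normal_moment -!EFinM -EFinB => -[] h.
by apply/eqP; rewrite -subr_eq0; exact/eqP.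
Qed.

Lemma normal_moment1 : normal_moment 1 = 0.
Proof.
have /esym/eqP := by_parts 0; rewrite mul0r mulf_eq0 invr_eq0 gt_eqF//=.
by move=> /eqP.
Qed.

Lemma normal_momentSS k : normal_moment k.+2 = k.+1%:R * g * normal_moment k.
Proof.
have := by_parts k.+1; rewrite /= => h.
by rewrite mulrAC h; field; rewrite gt_eqF.
Qed.

Lemma normal_moment_odd k : normal_moment k.*2.+1 = 0.
Proof.
elim: k => [|k IH]; first exact: normal_moment1.
by rewrite doubleS normal_momentSS IH mulr0.
Qed.

Lemma normal_moment_even k :
  normal_moment k.*2 = (\prod_(i < k) (i.*2.+1)%:R) * g ^+ k.
Proof.
elim: k => [|k IH]; first by rewrite normal_moment0 big_ord0 expr0 mulr1.
by rewrite doubleS normal_momentSS IH big_ord_recr/= exprS; ring.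
Qed.

End NormalMoments.

(** * The method of moments *)

Section Taylor.
Variable R : realType.

Lemma is_derive_add (f g : R -> R) df dg (x : R) :
  is_derive x 1 f df -> is_derive x 1 g dg ->
  is_derive x 1 (fun x => f x + g x) (df + dg).
Proof. by move=> hf hg; apply: is_derive_eq. Qed.

Lemma is_derive_scale (c : R) (f : R -> R) df (x : R) :
  is_derive x 1 f df -> is_derive x 1 (fun x => c * f x) (c * df).
Proof.
move=> hf; have h := is_derive_mul (is_derive_cst c x 1) hf.
by apply: is_derive_eq h _; rewrite mul0r add0r.
Qed.

Lemma nonneg_of_derive (h dh : R -> R) (b : R) :
  (forall x : R, is_derive x 1 h (dh x)) -> h 0 = 0 ->
  (forall x, 0 <= x -> 0 <= dh x) -> 0 <= b -> 0 <= h b.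
Proof.
move=> hd h0 dh0 b0.
have [c] := MVT_segment b0 (fun x _ => hd x) (continuous_subspaceT (continuous_derivable hd)).
rewrite in_itv/= => /andP[c0 _]; rewrite h0 !subr0 => ->.
by rewrite mulr_ge0// dh0.
Qed.

(** With P(x) = x^(K+1) / (K+1)!, both P + r and P - r vanish at 0 and have a nonnegative derivative
    on the positive half-line. *)
Lemma integrate_pow_bound_pos (r dr : R -> R) K :
  (forall x : R, is_derive x 1 r (dr x)) -> r 0 = 0 ->
  (forall x, 0 <= x -> `|dr x| <= x ^+ K / K`!%:R) ->
  forall y, 0 <= y -> `|r y| <= y ^+ K.+1 / (K.+1)`!%:R.
Proof.
move=> hd r0 hb y y0.
have F0 : (K`!%:R : R) != 0 by rewrite pnatr_eq0 -lt0n fact_gt0.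
have dP (x : R) : is_derive x 1 (fun x => (K.+1)`!%:R^-1 * x ^+ K.+1) (x ^+ K / K`!%:R).
  apply: is_derive_eq (is_derive_scale _ (is_derive_pow K.+1 x)) _.
  rewrite factS natrM.
  have : (K.+1%:R : R) != 0 by rewrite pnatr_eq0.
  by rewrite -[K.+1.-1]/K; move: (K.+1%:R : R) => k k0; rewrite invfM mulrACA mulVf// mul1r mulrC.
have dN (x : R) : is_derive x 1 (fun x => -1 * r x) (- dr x).
  apply: is_derive_eq (is_derive_scale (-1) (hd x)) _.
  by rewrite mulN1r.
have P0 : (K.+1)`!%:R^-1 * (0 : R) ^+ K.+1 = 0 by rewrite expr0n mulr0.
rewrite mulrC ler_norml; apply/andP; split.
  rewrite -subr_ge0 opprK addrC.
  apply: (nonneg_of_derive (h := fun x => (K.+1)`!%:R^-1 * x ^+ K.+1 + r x)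
     (fun x => is_derive_add (dP x) (hd x))) => //.
    by rewrite P0 r0 addr0.
  by move=> x x0; have := hb x x0; rewrite ler_norml => /andP[]; lra.
rewrite -subr_ge0 -mulN1r.
apply: (nonneg_of_derive (h := fun x => (K.+1)`!%:R^-1 * x ^+ K.+1 + -1 * r x)
     (fun x => is_derive_add (dP x) (dN x))) => //.
  by rewrite P0 r0 mulr0 addr0.
by move=> x x0; have := hb x x0; rewrite ler_norml => /andP[]; lra.
Qed.

Lemma integrate_pow_bound (r dr : R -> R) K :
  (forall x : R, is_derive x 1 r (dr x)) -> r 0 = 0 ->
  (forall x, `|dr x| <= `|x| ^+ K / K`!%:R) ->
  forall y, `|r y| <= `|y| ^+ K.+1 / (K.+1)`!%:R.
Proof.
move=> hd r0 hb y; have [y0|y0] := leP 0 y.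
  rewrite [in leRHS]ger0_norm//.
  by apply: (integrate_pow_bound_pos hd r0) => // x x0; have := hb x; rewrite [in leRHS]ger0_norm.
have hd' (x : R) : is_derive x 1 (fun x => r (- x)) (- dr (- x)).
  have hN : is_derive x 1 (fun x : R => - x) (-1).
    by apply: is_derive_eq.
  have h := is_derive1_comp (f := r) (g := fun x : R => - x) (hd (- x)) hN.
  by apply: is_derive_eq h _; rewrite mulrN1.
rewrite [in leRHS]ltr0_norm// -{1}[y]opprK.
apply: (integrate_pow_bound_pos hd').
- by rewrite oppr0.
- by move=> x x0; rewrite normrN; have := hb (- x); rewrite normrN (ger0_norm x0).
- by rewrite oppr_ge0 ltW.
Qed.

(** The k-th derivative of sin at b is sin (b + k pi / 2): one formula for all k, so that
    differentiation only shifts b. *)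
Definition sin_taylor (b : R) K (y : R) : R :=
  \sum_(k < K) (sin (b + k%:R * (pi / 2)) / k`!%:R) * y ^+ k.

Lemma is_derive_sin_taylor b K (y : R) :
  is_derive y 1 (sin_taylor b K.+1) (sin_taylor (b + pi / 2) K y).
Proof.
elim: K => [|K IH].
  have -> : sin_taylor b 1 = fun=> sin (b + 0%:R * (pi / 2)) / 0`!%:R.
    by apply/funext => z; rewrite /sin_taylor big_ord1 expr0 mulr1.
  by rewrite /sin_taylor big_ord0; exact: is_derive_cst.
have -> : sin_taylor b K.+2 = fun y => sin_taylor b K.+1 y +
    (sin (b + K.+1%:R * (pi / 2)) / (K.+1)`!%:R) * y ^+ K.+1.
  by apply/funext => z; rewrite /sin_taylor big_ord_recr.
have h := is_derive_scale (sin (b + K.+1%:R * (pi / 2)) / (K.+1)`!%:R)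
  (is_derive_pow K.+1 y).
apply: is_derive_eq (is_derive_add IH h) _.
rewrite [RHS]/sin_taylor big_ord_recr/=; congr (_ + _).
have -> : b + pi / 2 + K%:R * (pi / 2) = b + K.+1%:R * (pi / 2).
  by rewrite -natr1; ring.
rewrite factS natrM; have F0 : (K`!%:R : R) != 0 by rewrite pnatr_eq0 -lt0n fact_gt0.
have : (K.+1%:R : R) != 0 by rewrite pnatr_eq0.
by move: (K.+1%:R : R) (sin _) => k z k0; field; rewrite F0 k0.
Qed.

Lemma sin_taylor_bound b K y : `|sin (y + b) - sin_taylor b K y| <= `|y| ^+ K / K`!%:R.
Proof.
elim: K b y => [|K IH] b y.
  rewrite /sin_taylor big_ord0 subr0 expr0 fact0 divr1 ler_norml.
  by rewrite sin_geN1 sin_le1.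
have hd (x : R) : is_derive x 1 (fun x => sin (x + b) + -1 * sin_taylor b K.+1 x)
    (sin (x + (b + pi / 2)) - sin_taylor (b + pi / 2) K x).
  have hN : is_derive x 1 (fun x : R => x + b) 1.
    by apply: is_derive_eq; rewrite addr0.
  have h := is_derive1_comp (f := sin) (g := fun x : R => x + b) (is_derive_sin (x + b)) hN.
  apply: is_derive_eq (is_derive_add h (is_derive_scale (-1) (is_derive_sin_taylor b K x))) _.
  by rewrite mulN1r mulr1 addrA sinDpihalf.
have r0 : sin (0 + b) + -1 * sin_taylor b K.+1 0 = 0.
  rewrite add0r mulN1r /sin_taylor big_ord_recl/= mul0r addr0 fact0 divr1 expr0 mulr1.
  by rewrite big1 ?addr0 ?subrr// => i _; rewrite /bump/= expr0n mulr0.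
by have := integrate_pow_bound hd r0 (IH (b + pi / 2)) y; rewrite mulN1r.
Qed.

End Taylor.

(** * Bernstein approximation *)

Section Bernstein.
Variable R : realType.
Implicit Types (G H : nat -> R) (y c : R).

(* [bernstein n G] is the expectation of G under the binomial law (n, 'X). *)
Fixpoint bernstein n G : {poly R} :=
  if n is n'.+1 then 'X * bernstein n' (fun k => G k.+1) + (1 - 'X) * bernstein n' G
  else (G 0)%:P.

Lemma bernsteinS n G y : (bernstein n.+1 G).[y] =
  y * (bernstein n (fun k => G k.+1)).[y] + (1 - y) * (bernstein n G).[y].
Proof. by rewrite /= !hornerE. Qed.

Lemma bernstein_lin n a b G H y :
  (bernstein n (fun k => a * G k + b * H k)).[y] =
  a * (bernstein n G).[y] + b * (bernstein n H).[y].
Proof.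
elim: n G H => [|n IH] G H; first by rewrite /= !hornerC.
by rewrite !bernsteinS !IH; ring.
Qed.

Lemma bernstein_cst n a y : (bernstein n (fun=> a)).[y] = a.
Proof.
elim: n => [|n IH]; first by rewrite hornerC.
by rewrite bernsteinS !IH; ring.
Qed.

Lemma ler_bernstein n G H y : 0 <= y <= 1 -> (forall k, G k <= H k) ->
  (bernstein n G).[y] <= (bernstein n H).[y].
Proof.
move=> /andP[y0 y1]; elim: n G H => [|n IH] G H GH; first by rewrite !hornerC.
rewrite !bernsteinS lerD// ler_wpM2l ?subr_ge0//; exact: IH.
Qed.

(** Squared bias plus the binomial variance; c is arbitrary because the recursion shifts it by
    one. *)
Lemma bernstein_sqr n c y : (bernstein n (fun k => (k%:R - c) ^+ 2)).[y] =
  (n%:R * y - c) ^+ 2 + n%:R * y * (1 - y).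
Proof.
elim: n c => [|n IH] c; first by rewrite hornerC; ring.
rewrite bernsteinS IH.
have -> : bernstein n (fun k => (k.+1%:R - c) ^+ 2) =
          bernstein n (fun k => (k%:R - (c - 1)) ^+ 2).
  by congr bernstein; apply/funext => k; rewrite -natr1; congr (_ ^+ 2); ring.
by rewrite IH -natr1; ring.
Qed.

(** Only x is confined to the segment: [bernstein_approx] compares h at a point of [0, 1] with h (k
    / n) for every k, including k > n. *)
Lemma unif_cont_segment (h : R -> R) (u w e : R) : continuous h -> 0 < e ->
  exists2 del, 0 < del & forall x y, u <= x <= w -> `|x - y| <= del ->
    `|h x - h y| <= e.
Proof.
move=> ch e0.
pose Q (n : nat) (x : R) := forall y, `|x - y| <= n.+1%:R^-1 -> `|h x - h y| <= e.
have /compact_near_coveringP/(_ nat \oo Q _) := @segment_compact R u w.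
case=> [x _|N _ HN]; last first.
  exists N.+1%:R^-1 => [|x y xuw]; first by rewrite invr_gt0.
  by apply: (HN N (leqnn _) x); rewrite /= in_itv.
have e2 : 0 < e / 2 by rewrite divr_gt0.
have /cvgrPdist_le/(_ _ e2)/nbhs_ballP[d /= d0 hd] := ch x.
have d2 : 0 < d / 2 by rewrite divr_gt0.
have /cvgn_dist/(_ _ d2)[M HM] := @cvg_harmonic R.
exists (ball x (d / 2), [set n | (M <= n)%N]).
  split; last by exists M.
  exact: nbhsx_ballx.
move=> [z n] /= [xz Mn] y zy.
have hn := HM n Mn; rewrite /harmonic/= subr0 ger0_norm// in hn.
rewrite /ball/= in xz.
have h1 : `|h x - h z| <= e / 2.
  by apply: hd; rewrite /ball/=; apply: lt_trans xz _; lra.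
have h2 : `|h x - h y| <= e / 2.
  apply: hd; rewrite /ball/=.
  have h3 := ler_normD (x - z) (z - y); rewrite subrKA in h3.
  apply: le_lt_trans h3 _; have -> : d = d / 2 + d / 2 by lra.
  by apply: ltr_leD => //; exact: le_trans zy hn.
have h3 := ler_normD (h z - h x) (h x - h y); rewrite subrKA (distrC (h z) (h x)) in h3.
suff g : `|h z - h y| <= e by exact: g.
apply: le_trans h3 _; rewrite [leRHS](_ : e = e / 2 + e / 2); last by lra.
exact: lerD h1 h2.
Qed.

Lemma bernstein_approx (h : R -> R) (M e : R) : continuous h ->
  (forall x, `|h x| <= M) -> 0 < e ->
  exists p : {poly R}, forall y, 0 <= y <= 1 -> `|p.[y] - h y| <= e.
Proof.
move=> ch hM e0; have e2 : 0 < e / 2 by rewrite divr_gt0.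
have [del d0 hd] := unif_cont_segment 0 1 ch e2.
have M0 : 0 <= M by exact: le_trans (hM 0).
(* A value of 1 / n below this makes 2 M / (n del^2) at most e / 2; the 1 in 2 M + 1 covers M =
   0. *)
have K0 : 0 < e / 2 / (2 * M + 1) * del ^+ 2.
  by rewrite !mulr_gt0 ?invr_gt0 ?exprn_gt0//; lra.
have /cvgn_dist/(_ _ K0)[N HN] := @cvg_harmonic R.
have n0 : 0 < N.+1%:R :> R by rewrite ltr0n.
have hN := HN N (leqnn _); rewrite /harmonic/= subr0 ger0_norm// in hN.
pose n := N.+1; pose G k : R := h (k%:R / n%:R).
exists (bernstein n G) => y y01.
(* Chebyshev's argument as a pointwise bound: if k / n is within del of y the deviation is at most e
   / 2, otherwise the quadratic term is at least 2 M. *)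
pose W k : R := e / 2 * 1 + 2 * M / (del * n%:R) ^+ 2 * (k%:R - n%:R * y) ^+ 2.
have dn0 : 0 < del * n%:R by rewrite mulr_gt0.
have GW k : `|G k - h y| <= W k.
  rewrite /W /G; have s0 : 0 <= 2 * M / (del * n%:R) ^+ 2 * (k%:R - n%:R * y) ^+ 2.
    by rewrite mulr_ge0 ?sqr_ge0// divr_ge0 ?sqr_ge0// mulr_ge0.
  have [c|c] := leP `|y - k%:R / n%:R| del.
    by have := hd _ _ y01 c; rewrite distrC; lra.
  apply: (@le_trans _ _ (2 * M)).
    by have := ler_normB (h (k%:R / n%:R)) (h y); have := hM (k%:R / n%:R); have := hM y; lra.
  have dd : 1 <= (k%:R - n%:R * y) ^+ 2 / (del * n%:R) ^+ 2.
    rewrite ler_pdivlMr ?exprn_gt0// mul1r -[leRHS]ger0_norm ?sqr_ge0// normrX.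
    rewrite lerXn2r ?nnegrE ?(ltW dn0)//.
    have -> : k%:R - n%:R * y = - ((y - k%:R / n%:R) * n%:R).
      by field; rewrite gt_eqF.
    by rewrite normrN normrM normr_nat ler_wpM2r// ltW.
  have := ler_wpM2l (mulr_ge0 (ler0n _ 2) M0) dd.
  by rewrite mulr1 [_ * (_ / _)]mulrA [_ * _ / _]mulrAC; lra.
have E : (bernstein n W).[y] = e / 2 + 2 * M / (del * n%:R) ^+ 2 * (n%:R * y * (1 - y)).
  rewrite /W (bernstein_lin n _ _ (fun=> 1) (fun k => (k%:R - n%:R * y) ^+ 2)).
  by rewrite bernstein_cst bernstein_sqr subrr; ring.
have bd : (bernstein n W).[y] <= e.
  rewrite E [leRHS](_ : e = e / 2 + e / 2); last by lra.
  rewrite lerD2l.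
  have -> : 2 * M / (del * n%:R) ^+ 2 * (n%:R * y * (1 - y)) =
     (2 * M) * (y * (1 - y)) * n%:R^-1 / del ^+ 2.
    by field; rewrite !gt_eqF.
  rewrite ler_pdivrMr ?exprn_gt0//.
  have yy : y * (1 - y) <= 1 by nra.
  have yy0 : 0 <= y * (1 - y) by nra.
  apply: (@le_trans _ _ ((2 * M + 1) * n%:R^-1)).
    rewrite ler_wpM2r// ?invr_ge0//.
    have h1 := ler_wpM2l (mulr_ge0 (ler0n R 2) M0) yy; lra.
  have M1 : 0 < 2 * M + 1 by lra.
  have := ler_wpM2l (ltW M1) hN => /le_trans; apply.
  by rewrite le_eqVlt; apply/orP; left; apply/eqP; field; rewrite gt_eqF.
have hconst : (bernstein n (fun k => 1 * G k + -1 * h y)).[y] = (bernstein n G).[y] - h y.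
  by rewrite (bernstein_lin n 1 (-1) G (fun=> h y)) bernstein_cst mul1r mulN1r.
have up : (bernstein n G).[y] - h y <= (bernstein n W).[y].
  rewrite -hconst; apply: ler_bernstein => // k; rewrite mul1r mulN1r.
  exact: le_trans (ler_norm _) (GW k).
have lo : - (bernstein n W).[y] <= (bernstein n G).[y] - h y.
  rewrite -hconst; have -> : - (bernstein n W).[y] = (bernstein n (fun k => -1 * W k + 0 * W k)).[y].
    by rewrite (bernstein_lin n (-1) 0 W W) mul0r addr0 mulN1r.
  apply: ler_bernstein => // k; rewrite mul1r !mulN1r mul0r addr0.
  by have := GW k; rewrite ler_norml => /andP[].
by rewrite ler_norml; apply/andP; split; lra.
Qed.

End Bernstein.

(** * From moments to bounded continuous functions, through sines *)

Section MethodOfMoments.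
Variables (R : realType) (nu : probability (measurableTypeR R) R).
Variable E : nat -> (R -> R) -> R.
Hypothesis Elin : forall n a b (f g : R -> R),
  E n (fun x => a * f x + b * g x) = a * E n f + b * E n g.
Hypothesis Emono : forall n (f g : R -> R), (forall x, f x <= g x) -> E n f <= E n g.

Let I (f : R -> R) : R := fine (\int[nu]_x (f x)%:E)%E.

(** Integrability is included because [I] reads the integral through [fine], which sends an infinite
    value to 0. *)
Definition limit_agrees (f : R -> R) : Prop :=
  nu.-integrable setT (EFin \o f) /\ E n f @[n --> \oo] --> I f.

Let E_norm n (f g : R -> R) : (forall x, `|f x| <= g x) -> `|E n f| <= E n g.
Proof.
move=> fg; rewrite ler_norml; apply/andP; split; last first.
  by apply: Emono => x; exact: le_trans (ler_norm _) (fg x).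
have -> : - E n g = E n (fun x => -1 * g x + 0 * g x).
  by rewrite Elin mulN1r mul0r addr0.
apply: Emono => x; rewrite mulN1r mul0r addr0.
by have := fg x; rewrite ler_norml => /andP[].
Qed.

Let I_lin a b (f g : R -> R) :
  nu.-integrable setT (EFin \o f) -> nu.-integrable setT (EFin \o g) ->
  nu.-integrable setT (EFin \o (fun x => a * f x + b * g x)) /\
  I (fun x => a * f x + b * g x) = a * I f + b * I g.
Proof.
move=> fi gi; have fi' := integrableZl measurableT a fi.
have gi' := integrableZl measurableT b gi.
have fN := integrable_fin_num measurableT fi; have gN := integrable_fin_num measurableT gi.
split; first exact: integrableD fi' gi'.
rewrite /I; transitivity (fine (\int[nu]_x (a%:E * (f x)%:E + b%:E * (g x)%:E))%E) => //.
rewrite integralD// integralZl// integralZl//.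
rewrite -(fineK fN) -(fineK gN).
by rewrite -!EFinM -EFinD.
Qed.

Lemma limit_agrees_lin a b (f g : R -> R) : limit_agrees f -> limit_agrees g ->
  limit_agrees (fun x => a * f x + b * g x).
Proof.
move=> [fi fc] [gi gc]; have [i e] := I_lin a b fi gi; split => //.
rewrite e; have h := cvgnD (cvgnM (cvgn_cst (l := a)) fc) (cvgnM (cvgn_cst (l := b)) gc).
by apply: (eq_cvgn h) => n; rewrite Elin.
Qed.

Lemma limit_agrees_sum (J : finType) (c : J -> R) (f : J -> R -> R) :
  (forall j, limit_agrees (f j)) -> limit_agrees (fun x => \sum_j c j * f j x).
Proof.
move=> hf.
have h0 : limit_agrees (fun=> 0).
  have I0 : I (fun=> 0) = 0 by rewrite /I integral0.
  split; first exact: integrable0.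
  rewrite I0; apply: (eq_cvgn (cvgn_cst (l := 0 : R))) => n.
  by have h := Elin n 0 0 (fun=> 0) (fun=> 0); rewrite !mul0r !addr0 in h.
elim: (index_enum J) => [|j s IH].
  by under eq_fun do rewrite big_nil.
have := limit_agrees_lin (c j) 1 (hf j) IH.
by under eq_fun do rewrite mul1r; under [X in _ -> limit_agrees X]eq_fun do rewrite big_cons.
Qed.

(** The error b need not be bounded, which admits monomials as error terms; it must lie in the class
    itself and have a small integral. *)
Lemma limit_agrees_approx (f : R -> R) : measurable_fun setT f ->
  (forall e, 0 < e -> exists p b : R -> R, [/\ limit_agrees p, limit_agrees b,
     forall x, `|f x - p x| <= b x & I b <= e]) ->
  limit_agrees f.
Proof.
move=> mf H.
have Ile (f1 f2 : R -> R) : nu.-integrable setT (EFin \o f1) -> nu.-integrable setT (EFin \o f2) ->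
    (forall x, f1 x <= f2 x) -> I f1 <= I f2.
  move=> i1 i2 le; apply: fine_le; [exact: integrable_fin_num|exact: integrable_fin_num|].
  by apply: le_integral => // x _; rewrite lee_fin.
have fi : nu.-integrable setT (EFin \o f).
  have [p [b [[pi _] [bi _] hb _]]] := H 1 ltr01.
  have pai : nu.-integrable setT (EFin \o (fun x => `|p x|)) by exact: integrable_abse pi.
  have [si _] := I_lin 1 1 pai bi.
  apply: le_integrable si => //; first exact/measurable_EFinP.
  move=> x _ /=; rewrite lee_fin !mul1r; apply: le_trans (ler_norm _).
  have h1 := ler_normD (p x) (f x - p x); rewrite [p x + _]addrC subrK in h1.
  by have := hb x; lra.
split => //; apply/cvgn_dist => e e0.
(* Four errors: the convergence for p, the convergence for b, and the integral of b twice, once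
   through [E n b] and once in the limit. *)
have e4 : 0 < e / 4 by rewrite divr_gt0.
have [p [b [[pi pc] [bi bc] hb Ib]]] := H _ e4.
have [N1 HN1] := (cvgn_dist _ _).1 pc _ e4.
have [N2 HN2] := (cvgn_dist _ _).1 bc _ e4.
exists (N1 + N2)%N => n Nn.
have h1 := HN1 n ltac:(lia); have h2 := HN2 n ltac:(lia).
have h3 : `|E n f - E n p| <= E n b.
  have -> : E n f - E n p = E n (fun x => 1 * f x + -1 * p x).
    by rewrite Elin mul1r mulN1r.
  by apply: E_norm => x; rewrite mul1r mulN1r.
have h4 : `|I f - I p| <= I b.
  have [di e1] := I_lin 1 (-1) fi pi.
  have -> : I f - I p = I (fun x => 1 * f x + -1 * p x).
    by rewrite e1 mul1r mulN1r.
  rewrite ler_norml; apply/andP; split.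
    have [bi' e2] := I_lin (-1) 0 bi bi.
    have -> : - I b = I (fun x => -1 * b x + 0 * b x).
      by rewrite e2 mulN1r mul0r addr0.
    apply: Ile => // x; rewrite mul1r !mulN1r mul0r addr0.
    by have := hb x; rewrite ler_norml => /andP[].
  by apply: Ile => // x; rewrite mul1r mulN1r; exact: le_trans (ler_norm _) (hb x).
move: h1 h2 h3 h4; rewrite !ler_norml => /andP[? ?] /andP[? ?] /andP[? ?] /andP[? ?].
by apply/andP; split; lra.
Qed.

Hypothesis moments : forall k, limit_agrees (fun x => x ^+ k).
Hypothesis tails : forall a : R,
  a ^+ j * I (fun x => x ^+ j.*2) / (j.*2)`!%:R @[j --> \oo] --> (0 : R).

(** The Taylor remainder of even order 2j is at most a multiple of x^(2j), whose integral is made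
    small by [tails]. *)
Lemma limit_agrees_sin a b : limit_agrees (fun x => sin (a * x + b)).
Proof.
apply: limit_agrees_approx.
  apply: continuous_measurable_fun => x; apply: continuous_comp; last exact: continuous_sin.
  by apply: cvgD; [apply: cvgM; [exact: cvg_cst|exact: cvg_id]|exact: cvg_cst].
move=> e e0; have /cvgn_dist/(_ _ e0)[j Hj] := tails (a ^+ 2).
pose C := (a ^+ 2) ^+ j / (j.*2)`!%:R.
exists (fun x => \sum_(k < j.*2) (sin (b + k%:R * (pi / 2)) / k`!%:R * a ^+ k) * x ^+ k).
exists (fun x => C * x ^+ j.*2 + 0 * x ^+ j.*2); split.
- by apply: limit_agrees_sum => k; exact: moments.
- exact: limit_agrees_lin.
- move=> x; have -> : \sum_(k < j.*2) (sin (b + k%:R * (pi / 2)) / k`!%:R * a ^+ k) * x ^+ k =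
      sin_taylor b j.*2 (a * x).
    by rewrite /sin_taylor; apply: eq_bigr => k _; rewrite exprMn -[LHS]mulrA.
  apply: le_trans (sin_taylor_bound b j.*2 (a * x)) _; rewrite mul0r addr0 /C.
  have -> : `|a * x| ^+ j.*2 = (a ^+ 2) ^+ j * x ^+ j.*2.
    rewrite -mul2n exprM [in RHS](exprM x) -exprMn -exprMn; congr (_ ^+ _).
    by rewrite -normrX ger0_norm ?sqr_ge0.
  by rewrite mulrAC.
- have [mi _] := moments j.*2; have [_ ->] := I_lin C 0 mi mi.
  rewrite mul0r addr0; have := Hj j (leqnn _); rewrite subr0 => /(le_trans (ler_norm _)).
  by rewrite /C mulrAC.
Qed.

(** Since sin u sin w is half of cos (u - w) - cos (u + w) and a cosine is a sine with phase pi / 2,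
    one factor sin (t x) is absorbed into new values of a and b. *)
Lemma limit_agrees_sin_pow t k a b :
  limit_agrees (fun x => sin (t * x) ^+ k * sin (a * x + b)).
Proof.
elim: k a b => [|k IH] a b.
  by under eq_fun do rewrite expr0 mul1r; exact: limit_agrees_sin.
have h := limit_agrees_lin (1 / 2) (- (1 / 2)) (IH (t - a) (- b + pi / 2)) (IH (t + a) (b + pi / 2)).
suff -> : (fun x => sin (t * x) ^+ k.+1 * sin (a * x + b)) = (fun x : R =>
    1 / 2 * (sin (t * x) ^+ k * sin ((t - a) * x + (- b + pi / 2))) +
    - (1 / 2) * (sin (t * x) ^+ k * sin ((t + a) * x + (b + pi / 2)))) by [].
apply/funext => x; rewrite !addrA !sinDpihalf.
have -> : (t - a) * x - b = t * x - (a * x + b) by ring.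
have -> : (t + a) * x + b = t * x + (a * x + b) by ring.
rewrite cosB (cosD (t * x)) exprS; move: (cos (a * x + b)) (sin (a * x + b)) => u w; by field.
Qed.

Lemma limit_agrees_poly_sin t (p : {poly R}) : limit_agrees (fun x => p.[sin (t * x)]).
Proof.
under eq_fun do rewrite horner_coef.
apply: limit_agrees_sum => k.
have := limit_agrees_sin_pow t k 0 (pi / 2).
by under eq_fun do rewrite mul0r add0r sin_pihalf mulr1.
Qed.

(** For |x| <= K and t = 1 / (2 K), x is a continuous function of sin (t x), so f is uniformly close
    there to a polynomial in sin (t x). Outside, the error is at most D, hence at most D x^2 / K^2,
    and the second moment controls it. *)
Lemma limit_agrees_bounded (f : R -> R) M : continuous f -> (forall x, `|f x| <= M) ->
  limit_agrees f.
Proof.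
move=> cf fM; have M0 : 0 <= M by exact: le_trans (fM 0).
apply: limit_agrees_approx; first exact: continuous_measurable_fun.
move=> e e0.
have e2 : 0 < e / 2 by rewrite divr_gt0.
pose m2 := I (fun x => x ^+ 2).
have m20 : 0 <= m2 by apply: fine_ge0; apply: integral_ge0 => x _; rewrite lee_fin sqr_ge0.
have I1 : I (fun=> 1) = 1.
  by rewrite /I integral_cst// mul1e [X in fine X](probability_setT nu).
(* Bounds the error at every x: M from f, M from h, and less than e from Bernstein's
   approximation. *)
pose D := 2 * M + e.
have D0 : 0 < D by rewrite /D; lra.
have q0 : 0 <= D * m2 / (e / 2).
  by apply: divr_ge0; [apply: mulr_ge0 => //; exact: ltW|exact: ltW].
(* Chosen so that D m2 / K^2 <= e / 2; the added 1 keeps K positive. *)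
pose K := Num.sqrt (D * m2 / (e / 2) + 1).
have K2 : K ^+ 2 = D * m2 / (e / 2) + 1.
  by rewrite sqr_sqrtr// addr_ge0.
have K0 : 0 < K by rewrite sqrtr_gt0 ltr_wpDl.
pose t := (2 * K)^-1.
pose c := sin (1 / 2 : R).
have pi2 : 1 <= (pi : R) / 2 by exact: pihalf_ge1.
have in_half (u : R) : `|u| <= 1 / 2 -> u \in `[- (pi / 2), pi / 2].
  by rewrite ler_norml in_itv/= => /andP[? ?]; apply/andP; split; lra.
have c1 : c < 1.
  rewrite -sin_pihalf /c ltr_sin; [lra| |].
    by apply: in_half; rewrite ger0_norm; lra.
  by rewrite in_itv/=; lra.
have c0 : 0 < c.
  by rewrite /c; apply: sin_gt0_pihalf; lra.
(* Clipping to [-c, c] with c = sin (1/2) < 1 keeps the argument of arcsine strictly inside (-1, 1),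
   so h is continuous on the whole line. Nothing is clipped when |x| <= K, since then |t x| <=
   1/2. *)
pose clip (y : R) := Num.max (- c) (Num.min c y).
have clip_in y : - c <= clip y <= c.
  by rewrite /clip le_max lexx/= ge_max ge_min lexx/= andbT; lra.
pose h (y : R) := f (asin (clip (2 * y - 1)) / t).
have ch : continuous h.
  move=> y; apply: (@continuous_comp _ _ _ (fun y : R => asin (clip (2 * y - 1)) / t) f); last exact: cf.
  apply: cvgM; last exact: cvg_cst.
  apply: (@continuous_comp _ _ _ (fun y : R => clip (2 * y - 1)) asin); last first.
    by apply: continuous_asin; have /andP[] := clip_in (2 * y - 1); lra.
  apply: (@continuous_max _ _ (fun=> - c)); first exact: cvg_cst.
  apply: (@continuous_min _ _ (fun=> c)); first exact: cvg_cst.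
  by apply: cvgB; [apply: cvgM; [exact: cvg_cst|exact: cvg_id]|exact: cvg_cst].
have [p hp] := bernstein_approx ch (fun y => fM _) e2.
(* Affine change from the range [-1, 1] of sin to the segment [0, 1] of Bernstein's
   approximation. *)
pose P := p \Po ((1 / 2)%:P * (1 + 'X)).
have PE y : P.[y] = p.[1 / 2 * (1 + y)] by rewrite /P horner_comp !hornerE.
exists (fun x => P.[sin (t * x)]), (fun x => e / 2 * x ^+ 0 + D / K ^+ 2 * x ^+ 2); split.
- exact: limit_agrees_poly_sin.
- exact: limit_agrees_lin.
- move=> x; rewrite expr0 mulr1 PE.
  set y := 1 / 2 * (1 + sin (t * x)).
  have y01 : 0 <= y <= 1.
    by have := sin_le1 (t * x); have := sin_geN1 (t * x); rewrite /y; lra.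
  have hy := hp y y01.
  have s0 : 0 <= D / K ^+ 2 * x ^+ 2.
    by rewrite mulr_ge0 ?sqr_ge0// divr_ge0 ?sqr_ge0 ?(ltW D0).
  have [xK|xK] := leP `|x| K.
    have tx : `|t * x| <= 1 / 2.
      rewrite normrM ger0_norm ?invr_ge0 ?mulr_ge0 ?(ltW K0)//.
      rewrite /t ler_pdivrMl ?mulr_gt0//; lra.
    have fx : f x = h y.
      rewrite /h; have -> : 2 * y - 1 = sin (t * x) by rewrite /y; field.
      have sc : - c <= sin (t * x) <= c.
        have half : `|1 / 2 : R| <= 1 / 2 by rewrite ger0_norm; lra.
        have nhalf : `|- (1 / 2) : R| <= 1 / 2 by rewrite normrN.
        have [t1 t2] := andP (eq_ind _ is_true tx _ (ler_norml _ _)).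
        apply/andP; split; rewrite /c -?sinN leNgt ltr_sin ?in_half// -leNgt; lra.
      have -> : clip (sin (t * x)) = sin (t * x).
        have /andP[sc1 sc2] := sc.
        by rewrite /clip (min_idPr sc2) (max_idPr sc1).
      rewrite sinK ?in_half// mulrC mulKf// invr_eq0 mulf_eq0 negb_or.
      by rewrite (gt_eqF K0) pnatr_eq0.
    rewrite fx distrC; lra.
  have h1 : `|f x - p.[y]| <= D.
    have := ler_normD (f x - h y) (h y - p.[y]); rewrite subrKA (distrC (h y)) => h1.
    have h2 : `|f x - h y| <= 2 * M.
      by have := ler_normB (f x) (h y); have := fM x; have := fM (asin (clip (2 * y - 1)) / t); rewrite -/(h y); lra.
    by rewrite /D; lra.
  have h2 : D <= D / K ^+ 2 * x ^+ 2.
    rewrite mulrAC ler_pdivlMr ?exprn_gt0// ler_wpM2l ?(ltW D0)//.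
    by rewrite -[x ^+ 2]ger0_norm ?sqr_ge0// normrX lerXn2r ?nnegrE ?(ltW K0)// ltW.
  lra.
- have [i0 _] := moments 0; have [i2 _] := moments 2.
  have [_ ->] := I_lin (e / 2) (D / K ^+ 2) i0 i2.
  have -> : I (fun x => x ^+ 0) = 1.
    by rewrite -I1; congr I; apply/funext => x; rewrite expr0.
  rewrite -/m2 mulr1 [leRHS](_ : e = e / 2 + e / 2); last by lra.
  rewrite lerD2l mulrAC ler_pdivrMr ?exprn_gt0// K2.
  have -> : e / 2 * (D * m2 / (e / 2) + 1) = D * m2 + e / 2.
    by field; rewrite gt_eqF.
  lra.
Qed.

End MethodOfMoments.

(** * Moments of the normalized count *)

Section MallowsTransfer.
Context (R : realType) (q : R) (d : measure_display) (T : measurableType d).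
Variables (P : probability T R) (n : nat) (tau : T -> 'S_n).
Hypothesis htau : is_Mallows P q tau.

Lemma integral_Mallows (g : 'S_n -> R) :
  (\int[P]_w (g (tau w))%:E = (mexp q g)%:E)%E.
Proof.
have [mtau law] := htau.
have mI s : measurable (tau @^-1` [set s]) by exact: mtau.
have iI s : P.-integrable setT (fun w => (\1_(tau @^-1` [set s]) w)%:E).
  exact: integrable_indic.
have iI' s := integrableZl measurableT (g s) (iI s).
transitivity (\int[P]_w (\sum_(s : 'S_n) ((g s)%:E * (\1_(tau @^-1` [set s]) w)%:E)))%E.
  apply: eq_integral => w _; rewrite (bigD1 (tau w))//= big1 ?adde0.
    by rewrite indicE mem_set//= mule1.
  by move=> s sw; rewrite indicE memNset ?mule0//= => e; rewrite e eqxx in sw.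
rewrite integral_sum// /mexp mulr_suml -sumEFin; apply: eq_bigr => s _.
rewrite integralZl// integral_indic// setIT [X in (_ * X)%E](law s) -EFinM.
by congr EFin; ring.
Qed.

End MallowsTransfer.

Section FactDouble.

Lemma fact_double j : ((j.*2)`! = (\prod_(i < j) i.*2.+1) * (2 ^ j * j`!))%N.
Proof.
elim: j => [|j IH]; first by rewrite big_ord0.
rewrite doubleS !factS IH big_ord_recr/= expnS.
by rewrite -[j.*2.+2]/(j.+1.*2) -muln2; lia.
Qed.

Lemma bin_le_pow n k : ('C(n, k) <= n ^ k)%N.
Proof.
by apply: leq_trans (ffact_le_expn _ _); rewrite -bin_ffact leq_pmulr// fact_gt0.
Qed.

(** By Pascal's rule the difference is a single binomial of lower index k - 1. *)
Lemma binB_pred_bound n k : (1 < n)%N -> (0 < k)%N ->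
  ('C(n - 1, k) - 'C(n - 2, k) <= n ^ k.-1)%N.
Proof.
case: n => [|[|n]]// _; case: k => // k _; rewrite subn1 subn2/= binS addKn.
apply: leq_trans (bin_le_pow _ _) _; case: k => // k.
by rewrite leq_exp2r//; lia.
Qed.

End FactDouble.

Section NormalizedMoments.
Variables (R : realType) (q : R) (r : nat).
Hypotheses (hq : 0 < q < 1) (hr : (2 <= r)%N).

Let m : R := q / (1 - q).
Let v : R := q / (1 - q) ^+ 2.
Let k := (r - 2)%N.
Let g : R := v / (k`!%:R ^+ 2).

Let q0 : 0 < q. Proof. by case/andP: hq. Qed.
Let omq : 0 < 1 - q. Proof. by case/andP: hq => _; rewrite subr_gt0. Qed.

Lemma variance_gt0 : 0 < g.
Proof.
rewrite /g /v !divr_gt0// ?exprn_gt0// ltr0n fact_gt0//.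
Qed.

Definition normalized_count n (s : 'S_n) : R :=
  ((occ_id r s)%:R - 'C(n, r)%:R + 'C(n, r - 1)%:R * (r - 1)%:R * m)
  / (n%:R `^ (r%:R - 3 / 2)).

Let sq n : R := Num.sqrt n%:R.

Let sq_gt0 n : (0 < n)%N -> 0 < sq n.
Proof. by move=> n0; rewrite sqrtr_gt0 ltr0n. Qed.

Let sqE n : sq n ^+ 2 = n%:R.
Proof. by rewrite sqr_sqrtr. Qed.

Let denomE n : (0 < n)%N -> n%:R `^ (r%:R - 3 / 2) = n%:R ^+ k * sq n.
Proof.
move=> n0; have -> : (r%:R - 3 / 2 : R) = k%:R + 2^-1.
  by rewrite /k natrB//; field.
rewrite powRD; last by rewrite pnatr_eq0 -lt0n n0 implybT.
by rewrite powR_mulrn// powR12_sqrt.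
Qed.

Let b n : R := 'C(n - 2, k)%:R / n%:R ^+ k.
Let main n (s : 'S_n) : R := - b n * (((inversions s)%:R - n%:R * m) / sq n).
Let rest n (s : 'S_n) : R := normalized_count s - main s.

(** The centering equals n ['C(n - 1, k)] m while the expansion produces ['C(n - 2, k)]: their
    difference gives the first term and the Bonferroni error the second. Both are nonnegative. *)
Let rest_bound n (s : 'S_n) : (1 < n)%N ->
  0 <= rest s <= m / sq n + 3 * (code_energy s)%:R / (n%:R * sq n).
Proof.
move=> n1; have n0 : (0 < n)%N by lia.
have sN := sq_gt0 n0; have nR : (0 : R) < n%:R by rewrite ltr0n.
have [err [e1 e2]] := occ_id_expansion s hr n0.
pose dd : R := 'C(n - 1, k)%:R - 'C(n - 2, k)%:R.
have m0 : 0 <= m by rewrite divr_ge0 ?(ltW q0) ?(ltW omq).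
have dd0 : 0 <= dd by rewrite subr_ge0 ler_nat leq_bin2l//; lia.
have dd1 : n%:R * dd <= n%:R ^+ k.
  have [k0|k0] := posnP k; first by rewrite /dd k0 !bin0 subrr mulr0.
  rewrite /dd -natrB; last by apply: leq_bin2l; lia.
  rewrite -natrX -natrM ler_nat -(prednK k0) expnS leq_mul2l prednK//.
  by rewrite binB_pred_bound// orbT.
have cE : 'C(n, r - 1)%:R * (r - 1)%:R = n%:R * 'C(n - 1, k)%:R :> R.
  rewrite -!natrM; congr (_%:R); have -> : (r - 1 = k.+1)%N by rewrite /k; lia.
  by rewrite mulnC -mul_bin_diag subn1.
have restE : rest s = (n%:R * dd * m + err%:R) / (n%:R ^+ k * sq n).
  rewrite /rest /normalized_count /main denomE// cE /b /dd.
  have := congr1 (fun x : nat => x%:R : R) e1; rewrite !natrD natrM -/k => e3.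
  have -> : (occ_id r s)%:R = 'C(n, r)%:R + err%:R -
     (inversions s)%:R * 'C(n - 2, k)%:R :> R by rewrite -e3; ring.
  have X0 : (n%:R ^+ k : R) != 0 by rewrite expf_neq0// gt_eqF.
  by move: (n%:R ^+ k : R) X0 => X X0; field; rewrite X0 gt_eqF.
have D0 : 0 < n%:R ^+ k * sq n by rewrite mulr_gt0// exprn_gt0.
have N0 : 0 <= n%:R * dd * m + err%:R by rewrite addr_ge0// mulr_ge0// mulr_ge0.
rewrite restE (divr_ge0 N0 (ltW D0))/=.
rewrite mulrDl lerD//.
  rewrite ler_pdivrMr//.
  have -> : m / sq n * (n%:R ^+ k * sq n) = n%:R ^+ k * m by field; rewrite gt_eqF.
  exact: ler_wpM2r.
have e3 : err%:R * n%:R ^+ 3 <= 3 * (code_energy s)%:R * n%:R ^+ r :> R.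
  by rewrite -!natrX -!natrM ler_nat.
rewrite ler_pdivrMr//.
have -> : 3 * (code_energy s)%:R / (n%:R * sq n) * (n%:R ^+ k * sq n) =
   3 * (code_energy s)%:R * n%:R ^+ r / n%:R ^+ 3.
  have -> : r = k.+2 by rewrite /k; lia.
  by rewrite 2!exprS; field; rewrite !gt_eqF.
by rewrite ler_pdivlMr ?exprn_gt0.
Qed.

Let inv_sq_cvg : (sq n)^-1 @[n --> \oo] --> (0 : R).
Proof.
apply/cvgn_dist => e e0; have e2 : 0 < e ^+ 2 by rewrite exprn_gt0.
have /cvgn_dist/(_ _ e2)[N HN] := @cvgn_invn R.
exists N.+1 => n Nn; have n0 : (0 < n)%N by lia.
have := HN n ltac:(lia); rewrite !subr0 -sqE -exprVn.
rewrite !ger0_norm ?invr_ge0 ?exprn_ge0 ?invr_ge0 ?sqrtr_ge0//.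
by rewrite ler_pXn2r ?nnegrE ?invr_ge0 ?sqrtr_ge0 ?(ltW e0).
Qed.

Let energy_cvg0 p : (0 < p)%N ->
  mexp q (fun s : 'S_n => ((code_energy s)%:R / (n%:R * sq n)) ^+ p) @[n --> \oo] --> (0 : R).
Proof.
move=> p0; have [C C0 HC] := mexp_energy_pow hq p.
have h := cvgnM (cvgn_cst (l := C)) (cvgn_exp (k := p) inv_sq_cvg).
rewrite expr0n gtn_eqF// mulr0 in h.
apply: (dom_cvgn0 (N := 1) h) => n n0.
have nR : (0 : R) < n%:R by rewrite ltr0n.
have sN := sq_gt0 n0.
rewrite ger0_norm; last first.
  apply: mexp_ge0 => // s; rewrite exprn_ge0// divr_ge0// mulr_ge0// ltW//.
have -> : mexp q (fun s : 'S_n => ((code_energy s)%:R / (n%:R * sq n)) ^+ p) =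
    (n%:R * sq n) ^- p * mexp q (fun s : 'S_n => (code_energy s)%:R ^+ p).
  by rewrite -mexpZ; apply: eq_mexp => s; rewrite expr_div_n mulrC.
rewrite mulrC ler_pdivrMr ?exprn_gt0 ?mulr_gt0//.
apply: le_trans (HC n) _; rewrite -mulrA ler_wpM2l// exprMn exprVn.
by rewrite mulrCA mulVf ?mulr1// expf_neq0// gt_eqF.
Qed.

(** Even powers are what Cauchy-Schwarz calls for in [normalized_count_moment]. *)
Let rest_moment j : mexp q (fun s : 'S_n => rest s ^+ (j.+1).*2) @[n --> \oo] --> (0 : R).
Proof.
set p := (j.+1).*2.
have m0 : 0 <= m by rewrite divr_ge0 ?(ltW q0) ?(ltW omq).
have hm : (m / sq n) ^+ p @[n --> \oo] --> (0 : R).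
  have h := cvgnM (cvgn_cst (l := (m ^+ 2) ^+ j.+1)) (cvgn_exp (k := j.+1) (@cvgn_invn R)).
  rewrite expr0n mulr0 in h; apply: (eq_cvgn h) => n.
  by rewrite /p -mul2n [RHS]exprM -exprMn (expr_div_n m) sqE.
have h := cvgnM (cvgn_cst (l := 2 ^+ p)) (cvgnD hm
  (cvgnM (cvgn_cst (l := 3 ^+ p)) (energy_cvg0 (p := p) isT))).
rewrite mulr0 addr0 mulr0 in h.
apply: (dom_cvgn0 (N := 2) h) => n n1.
rewrite ger0_norm; last first.
  by apply: mexp_ge0 => // s; rewrite /p -mul2n exprM exprn_ge0// sqr_ge0.
rewrite -mexpZ -[(m / sq n) ^+ p](mexp_cst hq n) -mexpD -mexpZ.
apply: ler_mexp => // s; have /andP[r0 r1] := rest_bound s n1.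
have n0 : (0 < n)%N by lia.
have sN := sq_gt0 n0; have nR : (0 : R) < n%:R by rewrite ltr0n.
set x := m / sq n in r1 *.
have x0 : 0 <= x by rewrite divr_ge0// ltW.
rewrite -exprMn mulrA; set y := 3 * _ / _ in r1 *.
have y0 : 0 <= y by rewrite divr_ge0// ?mulr_ge0// ltW.
apply: (@le_trans _ _ ((x + y) ^+ p)).
  by rewrite lerXn2r ?nnegrE// addr_ge0.
have [xy|xy] := leP x y.
  apply: (@le_trans _ _ ((2 * y) ^+ p)).
    by apply: lerXn2r; [exact: addr_ge0|exact: mulr_ge0|rewrite mulr_natl mulr2n lerD2r].
  by rewrite exprMn ler_wpM2l ?exprn_ge0// lerDr exprn_ge0.
apply: (@le_trans _ _ ((2 * x) ^+ p)).
  apply: lerXn2r; [exact: addr_ge0|exact: mulr_ge0|].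
  by rewrite mulr_natl mulr2n lerD2l ltW.
by rewrite exprMn ler_wpM2l ?exprn_ge0// lerDl exprn_ge0.
Qed.

Let b_cvg : b n @[n --> \oo] --> (k`!%:R^-1 : R).
Proof.
have h1 := @cvgn_binom_pow R k.
have h2 : 'C(n.+2 - 2, k)%:R / (n.+2%:R : R) ^+ k @[n --> \oo] --> (k`!%:R^-1 : R).
  have hr1 : (n%:R / n.+2%:R : R) ^+ k @[n --> \oo] --> (1 ^+ k : R).
    apply: cvgn_exp.
    have h0 : (n.+2%:R : R)^-1 @[n --> \oo] --> (0 : R).
      by have := @cvgn_invn R; rewrite -(cvg_shiftn 2); under eq_fun do rewrite addn2.
    have h3 := cvgnB (cvgn_cst (l := 1 : R)) (cvgnM (cvgn_cst (l := 2 : R)) h0).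
    rewrite mulr0 subr0 in h3; apply: (eq_cvgn h3) => n.
    have : (n.+2%:R : R) != 0 by rewrite pnatr_eq0.
    rewrite -[n.+2]addn2 natrD; move=> x0; field; exact: x0.
  have h3 := cvgnM h1 hr1; rewrite expr1n mulr1 in h3.
  apply: (near_eq_cvgn (N := 1) h3) => n n0; rewrite subn2/= expr_div_n.
  have nX : (n%:R ^+ k : R) != 0 by rewrite expf_neq0// pnatr_eq0 -lt0n.
  have nY : (n.+2%:R ^+ k : R) != 0 by rewrite expf_neq0// pnatr_eq0.
  by move: (n%:R ^+ k : R) (n.+2%:R ^+ k : R) nX nY => X Y X0 Y0; field; rewrite X0 Y0.
rewrite -(cvg_shiftn 2); apply: (eq_cvgn h2) => n.
by rewrite /b addn2.
Qed.

Let main_momentE n p :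
  mexp q (fun s : 'S_n => main s ^+ p) = (- b n) ^+ p * (inv_moment q n p / sq n ^+ p).
Proof.
rewrite mulrA [RHS]mulrAC /inv_moment -mexpZ; apply: eq_mexp => s.
by rewrite /main exprMn expr_div_n -/m; ring.
Qed.

Let main_moment p : mexp q (fun s : 'S_n => main s ^+ p) @[n --> \oo] --> normal_moment g p.
Proof.
have bN : - b n @[n --> \oo] --> (- (k`!%:R^-1) : R) by exact: cvgN b_cvg.
have hb := cvgn_exp (k := p) bN.
suff [L hL eL] : exists2 L : R, inv_moment q n p / sq n ^+ p @[n --> \oo] --> L &
    (- (k`!%:R^-1)) ^+ p * L = normal_moment g p.
  by rewrite -eL; apply: (eq_cvgn (cvgnM hb hL)) => n; rewrite main_momentE.
have [s [ps|ps]] : exists s, p = s.*2 \/ p = s.*2.+1.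
  by exists p./2; lia.
- subst p; exists ((\prod_(i < s) (i.*2.+1)%:R) * v ^+ s).
    by apply: (eq_cvgn (@inv_moment_even R q hq s)) => n; rewrite [in RHS](_ : sq n ^+ s.*2 = n%:R ^+ s)// -mul2n exprM sqE.
  rewrite normal_moment_even ?variance_gt0// mulrCA; congr (_ * _).
  by rewrite -mul2n exprM -exprMn /g sqrrN exprVn mulrC.
(* An odd moment of order 2s + 1 is O(n^s), against the normalisation n^(s + 1/2). *)
- subst p; exists 0; last by rewrite mulr0 normal_moment_odd// variance_gt0.
  have [B B0 HB] := inv_moment_bound hq s.*2.+1.
  have h := cvgnM (cvgn_cst (l := B * 2 ^+ s)) inv_sq_cvg; rewrite mulr0 in h.
  apply: (dom_cvgn0 (N := 1) h) => n n0.
  have sN := sq_gt0 n0; have nR : (0 : R) < n%:R by rewrite ltr0n.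
  rewrite normrM normfV (ger0_norm (exprn_ge0 _ (ltW sN))) ler_pdivrMr ?exprn_gt0//.
  apply: le_trans (HB n) _; rewrite -mulrA -mulrA ler_wpM2l//.
  rewrite exprS mulKf ?gt_eqF// -mul2n exprM sqE.
  rewrite (_ : (2 * s).+1./2 = s)%N; last by lia.
  exact: succ_pow_bound.
Qed.

(** In the expansion of (main + rest)^p the pure power of [main] gives the limit; by Cauchy-Schwarz
    the other terms vanish, since even moments of [main] converge while those of [rest] tend to
    0. *)
Lemma normalized_count_moment p :
  mexp q (fun s : 'S_n => normalized_count s ^+ p) @[n --> \oo] --> normal_moment g p.
Proof.
have E n : mexp q (fun s : 'S_n => normalized_count s ^+ p) =
    \sum_(j < p.+1) 'C(p, j)%:R * mexp q (fun s : 'S_n => main s ^+ (p - j) * rest s ^+ j).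
  rewrite -(eq_bigr _ (fun j _ => mexpZ _ _ _)) -mexp_sum; apply: eq_mexp => s.
  have -> : normalized_count s = main s + rest s by rewrite /rest addrC subrK.
  by rewrite exprDn; apply: eq_bigr => j _; rewrite -mulr_natl.
pose L (j : 'I_p.+1) : R := if (j : nat) == 0%N then normal_moment g p else 0.
have -> : normal_moment g p = \sum_(j < p.+1) L j.
  by rewrite big_ord_recl /L/= big1 ?addr0.
suff h : \sum_(j < p.+1) 'C(p, j)%:R *
    mexp q (fun s : 'S_n => main s ^+ (p - j) * rest s ^+ j) @[n --> \oo] --> \sum_(j < p.+1) L j.
  by apply: (eq_cvgn h) => n; rewrite E.
apply: cvgn_sum => -[[|j] jp]; rewrite /L/=.
  apply: (eq_cvgn (@main_moment p)) => n; rewrite bin0 mul1r subn0.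
  by apply: eq_mexp => s; rewrite expr0 mulr1.
have h1 := cvgnM (@main_moment (p - j.+1).*2) (@rest_moment j).
rewrite mulr0 in h1.
have h2 : mexp q (fun s : 'S_n => main s ^+ (p - j.+1) * rest s ^+ j.+1) ^+ 2
    @[n --> \oo] --> (0 : R).
  apply: (dom_cvgn0 (N := 0) h1) => n _; rewrite ger0_norm ?sqr_ge0//.
  apply: le_trans (sqr_mexpM hq _ _) _.
  rewrite le_eqVlt; apply/orP; left; apply/eqP; congr (_ * _).
    by apply: eq_mexp => s; rewrite -exprM muln2.
  by apply: eq_mexp => s; rewrite -exprM muln2.
have h3 : mexp q (fun s : 'S_n => main s ^+ (p - j.+1) * rest s ^+ j.+1)
    @[n --> \oo] --> (0 : R).
  apply/cvgn_dist => e e0; have e2 : 0 < e ^+ 2 by rewrite exprn_gt0.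
  have /cvgn_dist/(_ _ e2)[N HN] := h2; exists N => n Nn.
  have := HN n Nn; rewrite !subr0 normrX.
  by rewrite ler_pXn2r ?nnegrE ?(ltW e0).
have := cvgnM (cvgn_cst (l := 'C(p, j.+1)%:R)) h3; by rewrite mulr0.
Qed.

(** As (2j - 1)!! / (2j)! = 1 / (2^j j!), the sequence is (a g / 2)^j / j!, the general term of an
    exponential series. *)
Lemma normal_moment_tails (a : R) :
  a ^+ j * normal_moment g j.*2 / (j.*2)`!%:R @[j --> \oo] --> (0 : R).
Proof.
have h := @cvg_exp_coeff R (a * g / 2).
apply: (eq_cvgn (u := fun j => (a * g / 2) ^+ j / j`!%:R)); first exact: h.
move=> j; rewrite normal_moment_even ?variance_gt0// fact_double !natrM natrX.
have -> : (\prod_(i < j) i.*2.+1)%:R = \prod_(i < j) (i.*2.+1)%:R :> R.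
  by rewrite natr_prod.
have P0 : (\prod_(i < j) (i.*2.+1)%:R : R) != 0.
  by apply/prodf_neq0 => i _; rewrite pnatr_eq0.
have F0 : (j`!%:R : R) != 0 by rewrite pnatr_eq0 -lt0n fact_gt0.
have T0 : (2 ^+ j : R) != 0 by rewrite expf_neq0.
rewrite (expr_div_n (a * g)) (exprMn _ a).
by move: (\prod_(i < j) _) (2 ^+ j : R) (a ^+ j) (g ^+ j) P0 T0 => x y z t x0 y0;
  field; rewrite F0 x0 y0.
Qed.

End NormalizedMoments.

Theorem theorem2p6 (R : realType) (r : nat) (q : R)
  (hr : (2 <= r)%N) (hq : 0 < q < 1)
  (* tau_n ~ Mallows(n, q), each on its own probability space *)
  (d : nat -> measure_display) (T : forall n, measurableType (d n))
  (P : forall n, probability (T n) R) (tau : forall n, T n -> 'S_n)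
  (htau : forall n, (1 <= n)%N -> is_Mallows (P n) q (tau n))
  (dB : measure_display) (TB : measurableType dB) (PB : probability TB R)
  (B : TB -> finperm) (hB : is_MBlock PB q B) :
  let X := fun n (w : T n) => normalized_occ PB B r (tau n w) in
  let N := normal_prob 0 (Num.sqrt (gamma_sq PB B r)) in
  [/\ 0 < gamma_sq PB B r,
      cvg_in_distribution P X N &
      cvg_moments P X N].
Proof.
move=> X N; have gE := gamma_sq_MBlock hq hB r.
have g0 : 0 < gamma_sq PB B r by rewrite gE variance_gt0.
have XE n w : X n w = normalized_count q r (tau n w).
  by rewrite /X /normalized_occ (mean_ratio_MBlock hq hB).
(* Defined for every n; it is the expectation of f (X n) from n = 1 on, where the law of [tau n] is
   prescribed. *)
pose E n (f : R -> R) := mexp q (fun s : 'S_n => f (normalized_count q r s)).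
have expE n f : (1 <= n)%N -> ('E_(P n)[fun w => f (X n w)] = (E n f)%:E)%E.
  move=> n1; rewrite unlock -(integral_Mallows (htau n n1)).
  by apply: eq_integral => w _; rewrite XE.
have cvgE f (l : R) : E n f @[n --> \oo] --> l ->
    (('E_(P n)[fun w => f (X n w)])%E @[n --> \oo] --> l%:E)%E.
  move=> h; have h' : ((E n f)%:E @[n --> \oo] --> l%:E)%E by apply/fine_cvgP; split; [exact: nearW|exact: h].
  apply: cvg_trans h'; apply: near_eq_cvg.
  by exists 1%N => // n /= n1; rewrite expE.
have moments p : E n (fun x => x ^+ p) @[n --> \oo] --> normal_moment (gamma_sq PB B r) p.
  by rewrite gE; exact: normalized_count_moment.
split => // [f cf [M fM]|p]; last first.
  have -> : ('E_N[fun x : R => (x ^+ p)%R] = (normal_moment (gamma_sq PB B r) p)%:E)%E.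
    by rewrite unlock integral_normal_moment.
  exact: cvgE (moments p).
have [fi fl] : limit_agrees N E f.
  apply: (limit_agrees_bounded _ _ _ _ cf fM).
  - by move=> n a b f1 f2; rewrite /E mexpD !mexpZ.
  - by move=> n f1 f2 h; apply: ler_mexp => // s; exact: h.
  - by move=> p; split; [exact: integrable_normal_pow|exact: moments].
  - by move=> a; have := normal_moment_tails r hq a; rewrite -gE.
have -> : ('E_N[f] = (fine (\int[N]_x (f x)%:E))%:E)%E.
  by rewrite unlock fineK// (integrable_fin_num measurableT fi).
exact: cvgE fl.
Qed.
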